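(* Let $(\mathcal M,g)$ be a conformally recurrent pseudo-Riemannian manifold of dimension $n\ge 5$ with recurrence vector $\alpha_i$ and with $C^2=C_{jklm}C^{jklm}\ne 0$. Define the symmetric tensor $h_{ij}=\frac{1}{C^2}C_i{}^{klm}C_{jklm}$, and assume that $h_{ij}$ is not proportional to the metric. Then: (i) $h_{ij}$ is covariantly constant: $\nabla_k h_{ij}=0$. (ii) The traceless part of the Ricci tensor is proportional to the traceless part of $h_{ij}$: there is a scalar function $G$ such that $$R_{ij}-\frac{R}{n}g_{ij}=G\left(\frac{1}{C^2}C_{iklm}C_j{}^{klm}-\frac{1}{n}g_{ij}\right).$$ (iii) The Ricci tensor has at most two distinct eigenvalues, and the recurrence vector is an eigenvector of the Ricci tensor.
   Context: Manifolds are smooth, connected, Hausdorff, with a non-degenerate metric $g$ of arbitrary signature and Levi-Civita connection $\nabla$. Conventions: $[\nabla_j,\nabla_k]v_l=R_{jkl}{}^m v_m$, $R_{kl}=-R_{mkl}{}^m$ (Ricci tensor), $R=g^{ij}R_{ij}$ (curvature scalar). The Weyl tensor is $$C_{jkl}{}^m=R_{jkl}{}^m+\tfrac{1}{n-2}(\delta_j{}^mR_{kl}-\delta_k{}^mR_{jl}+R_j{}^mg_{kl}-R_k{}^mg_{jl})-R\,\frac{\delta_j{}^mg_{kl}-\delta_k{}^mg_{jl}}{(n-1)(n-2)}.$$ $(\mathcal M,g)$ is conformally recurrent if $\nabla_iC_{jklm}=\alpha_iC_{jklm}$ for a non-zero covector field $\alpha_i$, called the recurrence vector. *)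

(* Defs.v *)
From HB Require Import structures.
From mathcomp Require Import all_boot all_order all_algebra.
From mathcomp Require Import all_classical all_reals all_analysis.
From mathcomp Require Import complex.

Set Implicit Arguments.
Unset Strict Implicit.
Unset Printing Implicit Defensive.

Import Order.TTheory GRing.Theory Num.Theory.
Import numFieldNormedType.Exports.

Local Open Scope classical_set_scope.
Local Open Scope ring_scope.

(* Tensor fields are given by their components in the charts of an atlas, as
   functions of the coordinate vector x : 'rV[R]_n.  Derivatives are only ever
   evaluated at points of the open coordinate domain of a chart, so the values
   of components outside that domain are irrelevant. *)

Section SmoothFunctions.
Variables (R : realType) (n : nat).
Implicit Types (f : 'rV[R]_n -> R) (U : set 'rV[R]_n).

Definition partial (i : 'I_n) f : 'rV[R]_n -> R :=
  fun x => 'D_(delta_mx 0 i) f x.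

(* C^oo on an open set U: the iterated partial derivatives of f of all orders
   (order 0 being f itself) are differentiable, hence continuous, on U. *)
Definition smooth_on U f : Prop :=
  forall (s : seq 'I_n) x, U x -> differentiable (foldr partial f s) x.

End SmoothFunctions.

Record chart (R : realType) (n : nat) (M : topologicalType) := Chart {
  cdom : set M;
  cmap : M -> 'rV[R]_n;
  cinv : 'rV[R]_n -> M;
  cdom_open : open cdom;
  cimg_open : open (cmap @` cdom);
  cmapK : forall p, cdom p -> cinv (cmap p) = p;
  cmap_continuous : {within cdom, continuous cmap};
  cinv_continuous : {within cmap @` cdom, continuous cinv} }.

Section Transition.
Variables (R : realType) (n : nat) (M : topologicalType).
Implicit Types c d : chart R n M.

Definition coords c : set 'rV[R]_n := cmap c @` cdom c.

Definition overlap c d : set 'rV[R]_n := cmap c @` (cdom c `&` cdom d).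

Definition transition c d (x : 'rV[R]_n) : 'rV[R]_n := cmap d (cinv c x).

(* (jacobian c d x) i a = d y^a / d x^i, where x (resp. y) are the coordinates
   of c (resp. d). *)
Definition jacobian c d (x : 'rV[R]_n) : 'M[R]_n :=
  \matrix_(i, a) partial i (fun z => transition c d z 0 a) x.

End Transition.

Record manifold (R : realType) (n : nat) := Manifold {
  carrier :> topologicalType;
  atlas : set (chart R n carrier);
  manifold_connected : connected [set: carrier];
  manifold_hausdorff : hausdorff_space carrier;
  atlas_cover : forall p : carrier, exists2 c, atlas c & cdom c p;
  atlas_smooth : forall c d, atlas c -> atlas d -> forall a : 'I_n,
    smooth_on (overlap c d) (fun x => transition c d x 0 a) }.

(* A metric is symmetric and non-degenerate, of arbitrary signature. *)
Record metric (R : realType) (n : nat) (M : manifold R n) := Metric {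
  metric_mx :> chart R n M -> 'rV[R]_n -> 'M[R]_n;
  metric_smooth : forall c, atlas c -> forall i j : 'I_n,
    smooth_on (coords c) (fun x => metric_mx c x i j);
  metric_tensor : forall c d, atlas c -> atlas d ->
    forall x, overlap c d x ->
    metric_mx c x = jacobian c d x *m metric_mx d (transition c d x)
                    *m (jacobian c d x)^T;
  metric_sym : forall c, atlas c -> forall x, coords c x ->
    (metric_mx c x)^T = metric_mx c x;
  metric_nondeg : forall c, atlas c -> forall x, coords c x ->
    metric_mx c x \in unitmx }.

Record covector_field (R : realType) (n : nat) (M : manifold R n) :=
  CovectorField {
  covector_row :> chart R n M -> 'rV[R]_n -> 'rV[R]_n;
  covector_smooth : forall c, atlas c -> forall i : 'I_n,
    smooth_on (coords c) (fun x => covector_row c x 0 i);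
  covector_tensor : forall c d, atlas c -> atlas d ->
    forall x, overlap c d x ->
    covector_row c x = covector_row d (transition c d x)
                       *m (jacobian c d x)^T }.

Definition smooth_scalar (R : realType) (n : nat) (M : manifold R n)
    (G : M -> R) : Prop :=
  forall c, atlas c -> smooth_on (coords c) (fun x => G (cinv c x)).

(* Tensor calculus in one chart, g being the component matrix of the metric. *)
Section TensorCalculus.
Variables (R : realType) (n : nat) (g : 'rV[R]_n -> 'M[R]_n).
Implicit Types (i j k l m p q r : 'I_n) (x : 'rV[R]_n).

Definition ginv i j x : R := (invmx (g x)) i j.

(* christoffel m i j is Gamma^m_{ij}, for the Levi-Civita connection of g. *)
Definition christoffel m i j x : R :=
  2^-1 * \sum_p ginv m p x *
    (partial i (fun y => g y j p) x + partial j (fun y => g y i p) x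
     - partial p (fun y => g y i j) x).

(* nabla2 T k i j is nabla_k T_{ij}. *)
Definition nabla2 (T : 'I_n -> 'I_n -> 'rV[R]_n -> R) k i j x : R :=
  partial k (T i j) x
  - \sum_p christoffel p k i x * T p j x
  - \sum_p christoffel p k j x * T i p x.

(* nabla4 T i j k l m is nabla_i T_{jklm}. *)
Definition nabla4 (T : 'I_n -> 'I_n -> 'I_n -> 'I_n -> 'rV[R]_n -> R)
    i j k l m x : R :=
  partial i (T j k l m) x
  - \sum_p christoffel p i j x * T p k l m x
  - \sum_p christoffel p i k x * T j p l m x
  - \sum_p christoffel p i l x * T j k p m x
  - \sum_p christoffel p i m x * T j k l p x.

(* riemann j k l m is R_{jkl}^m, with the sign convention
   [nabla_j, nabla_k] v_l = R_{jkl}^m v_m; since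
   nabla_k v_l = d_k v_l - Gamma^m_{kl} v_m, the coefficient of v_m is *)
Definition riemann j k l m x : R :=
  partial k (christoffel m j l) x - partial j (christoffel m k l) x
  + \sum_p (christoffel p j l x * christoffel m k p x
            - christoffel p k l x * christoffel m j p x).

(* R_{kl} = - R_{mkl}^m *)
Definition ricci k l x : R := - \sum_m riemann m k l m x.

(* R_k^l *)
Definition ricci_up k l x : R := \sum_p ricci k p x * ginv p l x.

Definition scalar_curv x : R := \sum_i \sum_j ginv i j x * ricci i j x.

Definition kron i j : R := (i == j)%:R.

(* weyl_up j k l m is C_{jkl}^m. *)
Definition weyl_up j k l m x : R :=
  riemann j k l m x
  + (n%:R - 2)^-1 * (kron j m * ricci k l x - kron k m * ricci j l x
                     + ricci_up j m x * g x k l - ricci_up k m x * g x j l)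
  - scalar_curv x * ((kron j m * g x k l - kron k m * g x j l)
                     / ((n%:R - 1) * (n%:R - 2))).

(* C_{jklm} *)
Definition weyl j k l m x : R := \sum_p weyl_up j k l p x * g x p m.

(* weyl_raised j k l m is C_j^{klm}. *)
Definition weyl_raised j k l m x : R :=
  \sum_p \sum_q \sum_r
    weyl j p q r x * ginv p k x * ginv q l x * ginv r m x.

(* C_i^{klm} C_{jklm} *)
Definition weyl_contr i j x : R :=
  \sum_k \sum_l \sum_m weyl_raised i k l m x * weyl j k l m x.

(* C^2 = C_{jklm} C^{jklm} *)
Definition weyl_sq x : R := \sum_i \sum_j ginv i j x * weyl_contr i j x.

Definition htensor i j x : R := (weyl_sq x)^-1 * weyl_contr i j x.

(* The Ricci tensor as the endomorphism v_i |-> v_j R^j_i of covectors (row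
   vectors). *)
Definition ricci_endo x : 'M[R]_n :=
  \matrix_(j, i) \sum_p ginv j p x * ricci p i x.

End TensorCalculus.

(* The recurrence vector alpha is non-zero at every point. *)
Definition conformally_recurrent (R : realType) (n : nat) (M : manifold R n)
    (g : metric M) (alpha : covector_field M) : Prop :=
  (forall c, atlas c -> forall x, coords c x -> alpha c x != 0) /\
  (forall c, atlas c -> forall x, coords c x -> forall i j k l m : 'I_n,
     nabla4 (g c) (weyl (g c)) i j k l m x
     = alpha c x 0 i * weyl (g c) j k l m x).

(* Eigenvalues are taken in R[i], since for an indefinite metric the Ricci
   endomorphism need not have real eigenvalues. *)
Definition at_most_two_eigenvalues (R : realType) (n : nat) (A : 'M[R]_n) :
    Prop :=
  exists a b : R[i], forall z : R[i],
    eigenvalue (map_mx (real_complex R) A) z -> z = a \/ z = b.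

(* Main.v *)
From mathcomp Require Import all_boot all_order all_algebra.
From mathcomp Require Import all_classical all_reals all_analysis.
From mathcomp Require Import complex ring lra.
Require Import Defs.
Set Implicit Arguments.
Unset Strict Implicit.
Unset Printing Implicit Defensive.
Import Order.TTheory GRing.Theory Num.Theory.
Import numFieldNormedType.Exports.
Local Open Scope classical_set_scope.
Local Open Scope ring_scope.

(** The second Bianchi identity and the recurrence of C give the condition [bianchi] on alpha,
    which relates the cyclic sum of alpha_i C_jklm to C_jklm alpha^m.  It is linear, so that,
    by differentiation, every nabla_k alpha satisfies it too; contracted with C^jklm it says
    that h alpha = mu alpha with mu = (n-3)/(2(n-2)).

    If a non-zero null covector, possibly complex, satisfies it, then C has a normal form
    from which (h - mu)(h - nu) = 0 with nu = 1/(n-2)^2, and C_iklm h^kl is a combination of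
    g and h.  Since h is parallel, R.h = 0; a contraction of this relation then forces the
    Schouten tensor to be a combination of g and h as well.

    The complex span of alpha and nabla_k alpha contains such a null covector unless alpha is
    non-null and nabla_k alpha is proportional to alpha for all k.  The latter cannot happen on
    an open set: alpha alpha / alpha^2 would be parallel, so that R_jklm alpha^m = 0, and the
    second Bianchi identity would give alpha^i nabla_i R_jklm = 0, hence C = 0.  So the two
    conclusions hold on a dense set, and everywhere by continuity.

    The scalar G does not depend on the chart, because it can be read off the curvature scalar
    and the eigenvalue of the Ricci tensor on alpha. *)

(** * Contractions *)

(** At a single point, a non-null covector subject to [bianchi] says too little: C may still depend
    on an arbitrary trace-free symmetric form on the orthogonal complement of beta, and then h can
    have many eigenvalues. This is why null covectors are sought, at the price of complex scalars,
    and why one case has to be excluded on open sets, by differentiation, before continuity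
    concludes. A null beta brings in a second covector f with beta.f <> 0; h acts by mu on the plane
    of beta and f and by nu on its orthogonal complement, and tr h = 1 reads 2 mu + (n - 2) nu = 1,
    which is the origin of nu. Once C_iklm h^kl is known, the contraction of R.h = 0 says that n S h
    = S modulo g and h. With the quadratic relation for h this determines S, because 1/n lies
    strictly between nu and mu, hence is no eigenvalue of h. To survive the descent from complex to
    real scalars and the passage to the limit, the conclusions are stated as equations that mention
    neither beta nor an unknown coefficient: see [special] and [coefG]. *)

Section Contraction.
Variables (K : comNzRingType) (n : nat).
Implicit Types (v F G : 'I_n -> K) (X Y : 'I_n -> 'I_n -> K) (g : 'M[K]_n).

(** Contractions act on arbitrary functions of the indices, not on matrices, so that any slots of
    any tensor expression can be contracted by abstracting them. In use [v] is a raised covector and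
    the matrix of [ctr] is the inverse metric. *)
Definition app v F := \sum_m v m * F m.
Definition ctr g X := \sum_p \sum_q g p q * X p q.

(* [ev v F r] and [ev2 g X r] assert the value of a contraction: the tactics [ev_solve]
   and [ctr_solve] read [r] off the shape of [F] or [X] by unification, calling [lf] on
   the subterms which linearity and the metric do not evaluate. *)
Definition ev v F r := app v F = r.
Definition ev2 g X r := ctr g X = r.

Lemma ev_eval v F r r' : ev v F r -> r = r' -> app v F = r'.
Proof. by move=> -> ->. Qed.
Lemma ctr_eval g X r r' : ev2 g X r -> r = r' -> ctr g X = r'.
Proof. by move=> -> ->. Qed.

Lemma evD v F G a b : ev v F a -> ev v G b -> ev v (fun m => F m + G m) (a + b).
Proof. by move=> <- <-; rewrite /ev /app -big_split; apply: eq_bigr => m _; rewrite mulrDr. Qed.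
Lemma evN v F a : ev v F a -> ev v (fun m => - F m) (- a).
Proof. by move=> <-; rewrite /ev /app -sumrN; apply: eq_bigr => m _; rewrite mulrN. Qed.
Lemma evMl v F a c : ev v F a -> ev v (fun m => c * F m) (c * a).
Proof. by move=> <-; rewrite /ev /app mulr_sumr; apply: eq_bigr => m _; rewrite mulrCA. Qed.
Lemma evMr v F a c : ev v F a -> ev v (fun m => F m * c) (a * c).
Proof. by move=> <-; rewrite /ev /app mulr_suml; apply: eq_bigr => m _; rewrite mulrA. Qed.
Lemma ev_refl v F : ev v F (app v F).
Proof. by []. Qed.
Lemma ev0 v : ev v (fun=> 0) 0.
Proof. by rewrite /ev /app big1 // => m _; rewrite mulr0. Qed.

Lemma eq_app v F G : F =1 G -> app v F = app v G.
Proof. by move=> FG; apply: eq_bigr => m _; rewrite FG. Qed.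

Lemma eq_ctr g X Y : X =2 Y -> ctr g X = ctr g Y.
Proof. by move=> XY; apply: eq_bigr => p _; apply: eq_bigr => q _; rewrite XY. Qed.

Lemma ctrD g X Y a b : ev2 g X a -> ev2 g Y b -> ev2 g (fun p q => X p q + Y p q) (a + b).
Proof.
move=> <- <-; rewrite /ev2 /ctr -big_split; apply: eq_bigr => p _.
by rewrite -big_split; apply: eq_bigr => q _; rewrite mulrDr.
Qed.
Lemma ctrN g X a : ev2 g X a -> ev2 g (fun p q => - X p q) (- a).
Proof.
move=> <-; rewrite /ev2 /ctr -sumrN; apply: eq_bigr => p _.
by rewrite -sumrN; apply: eq_bigr => q _; rewrite mulrN.
Qed.
Lemma ctrMl g X a c : ev2 g X a -> ev2 g (fun p q => c * X p q) (c * a).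
Proof.
move=> <-; rewrite /ev2 /ctr mulr_sumr; apply: eq_bigr => p _.
by rewrite mulr_sumr; apply: eq_bigr => q _; rewrite mulrCA.
Qed.
Lemma ctrMr g X a c : ev2 g X a -> ev2 g (fun p q => X p q * c) (a * c).
Proof.
move=> <-; rewrite /ev2 /ctr mulr_suml; apply: eq_bigr => p _.
by rewrite mulr_suml; apply: eq_bigr => q _; rewrite mulrA.
Qed.
Lemma ctr_refl g X : ev2 g X (ctr g X).
Proof. by []. Qed.
Lemma ctr_ext g X Y a : X =2 Y -> ev2 g Y a -> ev2 g X a.
Proof. by move=> XY <-; apply: eq_ctr. Qed.
Lemma ctr_C g X a : g^T = g -> ev2 g X a -> ev2 g (fun p q => X q p) a.
Proof.
move=> gs <-; rewrite /ev2 /ctr exchange_big; apply: eq_bigr => p _.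
by apply: eq_bigr => q _; rewrite -{1}gs mxE.
Qed.

Definition up g v p := \sum_q g p q * v q.

Lemma ctr_vl g v (F : 'I_n -> K) a : g^T = g -> ev (up g v) F a -> ev2 g (fun p q => v p * F q) a.
Proof.
move=> gs <-; rewrite /ev2 /ctr exchange_big /app; apply: eq_bigr => q _.
by rewrite /up mulr_suml; apply: eq_bigr => p _; rewrite -{1}gs mxE mulrA.
Qed.
Lemma ctr_vr g v (F : 'I_n -> K) a : g^T = g -> ev (up g v) F a -> ev2 g (fun p q => v q * F p) a.
Proof. by move=> gs h; apply: ctr_C gs (ctr_vl gs h). Qed.
Lemma ctr_lv g v (F : 'I_n -> K) a : g^T = g -> ev (up g v) F a -> ev2 g (fun p q => F p * v q) a.
Proof. by move=> gs h; apply: ctr_ext (ctr_vr gs h) => p q; rewrite mulrC. Qed.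
Lemma ctr_rv g v (F : 'I_n -> K) a : g^T = g -> ev (up g v) F a -> ev2 g (fun p q => F q * v p) a.
Proof. by move=> gs h; apply: ctr_ext (ctr_vl gs h) => p q; rewrite mulrC. Qed.

Lemma ctr_Dl g X X' Y a b : ev2 g (fun p q => X p q * Y p q) a -> ev2 g (fun p q => X' p q * Y p q) b ->
  ev2 g (fun p q => (X p q + X' p q) * Y p q) (a + b).
Proof. by move=> ha hb; apply: ctr_ext (ctrD ha hb) => p q; rewrite mulrDl. Qed.
Lemma ctr_Dr g X X' Y a b : ev2 g (fun p q => Y p q * X p q) a -> ev2 g (fun p q => Y p q * X' p q) b ->
  ev2 g (fun p q => Y p q * (X p q + X' p q)) (a + b).
Proof. by move=> ha hb; apply: ctr_ext (ctrD ha hb) => p q; rewrite mulrDr. Qed.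
Lemma ctr_Nl g X Y a : ev2 g (fun p q => X p q * Y p q) a -> ev2 g (fun p q => - X p q * Y p q) (- a).
Proof. by move=> h; apply: ctr_ext (ctrN h) => p q; rewrite mulNr. Qed.
Lemma ctr_Nr g X Y a : ev2 g (fun p q => X p q * Y p q) a -> ev2 g (fun p q => X p q * - Y p q) (- a).
Proof. by move=> h; apply: ctr_ext (ctrN h) => p q; rewrite mulrN. Qed.
Lemma ctr_cl g X Y a c : ev2 g (fun p q => X p q * Y p q) a -> ev2 g (fun p q => (c * X p q) * Y p q) (c * a).
Proof. by move=> h; apply: ctr_ext (ctrMl c h) => p q; rewrite mulrA. Qed.
Lemma ctr_lc g X Y a c : ev2 g (fun p q => X p q * Y p q) a -> ev2 g (fun p q => (X p q * c) * Y p q) (c * a).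
Proof. by move=> h; apply: ctr_ext (ctrMl c h) => p q; rewrite mulrA (mulrC c). Qed.
Lemma ctr_cr g X Y a c : ev2 g (fun p q => X p q * Y p q) a -> ev2 g (fun p q => X p q * (c * Y p q)) (c * a).
Proof. by move=> h; apply: ctr_ext (ctrMl c h) => p q; rewrite mulrCA. Qed.
Lemma ctr_rc g X Y a c : ev2 g (fun p q => X p q * Y p q) a -> ev2 g (fun p q => X p q * (Y p q * c)) (c * a).
Proof. by move=> h; apply: ctr_ext (ctrMl c h) => p q; rewrite mulrA mulrC. Qed.
Lemma ctr_in g (X : 'I_n -> 'I_n -> 'I_n -> 'I_n -> K) r a :
  (forall p q, ev2 g (X p q) (r p q)) -> ev2 g r a -> ev2 g (fun p q => ctr g (X p q)) a.
Proof. by move=> h <-; apply: eq_ctr => p q; apply: h. Qed.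
Lemma ctr_app g v (X : 'I_n -> 'I_n -> 'I_n -> K) a :
  ev v (fun m => ctr g (fun p q => X p q m)) a -> ev2 g (fun p q => app v (X p q)) a.
Proof.
move=> <-; rewrite /ev2 /ctr /app.
transitivity (\sum_p \sum_q \sum_m g p q * (v m * X p q m)).
  by apply: eq_bigr => p _; apply: eq_bigr => q _; rewrite mulr_sumr.
under eq_bigr do rewrite exchange_big.
rewrite exchange_big; apply: eq_bigr => m _; rewrite mulr_sumr; apply: eq_bigr => p _.
by rewrite mulr_sumr; apply: eq_bigr => q _; rewrite mulrCA.
Qed.

Lemma ctr_eq0 g X : (forall p q, X p q = 0) -> ev2 g X 0.
Proof.
by move=> X0; rewrite /ev2 /ctr big1 // => p _; rewrite big1 // => q _; rewrite X0 mulr0.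
Qed.

Lemma ctr_exch g (X : 'I_n -> 'I_n -> 'I_n -> 'I_n -> K) :
  ctr g (fun p q => ctr g (fun r s => X p q r s)) = ctr g (fun r s => ctr g (fun p q => X p q r s)).
Proof.
have e (Z : 'I_n -> 'I_n -> 'I_n -> 'I_n -> K) : ctr g (fun p q => ctr g (Z p q)) =
    \sum_p \sum_q \sum_r \sum_s g p q * (g r s * Z p q r s).
  rewrite /ctr; do 2 (apply: eq_bigr => ? _); rewrite mulr_sumr.
  by apply: eq_bigr => r _; rewrite mulr_sumr.
rewrite !e.
under eq_bigr => p _ do rewrite exchange_big /=.
rewrite exchange_big /=; apply: eq_bigr => r _.
under eq_bigr => p _ do rewrite exchange_big /=.
rewrite exchange_big /=; apply: eq_bigr => s _.
by do 2 (apply: eq_bigr => ? _); rewrite mulrCA.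
Qed.

Lemma ctr_appE g v (X : 'I_n -> 'I_n -> 'I_n -> K) :
  ctr g (fun p q => app v (X p q)) = app v (fun m => ctr g (fun p q => X p q m)).
Proof. exact/ctr_app/ev_refl. Qed.

Lemma ctr_swap g X : g^T = g -> ctr g X = ctr g (fun p q => X q p).
Proof. by move=> gs; rewrite (ctr_C gs (ctr_refl g X)). Qed.

Lemma ctr_rot g (X : 'I_n -> 'I_n -> 'I_n -> 'I_n -> 'I_n -> 'I_n -> K) :
  ctr g (fun p p' => ctr g (fun q q' => ctr g (fun r r' => X p p' q q' r r'))) =
  ctr g (fun q q' => ctr g (fun r r' => ctr g (fun p p' => X p p' q q' r r'))).
Proof. by rewrite ctr_exch; apply: eq_ctr => q q'; rewrite ctr_exch. Qed.

Section Metric.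
Variables (g gi : 'M[K]_n).
Hypothesis gK : gi *m g = 1%:M.
Hypothesis gs : g^T = g.
Hypothesis gis : gi^T = gi.
Lemma ctr_gl i (F : 'I_n -> K) : ev2 gi (fun p q => g p i * F q) (F i).
Proof.
apply: ctr_vl => //; rewrite /ev /app (bigD1 i) //= big1 => [|m mi].
  by rewrite /up; have /matrixP/(_ i i) := gK; rewrite !mxE eqxx => ->; rewrite mul1r addr0.
by rewrite /up; have /matrixP/(_ m i) := gK; rewrite !mxE (negbTE mi) => ->; rewrite mul0r.
Qed.
Lemma ctr_gl' i (F : 'I_n -> K) : ev2 gi (fun p q => g i p * F q) (F i).
Proof. by apply: ctr_ext (ctr_gl i F) => p q; rewrite -{1}gs mxE. Qed.
Lemma ctr_gr i (F : 'I_n -> K) : ev2 gi (fun p q => g q i * F p) (F i).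
Proof. by apply: (ctr_C gis (ctr_gl i F)). Qed.
Lemma ctr_gr' i (F : 'I_n -> K) : ev2 gi (fun p q => g i q * F p) (F i).
Proof. by apply: (ctr_C gis (ctr_gl' i F)). Qed.
Lemma ctr_lg i (F : 'I_n -> K) : ev2 gi (fun p q => F q * g p i) (F i).
Proof. by apply: ctr_ext (ctr_gl i F) => p q; rewrite mulrC. Qed.
Lemma ctr_lg' i (F : 'I_n -> K) : ev2 gi (fun p q => F q * g i p) (F i).
Proof. by apply: ctr_ext (ctr_gl' i F) => p q; rewrite mulrC. Qed.
Lemma ctr_rg i (F : 'I_n -> K) : ev2 gi (fun p q => F p * g q i) (F i).
Proof. by apply: ctr_ext (ctr_gr i F) => p q; rewrite mulrC. Qed.
Lemma ctr_rg' i (F : 'I_n -> K) : ev2 gi (fun p q => F p * g i q) (F i).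
Proof. by apply: ctr_ext (ctr_gr' i F) => p q; rewrite mulrC. Qed.
Lemma ctr_gg : ev2 gi (fun p q => g p q) n%:R.
Proof.
rewrite /ev2 /ctr (eq_bigr (fun=> 1)).
  by rewrite big_const_ord iter_addr_0.
move=> p _; have /matrixP/(_ p p) := gK; rewrite !mxE eqxx => e; apply: etrans e.
by apply: eq_bigr => q _; rewrite -{1}gs mxE.
Qed.
Lemma ctr_gg' : ev2 gi (fun p q => g q p) n%:R.
Proof. by apply: ctr_C gis ctr_gg. Qed.
End Metric.
End Contraction.

(** Eta-expansion, so that the patterns of the solvers always meet a syntactic [fun]. *)
Ltac ev_eta :=
  lazymatch goal with |- ev ?v ?F ?r => change (ev v (fun m => F m) r); cbv beta end.
Ltac ctr_eta :=
  lazymatch goal with |- ev2 ?G ?X ?r => change (ev2 G (fun p q => X p q) r); cbv beta end.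
Ltac ev_solve lf :=
  ev_eta;
  first [ solve [lf]
        | lazymatch goal with
          | |- ev _ (fun m => _ + _) _ => eapply evD; [ev_solve lf | ev_solve lf]
          | |- ev _ (fun m => - _) _ => eapply evN; ev_solve lf
          | |- ev _ (fun m => _ * _) _ =>
            first [eapply evMl; ev_solve lf | eapply evMr; ev_solve lf]
          end
        | eapply ev_refl ].
(* After [ctr_in] the inner contraction is already in normal form, so the outer
   one must not try [ctr_in] again. *)
Ltac ctr_solve_flat g gK gs gis lf :=
  ctr_eta;
  first [ solve [lf]
        | lazymatch goal with
          | |- ev2 _ (fun p q => _ + _) _ => eapply ctrD; [ctr_solve_flat g gK gs gis lf | ctr_solve_flat g gK gs gis lf]
          | |- ev2 _ (fun p q => - _) _ => eapply ctrN; ctr_solve_flat g gK gs gis lf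
          | |- ev2 _ (fun p q => app ?v _) _ => eapply ctr_app; ev_solve lf
          | |- ev2 _ (fun p q => _ * _) _ =>
            first [ eapply ctrMl; ctr_solve_flat g gK gs gis lf
                  | eapply ctrMr; ctr_solve_flat g gK gs gis lf
                  | lazymatch goal with
                    | |- ev2 _ (fun p q => (@fun_of_matrix _ _ _ g p _) * _) _ => eapply (ctr_gl gK gis)
                    | |- ev2 _ (fun p q => (@fun_of_matrix _ _ _ g _ p) * _) _ => eapply (ctr_gl' gK gs gis)
                    | |- ev2 _ (fun p q => (@fun_of_matrix _ _ _ g q _) * _) _ => eapply (ctr_gr gK gis)
                    | |- ev2 _ (fun p q => (@fun_of_matrix _ _ _ g _ q) * _) _ => eapply (ctr_gr' gK gs gis)
                    end
                  | lazymatch goal with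
                    | |- ev2 _ (fun p q => _ * (@fun_of_matrix _ _ _ g p _)) _ => eapply (ctr_lg gK gis)
                    | |- ev2 _ (fun p q => _ * (@fun_of_matrix _ _ _ g _ p)) _ => eapply (ctr_lg' gK gs gis)
                    | |- ev2 _ (fun p q => _ * (@fun_of_matrix _ _ _ g q _)) _ => eapply (ctr_rg gK gis)
                    | |- ev2 _ (fun p q => _ * (@fun_of_matrix _ _ _ g _ q)) _ => eapply (ctr_rg' gK gs gis)
                    end
                  | lazymatch goal with
                    | |- ev2 _ (fun p q => (- _) * _) _ => eapply ctr_Nl; ctr_solve_flat g gK gs gis lf
                    | |- ev2 _ (fun p q => (_ + _) * _) _ => eapply ctr_Dl; [ctr_solve_flat g gK gs gis lf | ctr_solve_flat g gK gs gis lf]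
                    | |- ev2 _ (fun p q => (_ * _) * _) _ =>
                      first [eapply ctr_cl; ctr_solve_flat g gK gs gis lf | eapply ctr_lc; ctr_solve_flat g gK gs gis lf]
                    end
                  | lazymatch goal with
                    | |- ev2 _ (fun p q => _ * (- _)) _ => eapply ctr_Nr; ctr_solve_flat g gK gs gis lf
                    | |- ev2 _ (fun p q => _ * (_ + _)) _ => eapply ctr_Dr; [ctr_solve_flat g gK gs gis lf | ctr_solve_flat g gK gs gis lf]
                    | |- ev2 _ (fun p q => _ * (_ * _)) _ =>
                      first [eapply ctr_cr; ctr_solve_flat g gK gs gis lf | eapply ctr_rc; ctr_solve_flat g gK gs gis lf]
                    end ]
          | |- ev2 _ (fun p q => (@fun_of_matrix _ _ _ g p q)) _ => eapply (ctr_gg gK gs)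
          | |- ev2 _ (fun p q => (@fun_of_matrix _ _ _ g q p)) _ => eapply (ctr_gg' gK gs gis)
          end
        | eapply ctr_refl ].
(** A factor carrying the covector [v] is eliminated by evaluating the other factor on the raised
    [v]. *)
Ltac ctr_vec v gis lf :=
  idtac; lazymatch goal with
  | |- ev2 _ (fun p q => v p * _) _ => eapply (ctr_vl gis); lf
  | |- ev2 _ (fun p q => v q * _) _ => eapply (ctr_vr gis); lf
  | |- ev2 _ (fun p q => _ * v p) _ => eapply (ctr_rv gis); lf
  | |- ev2 _ (fun p q => _ * v q) _ => eapply (ctr_lv gis); lf
  end.
Ltac ctr_solve g gK gs gis lf :=
  ctr_eta;
  first [ solve [lf]
        | lazymatch goal with
          | |- ev2 _ (fun p q => _ + _) _ => eapply ctrD; [ctr_solve g gK gs gis lf | ctr_solve g gK gs gis lf]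
          | |- ev2 _ (fun p q => - _) _ => eapply ctrN; ctr_solve g gK gs gis lf
          | |- ev2 _ (fun p q => _ * _) _ => first [eapply ctrMl; ctr_solve g gK gs gis lf | eapply ctrMr; ctr_solve g gK gs gis lf]
          | |- ev2 _ (fun p q => ctr _ _) _ => eapply ctr_in; [intros ? ?; ctr_solve g gK gs gis lf | ctr_solve_flat g gK gs gis lf]
          end
        | ctr_solve_flat g gK gs gis lf ].

(** * Algebraic Weyl tensors *)

Section WeylAlgebra.
Variables (K : numFieldType) (n : nat).
Variables (g gi : 'M[K]_n) (C : 'I_n -> 'I_n -> 'I_n -> 'I_n -> K).
Hypothesis n5 : (5 <= n)%N.
Hypothesis gK : gi *m g = 1%:M.
Hypothesis gs : g^T = g.
Hypothesis gis : gi^T = gi.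
Hypothesis C12 : forall j k l m, C j k l m = - C k j l m.
Hypothesis C34 : forall j k l m, C j k l m = - C j k m l.
Hypothesis Ccyc : forall j k l m, C j k l m + C k l j m + C l j k m = 0.
Hypothesis Ctr : forall k l, ctr gi (fun j m => C j k l m) = 0.
Local Notation N := (n%:R : K).

Lemma gC i j : g i j = g j i.
Proof. by rewrite -{1}gs mxE. Qed.

Lemma Nsub k : (k < n)%N -> N - k%:R != 0.
Proof. by move=> kn; rewrite subr_eq0 eqr_nat gtn_eqF. Qed.

(** The classical octahedron argument: the cyclic identities at the four rotations of j, k, l, m are
    added with signs +, +, -, -, and everything cancels except twice the claim. *)
Lemma pair_sym (T : 'I_n -> 'I_n -> 'I_n -> 'I_n -> K) :
  (forall j k l m, T j k l m = - T k j l m) -> (forall j k l m, T j k l m = - T j k m l) ->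
  (forall j k l m, T j k l m + T k l j m + T l j k m = 0) ->
  forall j k l m, T j k l m = T l m j k.
Proof.
move=> h1 h2 h3 j k l m.
have e1 := h3 j k l m; have e2 := h3 k l m j; have e3 := h3 l m j k; have e4 := h3 m j k l.
have two : (2 : K) != 0 by rewrite pnatr_eq0.
apply: (mulfI two); apply/eqP; rewrite -subr_eq0; apply/eqP.
have a2 : T k l m j = - T k l j m by rewrite h2.
have b2 : T l m k j = - T l m j k by rewrite h2.
have c2 : T m k l j = T k m j l by rewrite h1 h2 opprK.
have d2 : T m j l k = - T m j k l by rewrite h2.
have f2 : T j l m k = T l j k m by rewrite h1 h2 opprK.
have g2 : T j k m l = - T j k l m by rewrite h2.
rewrite {}a2 {}b2 {}c2 in e2; rewrite {}d2 {}f2 in e3; rewrite {}g2 in e4.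
rewrite -[RHS](_ : (T j k l m + T k l j m + T l j k m)
  + (- T k l j m + - T l m j k + T k m j l)
  - (T l m j k + - T m j k l + T l j k m)
  - (T m j k l + - T j k l m + T k m j l) = 0); first by ring.
by rewrite e1 e2 e3 e4; ring.
Qed.

Lemma Cpair j k l m : C j k l m = C l m j k.
Proof. exact: (pair_sym C12 C34 Ccyc). Qed.

Lemma tr13 k l : ev2 gi (fun p q => C p k q l) 0.
Proof.
apply: (ctr_ext (Y := fun p q => - C p k l q)) => [p q|]; first exact: C34.
by rewrite -oppr0; apply/ctrN/Ctr.
Qed.
Lemma tr23 k l : ev2 gi (fun p q => C k p q l) 0.
Proof.
apply: (ctr_ext (Y := fun p q => - C p k q l)) => [p q|]; first exact: C12.
by rewrite -oppr0; apply/ctrN/tr13.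
Qed.
Lemma tr24 k l : ev2 gi (fun p q => C k p l q) 0.
Proof.
apply: (ctr_ext (Y := fun p q => - C p k l q)) => [p q|]; first exact: C12.
by rewrite -oppr0; apply/ctrN/Ctr.
Qed.
Lemma self_opp (x : K) : x = - x -> x = 0.
Proof.
move=> e; have two : (2 : K) != 0 by rewrite pnatr_eq0.
by apply: (mulfI two); rewrite mulr0 mulr_natl mulr2n {1}e addNr.
Qed.
Lemma tr34 k l : ev2 gi (fun p q => C k l p q) 0.
Proof.
apply: self_opp; apply: etrans (ctrN (ctr_C gis (ctr_refl gi (fun p q => C k l p q)))).
by apply: eq_ctr => p q; exact: C34.
Qed.
Lemma tr12 k l : ev2 gi (fun p q => C p q k l) 0.
Proof. by apply: ctr_ext (tr34 k l) => p q; apply: Cpair. Qed.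

(** When beta is the recurrence vector, this is the divergence of C in its last slot. *)
Definition Dv (beta : 'I_n -> K) j k l := app (up gi beta) (C j k l).

(* The condition that the second Bianchi identity imposes on a recurrence covector of [C].
   It is linear in [beta]. *)
Definition bianchi (beta : 'I_n -> K) := forall i j k l m,
  (N - 3) * (beta i * C j k l m + beta j * C k i l m + beta k * C i j l m) =
  - (g i l * Dv beta j k m - g i m * Dv beta j k l
   + (g j l * Dv beta k i m - g j m * Dv beta k i l)
   + (g k l * Dv beta i j m - g k m * Dv beta i j l)).

Definition Hc i j := ctr gi (fun k k' => ctr gi (fun l l' => ctr gi (fun m m' => C i k l m * C j k' l' m'))).
Definition C2 := ctr gi Hc.
Definition hC i j := C2^-1 * Hc i j.
(* [mu] and [nu] turn out to be the eigenvalues of [hC]. *)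
Definition mu : K := (N - 3) / (2 * (N - 2)).
Definition nu : K := ((N - 2) ^+ 2)^-1.

Lemma Hc_sym i j : Hc i j = Hc j i.
Proof.
rewrite /Hc (ctr_swap _ gis); apply: eq_ctr => p p'; rewrite (ctr_swap _ gis).
by apply: eq_ctr => q q'; rewrite (ctr_swap _ gis); apply: eq_ctr => r r'; rewrite mulrC.
Qed.

Ltac trC := idtac; lazymatch goal with |- ev2 _ (fun p q => C _ _ _ _) _ =>
  first [apply: tr13 | apply: tr23 | apply: tr24 | apply: Ctr | apply: tr12 | apply: tr34
  | apply: (ctr_C gis (tr13 _ _)) | apply: (ctr_C gis (tr23 _ _)) | apply: (ctr_C gis (tr24 _ _)) | apply: (ctr_C gis (Ctr _ _))] end.

Section Any.
Variable beta : 'I_n -> K.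
Local Notation D := (Dv beta).
Local Notation a := (up gi beta).

Lemma D12 j k l : D j k l = - D k j l.
Proof.
apply: etrans (evN (ev_refl _ _)); apply: eq_app => m; exact: C12.
Qed.
Lemma Dcyc j k l : D j k l + D k l j + D l j k = 0.
Proof.
apply: etrans (etrans _ (ev0 a)); last first.
  by apply: eq_app => m; exact: (Ccyc j k l m).
by apply/esym/evD; [apply/evD|]; apply: ev_refl.
Qed.
Lemma trD k : ev2 gi (fun p q => D k p q) 0.
Proof.
rewrite /Dv; apply: ctr_app; by apply: etrans (ev0 a); apply: eq_app => m; exact: tr23.
Qed.
Lemma Da j k : app a (D j k) = 0.
Proof.
apply: self_opp; apply: etrans (evN (ev_refl _ _)).
rewrite /Dv /app; under eq_bigr do rewrite mulr_sumr.
rewrite exchange_big; apply: eq_bigr => m _; rewrite -sumrN mulr_sumr.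
by apply: eq_bigr => p _; rewrite mulrCA C34 !mulrN.
Qed.
End Any.

(** [Y] stands for the Cotton tensor. Contracting i with m expresses the divergence of C by (3 - n)
    Y and the trace y of Y; as the divergence is trace-free, a second trace gives (4 - 2n) y = 0. So
    Y can be eliminated in favour of C and alpha. *)
Lemma cotton_bianchi (alpha : 'I_n -> K) (Y : 'I_n -> 'I_n -> 'I_n -> K) :
  (forall j k l, Y j k l = - Y k j l) ->
  (forall i j k l m, alpha i * C j k l m + alpha j * C k i l m + alpha k * C i j l m =
     g i l * Y j k m - g i m * Y j k l + (g j l * Y k i m - g j m * Y k i l)
   + (g k l * Y i j m - g k m * Y i j l)) -> bianchi alpha.
Proof.
move=> Y12 B.
pose y k := ctr gi (fun p q => Y k p q).
have try_ k : ev2 gi (fun p q => Y p k q) (- y k).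
  by apply: (ctr_ext (Y := fun p q => - Y k p q)) => [p q|]; [exact: Y12 | exact: ctrN].
have e j k l : Dv alpha j k l = (3 - N) * Y j k l + g j l * y k - g k l * y j.
  have := eq_ctr gi (fun i m => B i j k l m).
  have -> : ctr gi (fun i m => alpha i * C j k l m + alpha j * C k i l m + alpha k * C i j l m) = Dv alpha j k l.
    apply: ctr_eval.
      ctr_solve g gK gs gis ltac:(first [trC | ctr_vec alpha gis ltac:(exact: ev_refl)]).
    by rewrite /Dv; ring.
  move=> ->; apply: ctr_eval.
    ctr_solve g gK gs gis ltac:(idtac; lazymatch goal with |- ev2 _ (fun p q => Y p _ q) _ => apply: try_ end).
  rewrite -/(y k) (Y12 k j l); ring.
have y0 j : y j = 0.
  have := trD alpha j; rewrite /ev2 (eq_ctr gi (Y := fun k l => _) (e j)).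
  rewrite -[ctr _ _](_ : (4 - 2 * N) * y j = _); last first.
    apply/esym; apply: ctr_eval.
      ctr_solve g gK gs gis ltac:(fail).
    rewrite -/(y j); ring.
  move=> /eqP; rewrite mulf_eq0 (_ : 4 - 2 * N = - 2 * (N - 2)); last by ring.
  by rewrite mulf_eq0 oppr_eq0 pnatr_eq0 (negbTE (Nsub (ltn_trans _ n5))) //= => /eqP.
have eY j k l : Dv alpha j k l = (3 - N) * Y j k l by rewrite e !y0; ring.
by move=> i j k l m; rewrite B !eY; ring.
Qed.

Section Bianchi.
Variable beta : 'I_n -> K.
Hypothesis Bb : bianchi beta.
Local Notation D := (Dv beta).
Local Notation a := (up gi beta).

Lemma up_g i : ev a (fun m => g i m) (beta i).
Proof. by apply: etrans (ctr_rg' gK gs gis i beta); apply/esym/(ctr_vl gis)/ev_refl. Qed.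
Lemma up_g' i : ev a (fun m => g m i) (beta i).
Proof. by apply: etrans (up_g i); apply: eq_app => m; apply: gC. Qed.

Ltac leafa := first [apply: up_g | apply: up_g' | apply: Da ].

(** Contracting [bianchi] with beta^m, the metric terms reproduce the cyclic sum on the left with
    coefficient 1, so that n - 4 times the sum vanishes. In dimension 4 this would say nothing. *)
Lemma alphaD i j k l : beta i * D j k l + beta j * D k i l + beta k * D i j l = 0.
Proof.
have := eq_app a (fun m => Bb i j k l m).
have -> : app a (fun m => (N - 3) * (beta i * C j k l m + beta j * C k i l m + beta k * C i j l m)) =
  (N - 3) * (beta i * D j k l + beta j * D k i l + beta k * D i j l).
  by apply: ev_eval; [ev_solve ltac:(leafa) | ].
rewrite [RHS](_ : _ = beta i * D j k l + beta j * D k i l + beta k * D i j l); last first.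
  by apply: ev_eval; [ev_solve ltac:(leafa) | ring].
move=> /eqP; rewrite -subr_eq0 -{2}[_ + beta k * _]mul1r -mulrBl mulf_eq0.
rewrite (_ : N - 3 - 1 = N - 4); last by ring.
by rewrite (negbTE (Nsub n5)) => /eqP.
Qed.

(** Contract [bianchi] with C^jklm and let X_i be the left-hand side here. The cyclic sum yields (n
    - 3)(C2 beta_i - 2 X_i). On the other side only the terms with g_il and g_im avoid a trace of C,
    and they yield 2 X_i. *)
Lemma contr_eigen i : app a (Hc i) = (N - 3) / (2 * (N - 2)) * C2 * beta i.
Proof.
pose T j k l m := (N - 3) * (beta i * C j k l m + beta j * C k i l m + beta k * C i j l m).
pose c4 F := ctr gi (fun m m' => ctr gi (fun k k' => ctr gi (fun j j' => ctr gi (fun l l' =>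
  F j k l m * C j' k' l' m')))).
have e0 : c4 T = (N - 3) * (beta i * C2 - 2 * app a (Hc i)).
  rewrite /c4 /T; apply: ctr_eval.
    ctr_solve g gK gs gis ltac:(first [trC | ctr_vec beta gis ltac:(exact: ev_refl)]).
  congr (_ * _); rewrite mulr_natl mulr2n opprD addrA; congr (_ + _ + _).
  - congr (_ * _); rewrite /C2 /Hc; apply/esym.
    under [LHS]eq_ctr => ? ? do rewrite -ctr_rot.
    rewrite ctr_exch; apply: eq_ctr => p p'.
    by rewrite ctr_exch.
  - apply: etrans (evN (ev_refl _ _)); apply: eq_app => m.
    rewrite ctr_rot; apply: etrans (ctrN (ctr_refl _ _)); apply: eq_ctr => p q.
    apply: etrans (ctrN (ctr_refl _ _)); apply: eq_ctr => p0 q0.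
    apply: etrans (ctrN (ctr_refl _ _)); apply: eq_ctr => p1 q1.
    by rewrite C12 mulNr.
  - apply: etrans (evN (ev_refl _ _)); apply: eq_app => m.
    rewrite ctr_rot; apply: etrans (ctrN (ctr_refl _ _)); apply: eq_ctr => p q.
    apply: etrans (ctrN (ctr_refl _ _)); apply: eq_ctr => p0 q0.
    apply: etrans (ctrN (ctr_refl _ _)); apply: eq_ctr => p1 q1.
    by rewrite [in LHS](C12 q) mulrN.
have e1 : c4 T = 2 * app a (Hc i).
  rewrite /c4 /T.
  transitivity (c4 (fun j k l m => - (g i l * D j k m - g i m * D j k l
   + (g j l * D k i m - g j m * D k i l) + (g k l * D i j m - g k m * D i j l)))).
    by do 4 (apply: eq_ctr => ? ?); rewrite Bb.
  rewrite /c4; apply: ctr_eval.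
    ctr_solve g gK gs gis ltac:(first [trC | ctr_vec beta gis ltac:(exact: ev_refl)]).
  have -> : ctr gi (fun p q => ctr gi (fun p0 q0 => ctr gi (fun p1 q1 => D p1 p0 p * C q1 q0 i q))) =
    - app a (Hc i).
    transitivity (app a (fun t => ctr gi (fun p q => ctr gi (fun p0 q0 => ctr gi (fun p1 q1 =>
        C p1 p0 p t * C q1 q0 i q))))).
      apply: etrans (ctr_appE _ _ _); apply: eq_ctr => p q.
      apply: etrans (ctr_appE _ _ _); apply: eq_ctr => p0 q0.
      apply: etrans (ctr_appE _ _ _); apply: eq_ctr => p1 q1.
      exact: esym (evMr _ (ev_refl _ _)).
    apply: etrans (evN (ev_refl _ _)); apply: eq_app => t.
    rewrite Hc_sym /Hc; apply: etrans (ctrN (ctr_refl _ _)); apply: eq_ctr => p q.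
    rewrite ctr_exch; apply: etrans (ctrN (ctr_refl _ _)); apply: eq_ctr => p0 q0.
    apply: etrans (ctrN (ctr_refl _ _)); apply: eq_ctr => p1 q1.
    by rewrite Cpair C12 mulNr (Cpair q0).
  have -> : ctr gi (fun p q => ctr gi (fun p0 q0 => ctr gi (fun p1 q1 => D p0 p p1 * C q0 q q1 i))) =
    app a (Hc i).
    transitivity (app a (fun t => ctr gi (fun p q => ctr gi (fun p0 q0 => ctr gi (fun p1 q1 =>
        C p0 p p1 t * C q0 q q1 i))))).
      apply: etrans (ctr_appE _ _ _); apply: eq_ctr => p q.
      apply: etrans (ctr_appE _ _ _); apply: eq_ctr => p0 q0.
      apply: etrans (ctr_appE _ _ _); apply: eq_ctr => p1 q1.
      exact: esym (evMr _ (ev_refl _ _)).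
    apply: eq_app => t; rewrite Hc_sym ctr_rot ctr_exch.
    do 3 (apply: eq_ctr => ? ?).
    by rewrite Cpair C12 [X in _ * X]Cpair [X in _ * X]C12 mulrNN.
  have -> : ctr gi (fun p q => ctr gi (fun p0 q0 => ctr gi (fun p1 q1 => D p0 i p1 * C p q0 q1 q))) = 0.
    rewrite ctr_rot; apply: ctr_eq0 => p q; apply: ctr_eq0 => p0 q0.
    by apply: etrans (ctrMl _ (Ctr _ _)) (mulr0 _).
  have -> : ctr gi (fun p q => ctr gi (fun p0 q0 => ctr gi (fun p1 q1 => D i p1 p * C q1 q0 p0 q))) = 0.
    apply: ctr_eq0 => p q; rewrite ctr_exch; apply: ctr_eq0 => p0 q0.
    by apply: etrans (ctrMl _ (ctr_C gis (tr23 _ _))) (mulr0 _).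
  have -> : ctr gi (fun p q => ctr gi (fun p0 q0 => ctr gi (fun p1 q1 => D i p0 p1 * C q0 p q1 q))) = 0.
    rewrite ctr_rot; apply: ctr_eq0 => p q; apply: ctr_eq0 => p0 q0.
    by apply: etrans (ctrMl _ (tr24 _ _)) (mulr0 _).
  ring.
have N2 : N - 2 != 0 by apply: Nsub; rewrite (ltn_trans _ n5).
have e : (N - 3) * (beta i * C2 - 2 * app a (Hc i)) = 2 * app a (Hc i) by rewrite -e0.
have two : (2 : K) != 0 by rewrite pnatr_eq0.
have -> : app a (Hc i) = (2 * (N - 2))^-1 * ((N - 3) * (beta i * C2 - 2 * app a (Hc i)) + 2 * app a (Hc i) * (N - 3)).
  by rewrite e; field; rewrite ?N2 ?two.
by field; rewrite ?N2 ?two.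
Qed.

Section Null.
Hypothesis null : app a beta = 0.
Hypothesis beta_neq0 : exists i, beta i != 0.

(** Contraction with such a vector is how a factor beta is split off from identities that are
    antisymmetrised with beta. *)
Lemma dual_vector : exists b : 'I_n -> K, app b beta = 1.
Proof.
have [i bi] := beta_neq0; exists (fun j => if j == i then (beta i)^-1 else 0).
rewrite /app (bigD1 i) //= eqxx mulVf // big1 ?addr0 // => j /negbTE ->; exact: mul0r.
Qed.

(* Contracting [alphaD] with a vector dual to [beta] gives D_jkl = beta_j E_kl - beta_k E_jl;
   a second contraction, of [Bb], determines E up to beta_k e_l. *)
Lemma null_divergence : exists c1 f, forall j k l,
  D j k l = c1 * (beta j * g k l - beta k * g j l) + (beta j * f k - beta k * f j) * beta l.
Proof.
have [b b1] := dual_vector.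
pose E k l := app b (fun i => D i k l).
have Es k l : ev b (fun i => D k i l) (- E k l).
  by apply: etrans (evN (ev_refl _ _)); apply: eq_app => i; apply: D12.
have DE j k l : D j k l = beta j * E k l - beta k * E j l.
  have := eq_app b (fun i => alphaD i j k l); rewrite (_ : app b (fun=> 0) = 0); last exact: ev0.
  have -> : app b (fun i => beta i * D j k l + beta j * D k i l + beta k * D i j l) =
      D j k l - beta j * E k l + beta k * E j l.
    apply: ev_eval.
      ev_solve ltac:(first [exact: b1 | exact: Es]).
    by rewrite /E; ring.
  move=> e; apply/eqP; rewrite -subr_eq0; apply/eqP; rewrite -[RHS]e; ring.
have Eb l : ev b (fun j => E j l) 0.
  apply: self_opp; rewrite /E /app.
  under eq_bigr do rewrite mulr_sumr.
  rewrite [LHS]exchange_big -sumrN; apply: eq_bigr => i _; rewrite -sumrN.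
  by apply: eq_bigr => j _; rewrite D12; ring.
pose e k := app b (E k).
have Ex k m : ev b (fun i => D k m i) (beta k * e m - beta m * e k).
  apply: etrans (eq_app b (fun i => DE k m i)) _; apply: ev_eval; first by ev_solve ltac:(fail).
  by [].
have eb : ev b e 0.
  rewrite /ev /e /app; under eq_bigr do rewrite mulr_sumr.
  rewrite exchange_big big1 // => i _; transitivity (b i * app b (E^~ i)).
    by rewrite /app mulr_sumr; apply: eq_bigr => j _; rewrite mulrCA.
  by rewrite Eb mulr0.
have Esym k m : E k m - beta m * e k = E m k - beta k * e m.
  have := eq_app b (fun i => Dcyc beta i k m); rewrite (_ : app b (fun=> 0) = 0); last exact: ev0.
  have -> : app b (fun i => D i k m + D k m i + D m i k) =
      E k m + (beta k * e m - beta m * e k) - E m k.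
    apply: ev_eval.
      ev_solve ltac:(first [exact: Es | exact: Ex]).
    by rewrite /E; ring.
  move=> h; apply/eqP; rewrite -subr_eq0; apply/eqP; rewrite -[RHS]h; ring.
(* F_kl = C_iklm beta^i beta^m. As beta is null, [alphaD] contracted with beta^i loses its first
   term and leaves beta_j F_kl = beta_k F_jl; F being symmetric, it is a multiple phi of beta
   beta. *)
pose F k l := app a (fun i => D i k l).
have Fs k l : ev a (fun i => D k i l) (- F k l).
  by apply: etrans (evN (ev_refl _ _)); apply: eq_app => i; apply: D12.
have FbF j k l : beta j * F k l = beta k * F j l.
  have := eq_app a (fun i => alphaD i j k l); rewrite (_ : app a (fun=> 0) = 0); last exact: ev0.
  have -> : app a (fun i => beta i * D j k l + beta j * D k i l + beta k * D i j l) =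
      - beta j * F k l + beta k * F j l.
    apply: ev_eval; first by ev_solve ltac:(first [exact: null | exact: Fs]).
    by rewrite /F; ring.
  by move=> h; apply/eqP; rewrite -subr_eq0; apply/eqP; rewrite -[RHS]oppr0 -[in RHS]h; ring.
have FC k l : F k l = F l k.
  rewrite /F /Dv /app; under eq_bigr do rewrite mulr_sumr.
  under [RHS]eq_bigr do rewrite mulr_sumr.
  rewrite exchange_big; apply: eq_bigr => i _; apply: eq_bigr => m _.
  by rewrite mulrCA Cpair C12 C34 opprK.
pose phi := app b (fun k => app b (fun l => F k l)).
have FE k l : F k l = phi * beta k * beta l.
  have F1 k' l' : F k' l' = beta k' * app b (F^~ l').
    rewrite -[LHS]mul1r -b1; apply: etrans (esym (evMr _ (ev_refl _ _))) _.
    by apply: etrans (evMl _ (ev_refl _ _)); apply: eq_app => j; rewrite FbF.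
  rewrite F1 (eq_app b (G := fun j => beta l * app b (F^~ j))) => [|j]; last by rewrite FC F1.
  rewrite (evMl _ (ev_refl _ _)).
  suff -> : app b (fun j => app b (F^~ j)) = phi by ring.
  by apply: eq_app => j; apply: eq_app => i; exact: FC.
(* [bianchi] contracted with beta^i: nullity removes the only term in which C itself would
   remain. *)
have step j k l m : (N - 3) * (beta j * D l m k - beta k * D l m j) =
  - (beta l * D j k m - beta m * D j k l + phi * (g j m * beta k * beta l - g j l * beta k * beta m
     + g k l * beta j * beta m - g k m * beta j * beta l)).
  have D3 k' : ev a (fun i => C k' i l m) (D l m k').
    by apply: eq_app => i; apply: Cpair.
  have D4 k' : ev a (fun i => C i k' l m) (- D l m k').
    apply: etrans (evN (ev_refl _ _)); apply: eq_app => i; rewrite Cpair; exact: C34.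
  have := eq_app a (fun i => Bb i j k l m).
  have -> : app a (fun i => (N - 3) * (beta i * C j k l m + beta j * C k i l m + beta k * C i j l m)) =
     (N - 3) * (beta j * D l m k - beta k * D l m j).
    apply: ev_eval; first ev_solve ltac:(first [exact: null | exact: D3 | exact: D4]).
    ring.
  move=> ->; apply: ev_eval; first ev_solve ltac:(first [exact: up_g' | exact: Fs]).
  rewrite -/(F j m) -/(F j l) !FE; ring.
pose bl m := app b (fun j => g j m).
have blE m : ev b (fun j => g m j) (bl m) by apply: eq_app => j; apply: gC.
pose gam := app b bl.
have N2 : N - 2 != 0 by apply: Nsub; rewrite (ltn_trans _ n5).
(* Contracting [step] with b in j and in l makes E appear on both sides, with coefficients n - 3 and
   -1; [Esym] lets them be added up to n - 2. *)
have EE k m : (N - 2) * (E m k - beta k * e m) = phi * (g k m + gam * beta k * beta m - bl k * beta m - bl m * beta k).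
  have h l : (N - 3) * (D l m k - beta k * (beta l * e m - beta m * e l)) =
    - (beta l * E k m - beta m * E k l + phi * (bl m * beta k * beta l - bl l * beta k * beta m
     + g k l * beta m - g k m * beta l)).
    have := eq_app b (fun j => step j k l m).
    have -> : app b (fun j => (N - 3) * (beta j * D l m k - beta k * D l m j)) =
       (N - 3) * (D l m k - beta k * (beta l * e m - beta m * e l)).
      apply: ev_eval; first ev_solve ltac:(first [exact: b1 | exact: Ex]).
      ring.
    move=> ->; apply: ev_eval; first ev_solve ltac:(first [exact: b1]).
    rewrite /bl /E; ring.
  have := eq_app b h.
  have -> : app b (fun l => (N - 3) * (D l m k - beta k * (beta l * e m - beta m * e l))) =
     (N - 3) * (E m k - beta k * e m).
    apply: ev_eval; first ev_solve ltac:(first [exact: b1 | exact: eb]).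
    rewrite /E; ring.
  have -> : app b (fun l => - (beta l * E k m - beta m * E k l + phi * (bl m * beta k * beta l - bl l * beta k * beta m
     + g k l * beta m - g k m * beta l))) = - ((E k m - beta m * e k) + phi * (bl m * beta k - gam * beta k * beta m
       + bl k * beta m - g k m)).
    apply: ev_eval; first ev_solve ltac:(first [exact: b1 | exact: eb | exact: blE]).
    rewrite /e /gam; ring.
  rewrite Esym => h'; rewrite (_ : N - 2 = N - 3 + 1); last by ring.
  rewrite mulrDl h'; ring.
(* The terms of E_kl with a factor beta_k cancel in D by antisymmetry; the remaining term in [bl]
   has a factor beta_l and is absorbed into f. *)
exists (phi / (N - 2)), (fun k => e k - phi / (N - 2) * bl k) => j k l.
have EE' k' m : E m k' = beta k' * e m + phi / (N - 2) * (g k' m + gam * beta k' * beta m - bl k' * beta m - bl m * beta k').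
  apply: (mulfI N2); rewrite mulrDr [(N - 2) * (phi / _ * _)]mulrA [(N - 2) * _]mulrC divfK // -EE; ring.
rewrite DE !EE' !(gC l); ring.
Qed.

Section TypeD.
Variables (c1 : K) (f : 'I_n -> K).
Hypothesis DE : forall j k l,
  D j k l = c1 * (beta j * g k l - beta k * g j l) + (beta j * f k - beta k * f j) * beta l.
Local Notation fv := (up gi f).
Local Notation fa := (app a f).
Local Notation f2 := (app fv f).
Local Notation E k l := (c1 * g k l + f k * beta l + beta k * f l).

Lemma fv_beta : app fv beta = fa.
Proof. by rewrite -(ctr_vl gis (ev_refl _ _)) (ctr_lv gis (ev_refl _ _)). Qed.

Lemma fv_g i : ev fv (fun m => g i m) (f i).
Proof. by apply: etrans (ctr_rg' gK gs gis i f); apply/esym/(ctr_vl gis)/ev_refl. Qed.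
Lemma fv_g' i : ev fv (fun m => g m i) (f i).
Proof. by apply: etrans (fv_g i); apply: eq_app => m; apply: gC. Qed.

Ltac leafv := first [exact: null | exact: fv_beta | exact: up_g | exact: up_g' | exact: fv_g | exact: fv_g'].
Ltac vecs := first [ctr_vec beta gis ltac:(ev_solve ltac:(leafv)) | ctr_vec f gis ltac:(ev_solve ltac:(leafv))].

(** D is trace-free in its last two slots; on the normal form, with beta null, the trace is beta
    times the difference of the two sides. *)
Lemma faE : fa = - (N - 1) * c1.
Proof.
have [i bi] := beta_neq0.
have := trD beta i; rewrite /ev2.
have -> : ctr gi (fun p q => D i p q) = ctr gi (fun p q =>
    c1 * (beta i * g p q - beta p * g i q) + (beta i * f p - beta p * f i) * beta q).
  by apply: eq_ctr => p q; apply: DE.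
have -> : ctr gi (fun p q =>
    c1 * (beta i * g p q - beta p * g i q) + (beta i * f p - beta p * f i) * beta q) =
    beta i * ((N - 1) * c1 + fa).
  apply: ctr_eval; first by ctr_solve g gK gs gis ltac:(vecs).
  ring.
move=> /eqP; rewrite mulf_eq0 (negbTE bi) /= => /eqP h.
by apply/eqP; rewrite -subr_eq0; apply/eqP; rewrite -[RHS]h; ring.
Qed.

Lemma N3_neq0 : N - 3 != 0.
Proof. by apply: Nsub; rewrite (ltn_trans _ n5). Qed.
Lemma N2_neq0 : N - 2 != 0.
Proof. by apply: Nsub; rewrite (ltn_trans _ n5). Qed.

(** The product of g and E, divided by n - 3, has the same cyclic sum with beta as C, by [bianchi]
    and the normal form of D. The difference [W] is therefore annihilated by antisymmetrisation with
    beta, and pair symmetry lets beta be split off from both pairs of indices. *)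
Lemma weyl_kulkarni : exists Psi : 'I_n -> 'I_n -> K, (forall k l, Psi k l = Psi l k) /\
  forall j k l m, C j k l m =
    (g j l * E k m + g k m * E j l - g j m * E k l - g k l * E j m) / (N - 3)
    + (beta j * beta l * Psi k m + beta k * beta m * Psi j l
       - beta j * beta m * Psi k l - beta k * beta l * Psi j m).
Proof.
have [b b1] := dual_vector.
pose W j k l m := C j k l m - (g j l * E k m + g k m * E j l - g j m * E k l - g k l * E j m) / (N - 3).
have Wp j k l m : W j k l m = W l m j k.
  rewrite /W Cpair !(gC l) !(gC m); ring.
have Wc i j k l m : beta i * W j k l m + beta j * W k i l m + beta k * W i j l m = 0.
  apply: (mulfI N3_neq0); rewrite mulr0.
  transitivity ((N - 3) * (beta i * C j k l m + beta j * C k i l m + beta k * C i j l m) -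
    (beta i * (g j l * E k m + g k m * E j l - g j m * E k l - g k l * E j m) +
     beta j * (g k l * E i m + g i m * E k l - g k m * E i l - g i l * E k m) +
     beta k * (g i l * E j m + g j m * E i l - g i m * E j l - g j l * E i m))).
    by rewrite /W; field; exact: N3_neq0.
  rewrite Bb !DE; ring.
have W12 j k l m : W j k l m = - W k j l m by rewrite /W C12; ring.
have W1 j k l m : W j k l m = beta j * app b (fun i => W i k l m) - beta k * app b (fun i => W i j l m).
  have := eq_app b (fun i => Wc i j k l m); rewrite (_ : app b (fun=> 0) = 0); last exact: ev0.
  have h k' : ev b (fun i => W k' i l m) (- app b (fun i => W i k' l m)).
    by apply: etrans (evN (ev_refl _ _)); apply: eq_app => i; apply: W12.
  have -> : app b (fun i => beta i * W j k l m + beta j * W k i l m + beta k * W i j l m) =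
     W j k l m - (beta j * app b (fun i => W i k l m) - beta k * app b (fun i => W i j l m)).
    apply: ev_eval; first by ev_solve ltac:(first [exact: b1 | exact: h]).
    ring.
  by move=> /eqP; rewrite subr_eq0 => /eqP.
pose Psi k m := app b (fun i => app b (fun j => W j m i k)).
have W2 k l m : app b (fun i => W i k l m) = beta l * Psi k m - beta m * Psi k l.
  rewrite (eq_app b (G := fun i => beta l * app b (fun j => W j m i k) - beta m * app b (fun j => W j l i k))).
    by apply: ev_eval; first by ev_solve ltac:(fail).
  by move=> i; rewrite Wp W1.
exists Psi; split=> [k l|j k l m].
  rewrite /Psi /app; under eq_bigr do rewrite mulr_sumr.
  under [RHS]eq_bigr do rewrite mulr_sumr.
  rewrite exchange_big; apply: eq_bigr => i _; apply: eq_bigr => m _.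
  by rewrite mulrCA Wp.
have -> : C j k l m = (g j l * E k m + g k m * E j l - g j m * E k l - g k l * E j m) / (N - 3) + W j k l m.
  by rewrite /W; ring.
rewrite W1 !W2; ring.
Qed.

Section Kulkarni.
Variable Psi : 'I_n -> 'I_n -> K.
Hypothesis PsiC : forall k l, Psi k l = Psi l k.
Hypothesis CE : forall j k l m, C j k l m =
    (g j l * E k m + g k m * E j l - g j m * E k l - g k l * E j m) / (N - 3)
    + (beta j * beta l * Psi k m + beta k * beta m * Psi j l
       - beta j * beta m * Psi k l - beta k * beta l * Psi j m).
Local Notation tau := (ctr gi Psi).

(** Let X be the difference of the two sides. The trace of the normal form of C over the first and
    third slots is beta_j X_l + beta_l X_j; it vanishes and beta is non-zero, so X = 0. *)
Lemma Psi_a k : app a (Psi k) = (N - 2) / (N - 3) * f k + tau / 2 * beta k.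
Proof.
have [i0 bi] := beta_neq0.
have two : (2 : K) != 0 by rewrite pnatr_eq0.
have h j l : beta j * ((N - 2) / (N - 3) * f l + tau / 2 * beta l - app a (Psi l))
           + beta l * ((N - 2) / (N - 3) * f j + tau / 2 * beta j - app a (Psi j)) = 0.
  have := tr13 j l; rewrite /ev2.
  have -> : ctr gi (fun p q => C p j q l) = ctr gi (fun p q =>
      (g p q * E j l + g j l * E p q - g p l * E j q - g j q * E p l) / (N - 3)
    + (beta p * beta q * Psi j l + beta j * beta l * Psi p q
       - beta p * beta l * Psi j q - beta j * beta q * Psi p l)).
    by apply: eq_ctr => p q; apply: CE.
  set X := ctr _ _.
  have -> : X = beta j * ((N - 2) / (N - 3) * f l + tau / 2 * beta l - app a (Psi l))
           + beta l * ((N - 2) / (N - 3) * f j + tau / 2 * beta j - app a (Psi j)); last by [].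
  apply: ctr_eval; first by ctr_solve g gK gs gis ltac:(vecs).
  have -> : app a (fun m => Psi m l) = app a (Psi l) by apply: eq_app => m; apply: PsiC.
  rewrite !faE; field.
  by rewrite ?N3_neq0 ?two.
have z0 : (N - 2) / (N - 3) * f i0 + tau / 2 * beta i0 - app a (Psi i0) = 0.
  apply: (mulfI bi); rewrite mulr0; apply/self_opp/eqP; rewrite -addr_eq0; apply/eqP.
  exact: h.
have := h i0 k; rewrite z0 mulr0 addr0 => /eqP.
by rewrite mulf_eq0 (negbTE bi) subr_eq0 => /eqP.
Qed.

Lemma Psi_a' k : ev a (fun m => Psi m k) ((N - 2) / (N - 3) * f k + tau / 2 * beta k).
Proof. by rewrite -Psi_a; apply: eq_app => m; apply: PsiC. Qed.

Lemma C_a4 i k l : ev a (fun m => C i k l m)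
  (c1 * (beta i * g k l - beta k * g i l) + (beta i * f k - beta k * f i) * beta l).
Proof. exact: DE. Qed.
Lemma C_a3 i k l : ev a (fun m => C i k m l)
  (- (c1 * (beta i * g k l - beta k * g i l) + (beta i * f k - beta k * f i) * beta l)).
Proof. by apply: etrans (evN (C_a4 i k l)); apply: eq_app => m; apply: C34. Qed.
Lemma C_a2 i k l : ev a (fun m => C i m k l)
  (c1 * (beta k * g l i - beta l * g k i) + (beta k * f l - beta l * f k) * beta i).
Proof. by apply: etrans (C_a4 k l i); apply: eq_app => m; apply: Cpair. Qed.
Lemma C_av i l : ev a (fun k => app fv (C i k l))
  (c1 * (beta l * f i - fa * g l i) + (beta l * f2 - fa * f l) * beta i).
Proof.
have e : app a (fun k => app fv (C i k l)) = app fv (fun m => app a (fun k => C i k l m)).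
  rewrite /app; under eq_bigr do rewrite mulr_sumr.
  rewrite exchange_big; apply: eq_bigr => p _; rewrite mulr_sumr; apply: eq_bigr => q _.
  by rewrite mulrCA.
apply: etrans e _; rewrite (eq_app fv (fun m => C_a2 i l m)).
apply: ev_eval; first by ev_solve ltac:(leafv).
ring.
Qed.

(** One factor C is replaced by [A], half of its normal form: the other half arises by exchanging l
    and m, under which the remaining factor changes sign, whence the factor 2. Psi enters only
    through its trace and its contraction with beta, both handled by [Psi_a], and disappears from
    the result. *)
Lemma contr_typeD i j : Hc i j =
  2 / (N - 3) * (- 2 * c1 * fa * g i j + (N - 4) * (fa * (beta i * f j + f i * beta j) - f2 * beta i * beta j)).
Proof.
pose A j k l m := (g j l * E k m + g k m * E j l) / (N - 3) - beta j * beta m * Psi k l + beta k * beta m * Psi j l.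
have CA j' k l m : C j' k l m = A j' k l m - A j' k m l by rewrite CE /A; ring.
have -> : Hc i j = 2 * ctr gi (fun k k' => ctr gi (fun l l' => ctr gi (fun m m' => C i k l m * A j k' l' m'))).
  rewrite /Hc mulr_natl mulr2n.
  rewrite -[in RHS](ctrD (ctr_refl _ _) (ctr_refl _ _)); apply: eq_ctr => k k'.
  have -> : ctr gi (fun l l' => ctr gi (fun m m' => C i k l m * C j k' l' m')) =
    ctr gi (fun l l' => ctr gi (fun m m' => C i k l m * A j k' l' m')) -
    ctr gi (fun l l' => ctr gi (fun m m' => C i k l m * A j k' m' l')).
    rewrite -[in RHS](ctrD (ctr_refl _ _) (ctrN (ctr_refl _ _))); apply: eq_ctr => l l'.
    rewrite -[in RHS](ctrD (ctr_refl _ _) (ctrN (ctr_refl _ _))); apply: eq_ctr => m m'.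
    by rewrite (CA j); ring.
  congr (_ + _); rewrite ctr_exch; apply: etrans (esym (ctrN (ctr_refl _ _))) _.
  apply: eq_ctr => l l'; apply: etrans (esym (ctrN (ctr_refl _ _))) _.
  by apply: eq_ctr => m m'; rewrite C34; ring.
suff -> : ctr gi (fun k k' => ctr gi (fun l l' => ctr gi (fun m m' => C i k l m * A j k' l' m'))) =
   1 / (N - 3) * (- 2 * c1 * fa * g i j + (N - 4) * (fa * (beta i * f j + f i * beta j) - f2 * beta i * beta j)) by ring.
rewrite /A; apply: ctr_eval.
  ctr_solve g gK gs gis ltac:(first [trC | leafv | exact: C_a4 | exact: C_a3 | exact: C_a2 | exact: C_av | exact: Psi_a | exact: Psi_a' |
    ctr_vec beta gis ltac:(ev_solve ltac:(first [leafv | exact: C_a4 | exact: C_a3 | exact: C_a2 | exact: C_av| exact: Psi_a | exact: Psi_a']))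
  | ctr_vec f gis ltac:(ev_solve ltac:(leafv))]).
have -> : app fv (fun m => ctr gi (fun p => C i p m)) = 0.
  by apply: etrans (ev0 fv); apply: eq_app => m; apply: tr24.
have -> : ctr gi (fun p q => Psi q p) = tau by apply: eq_ctr => p q; apply: PsiC.
rewrite -/(app fv f) -/(app a f) (gC j i) !faE; field.
by rewrite ?N3_neq0.
Qed.

(** [Z] is fa^2 times the orthogonal projection onto the plane of beta and f, as inverting the Gram
    matrix with entries 0, fa, f2 shows. Each of its terms contains beta, so its contraction with C
    only involves the normal form of D. *)
Lemma weyl_typeD i m :
  let Z k l := fa * (beta k * f l + f k * beta l) - f2 * beta k * beta l in
  ctr gi (fun k k' => ctr gi (fun l l' => C i k l m * Z k' l')) =
  2 * c1 * fa ^+ 2 * g i m - (c1 - fa) * Z i m.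
Proof.
move=> Z; rewrite /Z; apply: ctr_eval.
  ctr_solve g gK gs gis ltac:(first [trC | leafv | exact: C_a4 | exact: C_a3 | exact: C_a2 | exact: C_av |
    ctr_vec beta gis ltac:(ev_solve ltac:(first [leafv | exact: C_a4 | exact: C_a3 | exact: C_a2 | exact: C_av]))
  | ctr_vec f gis ltac:(ev_solve ltac:(leafv))]).
have -> : app a (fun k => app fv (fun l => C i k l m)) =
    - (c1 * (beta m * f i - fa * g m i) + (beta m * f2 - fa * f m) * beta i).
  apply: etrans (evN (C_av i m)); apply: eq_app => k.
  by apply: etrans (evN (ev_refl _ _)); apply: eq_app => l; apply: C34.
rewrite -/(app fv f) -/(app a f) (gC m i); ring.
Qed.
End Kulkarni.

Lemma ctr_Z : ctr gi (fun k l => fa * (beta k * f l + f k * beta l) - f2 * beta k * beta l) = 2 * fa ^+ 2.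
Proof.
apply: ctr_eval; first by ctr_solve g gK gs gis ltac:(vecs).
ring.
Qed.

Lemma Z_proj i j :
  let Z k l := fa * (beta k * f l + f k * beta l) - f2 * beta k * beta l in
  ctr gi (fun p q => Z i p * Z q j) = fa ^+ 2 * Z i j.
Proof.
move=> Z; rewrite /Z; apply: ctr_eval; first by ctr_solve g gK gs gis ltac:(vecs).
rewrite -/(app fv f) -/(app a f); ring.
Qed.
End TypeD.

Lemma N1_neq0 : N - 1 != 0.
Proof. by apply: (@Nsub 1); rewrite (ltn_trans _ n5). Qed.

(** [Z] divided by [z] is a projection of rank two, so h has the eigenvalue mu on a plane and nu on
    its orthogonal complement. *)
Lemma null_typeD : C2 != 0 -> exists z (Z : 'I_n -> 'I_n -> K), [/\ z != 0,
  forall i j, hC i j = nu * g i j + (mu - nu) / z * Z i j,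
  forall i j, ctr gi (fun p q => Z i p * Z q j) = z * Z i j &
  exists x y, forall i m,
    ctr gi (fun k k' => ctr gi (fun l l' => C i k l m * Z k' l')) = x * g i m + y * Z i m].
Proof.
move=> C2n0.
have [c1 [f DE]] := null_divergence.
have [Psi [PsiC CE]] := weyl_kulkarni DE.
pose fa := app a f; pose f2 := app (up gi f) f.
pose Z k l := fa * (beta k * f l + f k * beta l) - f2 * beta k * beta l.
have c1E : c1 = - fa / (N - 1).
  by rewrite /fa (faE DE); field; rewrite ?N1_neq0.
have HE i j : Hc i j = 2 / (N - 3) * (2 / (N - 1) * fa ^+ 2 * g i j + (N - 4) * Z i j).
  rewrite (contr_typeD DE PsiC CE) -/fa -/f2 /Z c1E.
  by field; rewrite ?N1_neq0 ?N3_neq0.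
have C2E : C2 = 4 / (N - 3) * ((N - 2) ^+ 2 / (N - 1)) * fa ^+ 2.
  rewrite /C2 (eq_ctr gi HE); apply: ctr_eval.
    by ctr_solve g gK gs gis ltac:(idtac; lazymatch goal with |- ev2 _ (fun p q => Z p q) _ => exact: ctr_Z end).
  rewrite -/fa -/f2.
  by field; rewrite ?N1_neq0 ?N3_neq0.
(* The plane of beta and f is non-degenerate exactly because C^2, a multiple of fa^2, does not
   vanish. *)
have fa0 : fa != 0 by apply: contraNneq C2n0 => e; rewrite C2E e expr0n mulr0.
exists (fa ^+ 2), Z; split.
- by rewrite expf_neq0.
- move=> i j; rewrite /hC HE C2E /mu /nu.
  by field; rewrite ?N1_neq0 ?N3_neq0 ?N2_neq0 ?fa0.
- by move=> i j; apply: Z_proj.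
- exists (2 * c1 * fa ^+ 2), (- (c1 - fa)) => i m.
  by rewrite (weyl_typeD DE) mulNr.
Qed.

(** Since mu <> nu, [Z] is a combination of g and h and can be eliminated; the conclusion no longer
    refers to beta. *)
Lemma null_special : C2 != 0 ->
  (forall i j, ctr gi (fun p q => hC i p * hC q j) = (mu + nu) * hC i j - mu * nu * g i j) /\
  exists x y, forall i m,
    ctr gi (fun k k' => ctr gi (fun l l' => C i k l m * hC k' l')) = x * g i m + y * hC i m.
Proof.
move=> /null_typeD[z [Z [z0 hE ZZ [x [y CZ]]]]].
have mn : mu - nu != 0.
  have -> : mu - nu = (N - 1) * (N - 4) / (2 * (N - 2) ^+ 2).
    by rewrite /mu /nu; field; rewrite ?N2_neq0.
  by rewrite !mulf_eq0 invr_eq0 mulf_eq0 expf_eq0 pnatr_eq0 (negbTE N1_neq0) (negbTE (Nsub n5)) (negbTE N2_neq0).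
have ZE i j : Z i j = z / (mu - nu) * (hC i j - nu * g i j).
  by rewrite hE; field; rewrite z0 mn.
split=> [i j|].
  transitivity (ctr gi (fun p q => (nu * g i p + (mu - nu) / z * Z i p) * (nu * g q j + (mu - nu) / z * Z q j))).
    by apply: eq_ctr => p q; rewrite -!hE.
  apply: ctr_eval.
    ctr_solve g gK gs gis ltac:(idtac; lazymatch goal with |- ev2 _ (fun p q => Z _ p * Z q _) _ => exact: ZZ end).
  by rewrite hE; field; rewrite ?z0.
exists ((mu - nu) / z * x - y * nu), y => i m.
transitivity (ctr gi (fun k k' => ctr gi (fun l l' => C i k l m * (nu * g k' l' + (mu - nu) / z * Z k' l')))).
  by apply: eq_ctr => k k'; apply: eq_ctr => l l'; rewrite -hE.
apply: ctr_eval.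
  ctr_solve g gK gs gis ltac:(first [trC]).
rewrite CZ hE; field; exact: z0.
Qed.

Lemma null_schouten (S : 'I_n -> 'I_n -> K) sigma t : C2 != 0 ->
  (forall i l, N * ctr gi (fun p q => S i p * hC q l) + sigma * hC i l - S i l - t * g i l =
    ctr gi (fun j j' => ctr gi (fun m m' => C i j l m * hC j' m'))) ->
  exists x y, forall i l, S i l = x * g i l + y * hC i l.
Proof.
move=> C2n0 T; have [hh [x [y Ch]]] := null_special C2n0.
have N0 : N != 0 by rewrite -[N]subr0; apply: (@Nsub 0); rewrite (ltn_trans _ n5).
have SH i l : ctr gi (fun p q => S i p * hC q l) = (S i l + (t - x) * g i l + (- sigma - y) * hC i l) / N.
  apply: (mulfI N0); rewrite [in RHS]mulrC divfK //.
  have := T i l.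
  have -> : ctr gi (fun j j' => ctr gi (fun m m' => C i j l m * hC j' m')) = - (x * g i l + y * hC i l).
    rewrite -Ch; apply: etrans (ctrN (ctr_refl _ _)); apply: eq_ctr => p q.
    by apply: etrans (ctrN (ctr_refl _ _)); apply: eq_ctr => p0 q0; rewrite C34 mulNr.
  move=> e; apply/eqP; rewrite -subr_eq0; apply/eqP.
  rewrite -[RHS](subrr (- (x * g i l + y * hC i l))) -[in X in _ = X - _]e; ring.
pose al := (t - x) / N; pose be := (- sigma - y) / N.
have SH' i l : ctr gi (fun p q => S i p * hC q l) = N^-1 * S i l + al * g i l + be * hC i l.
  by rewrite SH /al /be; field; exact: N0.
have SHH i l : ctr gi (fun p q => ctr gi (fun r s => S i r * hC s p) * hC q l) =
   (mu + nu) * ctr gi (fun p q => S i p * hC q l) - mu * nu * S i l.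
  transitivity (ctr gi (fun r s => S i r * ctr gi (fun p q => hC s p * hC q l))).
    transitivity (ctr gi (fun p q => ctr gi (fun r s => S i r * hC s p * hC q l))).
      by apply: eq_ctr => p q; apply: esym (ctrMr _ (ctr_refl _ _)).
    rewrite ctr_exch; apply: eq_ctr => r s.
    apply: etrans (ctrMl (S i r) (ctr_refl gi (fun p q => hC s p * hC q l))).
    by apply: eq_ctr => p q; rewrite -mulrA.
  rewrite (eq_ctr gi (Y := fun r s => S i r * ((mu + nu) * hC s l - mu * nu * g s l))).
    by apply: ctr_eval; first by ctr_solve g gK gs gis ltac:(fail).
  by move=> r s; rewrite hh.
have SHH' i l : ctr gi (fun p q => ctr gi (fun r s => S i r * hC s p) * hC q l) =
    N^-1 * ctr gi (fun p q => S i p * hC q l) + al * hC i l + be * ((mu + nu) * hC i l - mu * nu * g i l).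
  rewrite (eq_ctr gi (Y := fun p q => (N^-1 * S i p + al * g i p + be * hC i p) * hC q l)).
    apply: ctr_eval; first by ctr_solve g gK gs gis ltac:(idtac; lazymatch goal with |- ev2 _ (fun p q => hC _ p * hC q _) _ => exact: hh end).
    by [].
  by move=> p q; rewrite SH'.
(* The coefficient of S in the comparison; it equals - (mu - 1/n)(nu - 1/n). *)
pose de := (mu + nu - N^-1) * N^-1 - mu * nu.
have de0 : de != 0.
  have -> : de = (N - 1) ^+ 2 * (N - 4) ^+ 2 / (2 * N ^+ 2 * (N - 2) ^+ 3).
    by rewrite /de /mu /nu; field; rewrite ?N2_neq0 ?N0.
  by rewrite !mulf_eq0 invr_eq0 !mulf_eq0 ?expf_eq0 /= pnatr_eq0 (negbTE N1_neq0) (negbTE (Nsub n5)) (negbTE N2_neq0) (negbTE N0).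
exists (- (al * (mu + nu - N^-1) + be * mu * nu) / de), ((al + be * (mu + nu) - be * (mu + nu - N^-1)) / de) => i l.
apply: (mulfI de0).
have := SHH i l; rewrite SHH' SH' => e.
rewrite -[LHS]addr0 -(subrr (N^-1 * (N^-1 * S i l + al * g i l + be * hC i l) + al * hC i l + be * ((mu + nu) * hC i l - mu * nu * g i l))).
rewrite {2}e /de; field.
rewrite N0 (_ : _ + _ = de * N ^+ 2) ?mulf_neq0 ?expf_neq0 //.
by rewrite /de; field; exact: N0.
Qed.
End Null.
End Bianchi.
End WeylAlgebra.

(** * Passing between real and complex scalars *)

Record weyl_tensor (K : numFieldType) (n : nat) (g gi : 'M[K]_n)
    (C : 'I_n -> 'I_n -> 'I_n -> 'I_n -> K) : Prop := WeylTensor {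
  wt_n5 : (5 <= n)%N;
  wt_gK : gi *m g = 1%:M;
  wt_gs : g^T = g;
  wt_gis : gi^T = gi;
  wt12 : forall j k l m, C j k l m = - C k j l m;
  wt34 : forall j k l m, C j k l m = - C j k m l;
  wt_cyc : forall j k l m, C j k l m + C k l j m + C l j k m = 0;
  wt_tr : forall k l, ctr gi (fun j m => C j k l m) = 0 }.

Section Span.
Variables (K : numFieldType) (n : nat) (g gi : 'M[K]_n).
Local Notation N := (n%:R : K).
Local Notation mu := (mu K n).
Local Notation nu := (nu K n).

Definition trace_free S i j : K := S i j - ctr gi S / N * g i j.
(* The squared norm of the trace-free part of [h] when tr h = 1 and (h - mu)(h - nu) = 0. *)
Definition kap : K := mu + nu - N * mu * nu - N^-1.
(** The only possible factor of proportionality, found by pairing both sides with h. Being an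
    explicit expression in h and S, it turns the proportionality into an equation between
    differentiable functions, which extends by continuity and is reflected by field morphisms. *)
Definition coefG (h S : 'I_n -> 'I_n -> K) : K :=
  ctr gi (fun i i' => ctr gi (fun j j' => trace_free S i j * h i' j')) / kap.
Definition special h S :=
  (forall i j, ctr gi (fun p q => h i p * h q j) = (mu + nu) * h i j - mu * nu * g i j) /\
  forall i j, trace_free S i j = coefG h S * (h i j - g i j / N).

Lemma kap_neq0 : (5 <= n)%N -> kap != 0.
Proof.
move=> n5; have n5' k : (k < 5)%N -> N - k%:R != 0 by move=> k5; apply/Nsub/(leq_trans k5).
have N0 : N != 0 by rewrite -[N]subr0; apply: (n5' 0%N).
have N1 : N - 1 != 0 by apply: (n5' 1%N).
have N2 : N - 2 != 0 by apply: (n5' 2%N).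
have N4 : N - 4 != 0 by apply: (n5' 4%N).
have -> : kap = (N - 1) ^+ 2 * (N - 4) ^+ 2 / (2 * N * (N - 2) ^+ 3).
  by rewrite /kap /mu /nu; field; rewrite ?N2 ?N0.
by rewrite !mulf_neq0 ?invr_eq0 ?mulf_neq0 ?expf_neq0 // pnatr_eq0.
Qed.

Hypothesis n5 : (5 <= n)%N.
Hypothesis gK : gi *m g = 1%:M.
Hypothesis gs : g^T = g.
Hypothesis gis : gi^T = gi.
Variables (h S : 'I_n -> 'I_n -> K).
Hypothesis hs : forall i j, h i j = h j i.
Hypothesis hh : forall i j, ctr gi (fun p q => h i p * h q j) = (mu + nu) * h i j - mu * nu * g i j.
Hypothesis htr : ctr gi h = 1.

Lemma norm_h : ctr gi (fun i i' => ctr gi (fun j j' => h i j * h i' j')) = mu + nu - N * mu * nu.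
Proof.
have -> : ctr gi (fun i i' => ctr gi (fun j j' => h i j * h i' j')) =
    ctr gi (fun i i' => (mu + nu) * h i i' - mu * nu * g i i').
  by apply: eq_ctr => i i'; rewrite -hh; apply: eq_ctr => j j'; rewrite (hs i').
apply: ctr_eval; first by ctr_solve g gK gs gis ltac:(exact: htr).
ring.
Qed.

Lemma N_neq0 : N != 0.
Proof. by rewrite pnatr_eq0; case: n n5. Qed.

Lemma span_special x y : (forall i j, S i j = x * g i j + y * h i j) -> special h S.
Proof.
move=> SE; split=> // .
have trS : ctr gi S = x * N + y.
  rewrite (eq_ctr gi SE); apply: ctr_eval; first by ctr_solve g gK gs gis ltac:(exact: htr).
  ring.
have tf i j : trace_free S i j = y * (h i j - g i j / N).
  by rewrite /trace_free trS SE; field; exact: N_neq0.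
have -> : coefG h S = y; last exact: tf.
rewrite /coefG.
rewrite (eq_ctr gi (Y := fun i i' => ctr gi (fun j j' => (y * (h i j - g i j / N)) * h i' j'))); last first.
  by move=> i i'; apply: eq_ctr => j j'; rewrite tf.
have -> : ctr gi (fun i i' => ctr gi (fun j j' => (y * (h i j - g i j / N)) * h i' j')) = y * kap.
  apply: ctr_eval.
    ctr_solve g gK gs gis ltac:(first [exact: htr | exact: (ctr_C gis htr)]).
  rewrite norm_h /kap; ring.
by rewrite mulfK // kap_neq0.
Qed.
End Span.

Section Map.
Variables (K L : numFieldType) (f : {rmorphism K -> L}) (n : nat).
Implicit Types (g gi : 'M[K]_n).

Lemma app_map (v F : 'I_n -> K) : app (f \o v) (f \o F) = f (app v F).
Proof. by rewrite /app rmorph_sum; apply: eq_bigr => i _; rewrite rmorphM. Qed.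
Lemma ctr_map g (X : 'I_n -> 'I_n -> K) : ctr (map_mx f g) (fun p q => f (X p q)) = f (ctr g X).
Proof.
rewrite /ctr rmorph_sum; apply: eq_bigr => i _; rewrite rmorph_sum.
by apply: eq_bigr => j _; rewrite rmorphM mxE.
Qed.
Lemma ctr_map' g X Y : (forall p q, X p q = f (Y p q)) -> ctr (map_mx f g) X = f (ctr g Y).
Proof. by move=> e; rewrite -ctr_map; apply: eq_ctr => p q; rewrite e. Qed.
Lemma up_map g (v : 'I_n -> K) p : up (map_mx f g) (f \o v) p = f (up g v p).
Proof. by rewrite /up rmorph_sum; apply: eq_bigr => i _; rewrite rmorphM mxE. Qed.

Variables (g gi : 'M[K]_n) (C : 'I_n -> 'I_n -> 'I_n -> 'I_n -> K).
Local Notation fg := (map_mx f g).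
Local Notation fgi := (map_mx f gi).
Definition fC i j k l := f (C i j k l).

Lemma weyl_map : weyl_tensor g gi C -> weyl_tensor fg fgi fC.
Proof.
move=> [n5 gK gs gis h12 h34 hc ht]; split=> //.
- by rewrite -map_mxM gK map_mx1.
- by rewrite map_trmx gs.
- by rewrite map_trmx gis.
- by move=> j k l m; rewrite /fC h12 rmorphN.
- by move=> j k l m; rewrite /fC h34 rmorphN.
- by move=> j k l m; rewrite /fC -!rmorphD hc rmorph0.
- by move=> k l; rewrite /fC ctr_map ht rmorph0.
Qed.

Lemma Dv_map beta j k l : Dv fgi fC (f \o beta) j k l = f (Dv gi C beta j k l).
Proof.
rewrite /Dv -app_map; apply: eq_bigr => m _; congr (_ * _); exact: up_map.
Qed.

Lemma bianchi_map beta : bianchi g gi C beta -> bianchi fg fgi fC (f \o beta).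
Proof.
move=> B i j k l m; rewrite !Dv_map !mxE /fC /=.
have := congr1 f (B i j k l m).
by rewrite !(rmorph_nat, rmorphM, rmorphB, rmorphD, rmorphN).
Qed.

Lemma Hc_map i j : Hc fgi fC i j = f (Hc gi C i j).
Proof. by do 3 (apply: ctr_map' => ? ?); rewrite rmorphM. Qed.
Lemma C2_map : C2 fgi fC = f (C2 gi C).
Proof. by apply: ctr_map' => ? ?; apply: Hc_map. Qed.
Lemma hC_map i j : hC fgi fC i j = f (hC gi C i j).
Proof. by rewrite /hC Hc_map C2_map rmorphM fmorphV. Qed.
Lemma mu_map : f (mu K n) = mu L n.
Proof. by rewrite /mu !(rmorph_nat, rmorphM, fmorphV, rmorphB). Qed.
Lemma nu_map : f (nu K n) = nu L n.
Proof. by rewrite /nu !(rmorph_nat, rmorphXn, fmorphV, rmorphB). Qed.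

Lemma special_map h S : special fg fgi (fun i j => f (h i j)) (fun i j => f (S i j)) -> special g gi h S.
Proof.
move=> [hh SS]; split=> i j; apply: (fmorph_inj f).
  have := hh i j; rewrite (ctr_map' _ (Y := fun p q => h i p * h q j)); last by move=> p q; rewrite rmorphM.
  by move=> ->; rewrite !mxE -mu_map -nu_map !(rmorph_nat, rmorphM, rmorphB, rmorphD).
have tf i' j' : trace_free fg fgi (fun i j => f (S i j)) i' j' = f (trace_free g gi S i' j').
  by rewrite /trace_free ctr_map mxE !(rmorph_nat, rmorphM, fmorphV, rmorphB).
have cG : coefG fg fgi (fun i j => f (h i j)) (fun i j => f (S i j)) = f (coefG g gi h S).
  rewrite /coefG rmorphM fmorphV; congr (_ / _); last first.
    by rewrite /kap -mu_map -nu_map !(rmorph_nat, rmorphM, fmorphV, rmorphB, rmorphD).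
  by apply: ctr_map' => p q; apply: ctr_map' => p' q'; rewrite tf rmorphM.
by have := SS i j; rewrite tf cG => ->; rewrite mxE !(rmorph_nat, rmorphM, fmorphV, rmorphB).
Qed.
End Map.

Section Linear.
Variables (K : numFieldType) (n : nat) (g gi : 'M[K]_n) (C : 'I_n -> 'I_n -> 'I_n -> 'I_n -> K).
Lemma up_lin a u v p : up gi (fun i => u i + a * v i) p = up gi u p + a * up gi v p.
Proof. by rewrite /up mulr_sumr -big_split; apply: eq_bigr => q _ /=; ring. Qed.
Lemma Dv_lin a u v j k l : Dv gi C (fun i => u i + a * v i) j k l = Dv gi C u j k l + a * Dv gi C v j k l.
Proof. by rewrite /Dv /app mulr_sumr -big_split; apply: eq_bigr => q _ /=; rewrite up_lin; ring. Qed.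
Lemma bianchi_lin a u v : bianchi g gi C u -> bianchi g gi C v -> bianchi g gi C (fun i => u i + a * v i).
Proof.
move=> Bu Bv i j k l m; rewrite !Dv_lin.
transitivity ((n%:R - 3) * (u i * C j k l m + u j * C k i l m + u k * C i j l m) +
   a * ((n%:R - 3) * (v i * C j k l m + v j * C k i l m + v k * C i j l m))); first by ring.
rewrite Bu Bv; ring.
Qed.
End Linear.

Section NullSpecial.
Variables (K : numFieldType) (n : nat) (g gi : 'M[K]_n) (C : 'I_n -> 'I_n -> 'I_n -> 'I_n -> K).
Hypothesis W : weyl_tensor g gi C.
Hypothesis C2_neq0 : C2 gi C != 0.
Variables (S : 'I_n -> 'I_n -> K) (sigma t : K).
Hypothesis T : forall i l,
  n%:R * ctr gi (fun p q => S i p * hC gi C q l) + sigma * hC gi C i l - S i l - t * g i l =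
    ctr gi (fun j j' => ctr gi (fun m m' => C i j l m * hC gi C j' m')).

Lemma hC_sym i j : hC gi C i j = hC gi C j i.
Proof. by rewrite /hC Hc_sym //; case: W. Qed.

Lemma null_is_special beta : bianchi g gi C beta -> app (up gi beta) beta = 0 ->
  (exists i, beta i != 0) -> special g gi (hC gi C) S.
Proof.
case: W => n5 gK gs gis h12 h34 hc ht B b0 bn0.
have [hh _] := null_special n5 gK gs gis h12 h34 hc ht B b0 bn0 C2_neq0.
have [x [y SE]] := null_schouten n5 gK gs gis h12 h34 hc ht B b0 bn0 C2_neq0 T.
apply: (span_special n5 gK gs gis _ hh _ SE); first exact: hC_sym.
by rewrite (ctrMl _ (ctr_refl _ _)) mulVf.
Qed.
End NullSpecial.

Section RealSpecial.
Variables (K : rcfType) (n : nat) (g gi : 'M[K]_n) (C : 'I_n -> 'I_n -> 'I_n -> 'I_n -> K).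
Hypothesis W : weyl_tensor g gi C.
Hypothesis C2_neq0 : C2 gi C != 0.
Variables (S : 'I_n -> 'I_n -> K) (sigma t : K).
Hypothesis T : forall i l,
  n%:R * ctr gi (fun p q => S i p * hC gi C q l) + sigma * hC gi C i l - S i l - t * g i l =
    ctr gi (fun j j' => ctr gi (fun m m' => C i j l m * hC gi C j' m')).

(* The complexified span of two independent covectors contains a null covector. *)
Lemma indep_is_special al w : bianchi g gi C al -> bianchi g gi C w ->
  app (up gi al) al != 0 -> ~ (exists c, forall i, w i = c * al i) -> special g gi (hC gi C) S.
Proof.
move=> Bal Bw s0 ind.
(* Destructing [inhabited] makes the embedding opaque: from here on it is just some morphism of
   fields. *)
have [f] : inhabited {rmorphism K -> K[i]} by exact: inhabits (real_complex K : {rmorphism K -> K[i]}).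
apply: (special_map (f := f)).
pose s : K[i] := f (app (up gi al) al); pose x : K[i] := f (app (up gi w) al).
pose r : K[i] := f (app (up gi w) w).
(* A root of s z^2 + 2 x z + r, the squared norm of w + z al. *)
pose z := (- x + sqrtC (x ^+ 2 - s * r)) / s.
have sn0 : s != 0 by rewrite fmorph_eq0.
have ze : s * z ^+ 2 + 2 * x * z + r = 0.
  have -> : s * z ^+ 2 + 2 * x * z + r = (sqrtC (x ^+ 2 - s * r) ^+ 2 - (x ^+ 2 - s * r)) / s.
    by rewrite /z; field.
  by rewrite sqrtCK subrr mul0r.
pose be i := f (w i) + z * f (al i).
have pair (u v : 'I_n -> K) : app (fun p => f (up gi u p)) (fun p => f (v p)) = f (app (up gi u) v).
  exact: app_map.
have symp (u v : 'I_n -> K) : app (up gi u) v = app (up gi v) u.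
  by case: W => _ _ _ gis _ _ _ _; rewrite -(ctr_vl gis (ev_refl _ _)) (ctr_lv gis (ev_refl _ _)).
have Bbe : bianchi (map_mx f g) (map_mx f gi) (fC f C) be.
  exact: bianchi_lin (bianchi_map f Bw) (bianchi_map f Bal).
have bnull : app (up (map_mx f gi) be) be = 0.
  rewrite -ze /s /x /r -!pair (_ : app (up (map_mx f gi) be) be =
    app (fun p => f (up gi w p) + z * f (up gi al p)) (fun p => f (w p) + z * f (al p))); last first.
    rewrite /app; apply: eq_bigr => p _; congr (_ * _).
    by rewrite /be up_lin -!up_map.
  rewrite /app.
  transitivity (\sum_m (f (up gi w m) * f (w m) + z * (f (up gi w m) * f (al m)) + z * (f (up gi al m) * f (w m))
     + z ^+ 2 * (f (up gi al m) * f (al m)))); first by apply: eq_bigr => m _; ring.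
  rewrite !big_split /= -!mulr_sumr -/(app (fun m => f (up gi w m)) (fun m => f (w m))).
  have e : \sum_m f (up gi al m) * f (w m) = \sum_m f (up gi w m) * f (al m).
    by have := congr1 f (symp al w); rewrite -!pair.
  rewrite e /app; ring.
(* If w + z al vanished, z would be minus the quotient w_i / al_i at any i with al_i <> 0, so w
   would be a multiple of al over the base field itself. *)
have bn0 : exists i, be i != 0.
  have [i0 ai0] : exists i, al i != 0.
    apply/existsP; apply: contraNT s0 => /existsPn a0.
    by rewrite /app big1 // => m _; rewrite (eqP (negPn (a0 m))) mulr0.
  apply/existsP; apply: contra_notT ind => /existsPn b0.
  have be0 i : f (w i) = - z * f (al i).
    by have /negPn := b0 i; rewrite /be addr_eq0 => /eqP ->; rewrite mulNr.
  exists (w i0 / al i0) => i; apply: (fmorph_inj f).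
  rewrite !(rmorphM, fmorphV) !be0; field.
  by rewrite fmorph_eq0.
have T' i l : n%:R * ctr (map_mx f gi) (fun p q => f (S i p) * hC (map_mx f gi) (fC f C) q l)
   + f sigma * hC (map_mx f gi) (fC f C) i l - f (S i l) - f t * map_mx f g i l =
   ctr (map_mx f gi) (fun j j' => ctr (map_mx f gi) (fun m m' => fC f C i j l m * hC (map_mx f gi) (fC f C) j' m')).
  rewrite (@ctr_map' _ _ f _ gi _ (fun p q => S i p * hC gi C q l)); last by move=> p q; rewrite hC_map -rmorphM.
  rewrite [RHS](@ctr_map' _ _ f _ gi _ (fun j j' => ctr gi (fun m m' => C i j l m * hC gi C j' m'))); last first.
    by move=> p q; apply: ctr_map' => p' q'; rewrite hC_map -rmorphM.
  by rewrite -T hC_map mxE -(rmorph_nat f n) -!rmorphM -rmorphD -!rmorphB.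
have C2n0 : C2 (map_mx f gi) (fC f C) != 0 by rewrite C2_map fmorph_eq0.
have := null_is_special (weyl_map f W) C2n0 T' Bbe bnull bn0.
suff -> : hC (map_mx f gi) (fC f C) = fun i j => f (hC gi C i j) by [].
by apply/funext => i; apply/funext => j; apply: hC_map.
Qed.
End RealSpecial.

(** * Smooth functions on open sets *)

(** Identities between components hold only on the open coordinate domain, so differentiability has
    to pass between functions with the same germ: the first-order expansion of one serves for the
    other. *)
Lemma near_differentiable (R : realType) (V W : normedModType R) (f g : V -> W) (x : V) :
  {near x, f =1 g} -> differentiable f x -> differentiable g x.
Proof.
move=> fg df.
have e : g = cst (g x) + 'd f x \o center x +o_x (center x).
  apply/eqaddoP => e e0; move/diffP: (df) => [_ dxf].
  have {}dxf : f = cst (f x) + 'd f x \o center x +o_x (center x).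
    by rewrite funeqE => y; rewrite dxf lim_id.
  have /eqaddoP/(_ e e0) fe := dxf.
  have fgx : f x = g x by exact: (nbhs_singleton fg).
  near=> y.
  have -> : (g - (cst (g x) + 'd f x \o center x)) y = (f - (cst (f x) + 'd f x \o center x)) y.
    have fgy : f y = g y by near: y; exact: fg.
    by rewrite !fctE /= fgy fgx.
  by near: y.
apply/diffP => /=.
apply: (@getPex _ (fun (df : {linear V -> W}) => continuous df /\
  forall y, g y = g (lim (nbhs x)) + df (y - lim (nbhs x))
                  +o_(y \near x) (y - lim (nbhs x)))).
exists ('d f x); split; first exact: diff_continuous.
move: e; rewrite funeqE => e y; rewrite lim_id //; exact: e.
Unshelve. all: by end_near. Qed.

Section Partial.
Variables (R : realType) (n : nat).
Implicit Types (f h : 'rV[R]_n -> R) (U : set 'rV[R]_n) (x : 'rV[R]_n) (i : 'I_n).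

Lemma partialE f i x : differentiable f x -> partial i f x = 'd f x (delta_mx 0 i).
Proof. exact: deriveE. Qed.

Lemma partialD f h i x : differentiable f x -> differentiable h x ->
  partial i (fun y => f y + h y) x = partial i f x + partial i h x.
Proof. by move=> df dh; apply: (deriveD (diff_derivable df) (diff_derivable dh)). Qed.
Lemma partialN f i x : differentiable f x -> partial i (fun y => - f y) x = - partial i f x.
Proof. by move=> df; apply: (deriveN (diff_derivable df)). Qed.
Lemma partialM f h i x : differentiable f x -> differentiable h x ->
  partial i (fun y => f y * h y) x = partial i f x * h x + f x * partial i h x.
Proof.
move=> df dh; rewrite addrC; apply: etrans (deriveM (diff_derivable df) (diff_derivable dh)) _.
by congr (_ + _); rewrite [LHS]mulrC.
Qed.
Lemma partialV f i x : f x != 0 -> differentiable f x ->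
  partial i (fun y => (f y)^-1) x = - (f x) ^- 2 * partial i f x.
Proof. by move=> f0 df; apply: (deriveV f0 (diff_derivable df)). Qed.
Lemma partial_cst (c : R) i x : partial i (fun=> c) x = 0.
Proof. exact: derive_cst. Qed.

Lemma differentiable_sumf (I : Type) (r : seq I) (F : I -> 'rV[R]_n -> R) x :
  (forall a, differentiable (F a) x) -> differentiable (fun y => \sum_(a <- r) F a y) x.
Proof.
move=> dF; elim: r => [|a r IH].
  by under eq_fun do rewrite big_nil; apply: differentiable_cst.
under eq_fun do rewrite big_cons.
exact: (differentiableD (dF a) IH).
Qed.
Lemma partial_sumf (I : Type) (r : seq I) (F : I -> 'rV[R]_n -> R) i x :
  (forall a, differentiable (F a) x) ->
  partial i (fun y => \sum_(a <- r) F a y) x = \sum_(a <- r) partial i (F a) x.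
Proof.
move=> dF; elim: r => [|a r IH].
  by under eq_fun do rewrite big_nil; rewrite big_nil partial_cst.
under eq_fun do rewrite big_cons.
rewrite big_cons partialD ?IH //; exact: differentiable_sumf.
Qed.

Lemma near_partial f h i x : {near x, f =1 h} -> partial i f x = partial i h x.
Proof. by move=> fh; apply: near_eq_derive. Qed.

Lemma eq_on_partial U f h i x : open U -> U x -> (forall y, U y -> f y = h y) ->
  partial i f x = partial i h x.
Proof.
move=> oU Ux fh; apply: near_partial; near=> y; apply: fh; near: y.
exact: open_nbhs_nbhs.
Unshelve. all: by end_near. Qed.

Lemma eq_on_diff U f h x : open U -> U x -> (forall y, U y -> f y = h y) ->
  differentiable f x -> differentiable h x.
Proof.
move=> oU Ux fh; apply: near_differentiable; near=> y; apply: fh; near: y.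
exact: open_nbhs_nbhs.
Unshelve. all: by end_near. Qed.

(* Truncating [smooth_on] at order [k] makes the closure properties provable by induction on [k]. *)
Definition smoothk U k f := forall (s : seq 'I_n) x, (size s <= k)%N -> U x ->
  differentiable (foldr (@partial R n) f s) x.

Lemma smooth_onP U f : smooth_on U f <-> forall k, smoothk U k f.
Proof. by split=> [sf k s x _|sf s x]; [exact: sf|exact: (sf (size s))]. Qed.

(** [foldr] differentiates first along the last entry of the list, so one derivative of f is peeled
    off at that end. *)
Lemma smoothkS U k f : smoothk U k.+1 f <->
  (forall x, U x -> differentiable f x) /\ forall i, smoothk U k (partial i f).
Proof.
split=> [sf|[f0 sf] s x].
  split=> [x Ux|i s x ks Ux]; first exact: (sf [::]).
  by rewrite -foldr_rcons; apply: sf => //; rewrite size_rcons.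
case/lastP: s => [_ Ux|s i]; first exact: f0.
by rewrite size_rcons foldr_rcons => ks Ux; apply: sf.
Qed.

Lemma smoothk_diff U k f x : smoothk U k f -> U x -> differentiable f x.
Proof. by move=> sf Ux; apply: (sf [::]). Qed.

Lemma smooth_diff U f x : smooth_on U f -> U x -> differentiable f x.
Proof. by move=> sf Ux; apply: (sf [::]). Qed.

Lemma smooth_partial U f i : smooth_on U f -> smooth_on U (partial i f).
Proof. by move=> sf s x Ux; rewrite -foldr_rcons; apply: sf. Qed.

Lemma smoothkW U k f : smoothk U k.+1 f -> smoothk U k f.
Proof. by move=> sf s x ks; apply: sf; apply: leqW. Qed.

Lemma smoothk0 U f : smoothk U 0 f <-> forall x, U x -> differentiable f x.
Proof. by split=> [sf x|sf s x]; [exact: (sf [::])|rewrite leqn0 size_eq0 => /eqP ->; apply: sf]. Qed.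

Section Open.
Variable U : set 'rV[R]_n.
Hypothesis oU : open U.

Lemma eq_smoothk k f h : (forall y, U y -> f y = h y) -> smoothk U k f -> smoothk U k h.
Proof.
elim: k f h => [|k IH] f h fh.
  by move=> /smoothk0 sf; apply/smoothk0 => x Ux; apply: eq_on_diff oU Ux fh (sf x Ux).
move=> /smoothkS[df sf]; apply/smoothkS; split=> [x Ux|i].
  exact: eq_on_diff oU Ux fh (df x Ux).
by apply: IH (sf i) => y Uy; apply: eq_on_partial oU Uy fh.
Qed.
Lemma eq_smooth f h : (forall y, U y -> f y = h y) -> smooth_on U f -> smooth_on U h.
Proof. by move=> fh /smooth_onP sf; apply/smooth_onP => k; apply: eq_smoothk fh (sf k). Qed.

Lemma smoothkD k f h : smoothk U k f -> smoothk U k h -> smoothk U k (fun y => f y + h y).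
Proof.
elim: k f h => [|k IH] f h.
  move=> /smoothk0 df /smoothk0 dh; apply/smoothk0 => x Ux; exact: (differentiableD (df _ Ux) (dh _ Ux)).
move=> /smoothkS[df sf] /smoothkS[dh sh]; apply/smoothkS; split=> [x Ux|i].
  exact: (differentiableD (df _ Ux) (dh _ Ux)).
apply: eq_smoothk (IH _ _ (sf i) (sh i)) => y Uy.
by rewrite partialD //; [exact: df|exact: dh].
Qed.
Lemma smoothkM k f h : smoothk U k f -> smoothk U k h -> smoothk U k (fun y => f y * h y).
Proof.
elim: k f h => [|k IH] f h.
  move=> /smoothk0 df /smoothk0 dh; apply/smoothk0 => x Ux; exact: (differentiableM (df _ Ux) (dh _ Ux)).
move=> sf' sh'; have /smoothkS[df sf] := sf'; have /smoothkS[dh sh] := sh'.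
apply/smoothkS; split=> [x Ux|i]; first exact: (differentiableM (df _ Ux) (dh _ Ux)).
apply: eq_smoothk (smoothkD (IH _ _ (sf i) (smoothkW sh')) (IH _ _ (smoothkW sf') (sh i))) => y Uy.
by rewrite partialM //; [exact: df|exact: dh].
Qed.
Lemma smooth_cst (c : R) : smooth_on U (fun=> c).
Proof.
apply/smooth_onP => k; elim: k c => [|k IH] c.
  by apply/smoothk0 => x _; apply: differentiable_cst.
apply/smoothkS; split=> [x _|i]; first exact: differentiable_cst.
by apply: eq_smoothk (IH 0) => y _; rewrite partial_cst.
Qed.
Lemma smoothD f h : smooth_on U f -> smooth_on U h -> smooth_on U (fun y => f y + h y).
Proof. by move=> /smooth_onP sf /smooth_onP sh; apply/smooth_onP => k; apply: smoothkD. Qed.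
Lemma smoothM f h : smooth_on U f -> smooth_on U h -> smooth_on U (fun y => f y * h y).
Proof. by move=> /smooth_onP sf /smooth_onP sh; apply/smooth_onP => k; apply: smoothkM. Qed.
Lemma smoothN f : smooth_on U f -> smooth_on U (fun y => - f y).
Proof.
move=> sf; apply: eq_smooth (smoothM (smooth_cst (-1)) sf) => y _; exact: mulN1r.
Qed.
Lemma smoothB f h : smooth_on U f -> smooth_on U h -> smooth_on U (fun y => f y - h y).
Proof. by move=> sf sh; apply/smoothD/smoothN. Qed.
Lemma smooth_sum (I : Type) (r : seq I) (P : pred I) (F : I -> 'rV[R]_n -> R) :
  (forall a, P a -> smooth_on U (F a)) -> smooth_on U (fun y => \sum_(a <- r | P a) F a y).
Proof.
move=> sF; elim: r => [|a r IH].
  by apply: eq_smooth (smooth_cst 0) => y _; rewrite big_nil.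
case Pa: (P a); last by apply: eq_smooth IH => y _; rewrite big_cons Pa.
by apply: eq_smooth (smoothD (sF a Pa) IH) => y _; rewrite big_cons Pa.
Qed.
Lemma smooth_prod (I : Type) (r : seq I) (P : pred I) (F : I -> 'rV[R]_n -> R) :
  (forall a, P a -> smooth_on U (F a)) -> smooth_on U (fun y => \prod_(a <- r | P a) F a y).
Proof.
move=> sF; elim: r => [|a r IH].
  by apply: eq_smooth (smooth_cst 1) => y _; rewrite big_nil.
case Pa: (P a); last by apply: eq_smooth IH => y _; rewrite big_cons Pa.
by apply: eq_smooth (smoothM (sF a Pa) IH) => y _; rewrite big_cons Pa.
Qed.
Lemma smoothV f : (forall y, U y -> f y != 0) -> smooth_on U f -> smooth_on U (fun y => (f y)^-1).
Proof.
move=> f0 /smooth_onP sf; apply/smooth_onP; elim=> [|k IH].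
  by apply/smoothk0 => x Ux; apply: differentiableV (f0 _ Ux); apply: smoothk_diff (sf 0%N) Ux.
apply/smoothkS; split=> [x Ux|i].
  by apply: differentiableV (f0 _ Ux); apply: smoothk_diff (sf 0%N) Ux.
have /smoothkS[_ /(_ i) sfi] := sf k.+1.
have sN : smoothk U k (fun=> -1) by have /smooth_onP := smooth_cst (-1).
apply: eq_smoothk (smoothkM (smoothkM sN (smoothkM IH IH)) sfi) => y Uy.
rewrite partialV ?f0 //; last exact: smoothk_diff (sf 0%N) Uy.
by rewrite mulN1r expr2 invfM.
Qed.
End Open.
End Partial.

(** * Symmetry of second derivatives and the chain rule *)

Section Schwarz.
Variables (R : realType) (n : nat).
Implicit Types (f h : 'rV[R]_n -> R) (U : set 'rV[R]_n) (x y v : 'rV[R]_n) (i j : 'I_n).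

Lemma line_is_derive f y v (t : R) : differentiable f (y + t *: v) ->
  is_derive t 1 (fun s : R => f (y + s *: v)) ('D_v f (y + t *: v)).
Proof.
move=> df.
have [da da'] : is_diff t (cst y + ( *:%R^~ v)) (0 + ( *:%R^~ v)) by exact: is_diffD.
have dfa : differentiable (f \o (cst y + ( *:%R^~ v))) t.
  exact: differentiable_comp.
apply: DeriveDef; first exact: (diff_derivable dfa).
rewrite (deriveE _ dfa) diff_comp //= da'.
by rewrite (deriveE _ df) !fctE add0r scale1r.
Qed.

(* The left-hand side of the conclusion is symmetric in [i] and [j]: see [partialC]. *)
Lemma second_difference U f i j x (t : R) : 0 < t ->
  (forall a b : R, 0 <= a <= t -> 0 <= b <= t -> U (x + a *: delta_mx 0 i + b *: delta_mx 0 j)) ->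
  (forall y, U y -> differentiable f y) ->
  (forall y, U y -> differentiable (partial i f) y) ->
  exists a b : R, [/\ 0 <= a <= t, 0 <= b <= t &
    f (x + t *: delta_mx 0 i + t *: delta_mx 0 j) - f (x + t *: delta_mx 0 i)
    - (f (x + t *: delta_mx 0 j) - f x) =
    t ^+ 2 * partial j (partial i f) (x + a *: delta_mx 0 i + b *: delta_mx 0 j)].
Proof.
move=> t0 Ux df ddf; set ei := delta_mx 0 i; set ej := delta_mx 0 j.
have tt : 0 <= t <= t by rewrite lexx ltW.
have zt : (0 : R) <= 0 <= t by rewrite lexx ltW.
have U1 a : 0 <= a <= t -> U (x + a *: ei) by move=> at'; have := Ux a 0 at' zt; rewrite scale0r addr0.
have U2 a : 0 <= a <= t -> U (x + t *: ej + a *: ei) by move=> at'; rewrite addrAC; apply: Ux.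
have dG a : 0 <= a <= t -> is_derive a 1 (fun s : R => f (x + t *: ej + s *: ei) - f (x + s *: ei))
    (partial i f (x + t *: ej + a *: ei) - partial i f (x + a *: ei)).
  move=> a0t; apply: is_deriveB.
  - by apply: line_is_derive; apply/df/U2.
  - by apply: line_is_derive; apply/df/U1.
(* The mean value theorem along [ei], applied to a difference of f across the square; it is applied
   again below, along [ej], to [partial i f]. *)
have [a a0t Ga] : exists2 a, a \in `]0, t[ & (f (x + t *: ej + t *: ei) - f (x + t *: ei)) -
    (f (x + t *: ej + 0 *: ei) - f (x + 0 *: ei)) =
    (partial i f (x + t *: ej + a *: ei) - partial i f (x + a *: ei)) * (t - 0).
  apply: (MVT (f := fun s : R => f (x + t *: ej + s *: ei) - f (x + s *: ei))
    (df := fun s : R => partial i f (x + t *: ej + s *: ei) - partial i f (x + s *: ei))) => //.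
    by move=> a; rewrite in_itv /= => /andP[a0 a1]; apply: dG; rewrite !ltW.
  apply: continuous_in_subspaceT => a; rewrite inE /= in_itv /= => a0t.
  by apply: differentiable_continuous; apply/derivable1_diffP; have [] := dG a a0t.
have {}a0t : 0 <= a <= t by move: a0t; rewrite in_itv /= => /andP[a0 a1]; rewrite !ltW.
have dH b : 0 <= b <= t -> is_derive b 1 (fun s : R => partial i f (x + a *: ei + s *: ej))
    (partial j (partial i f) (x + a *: ei + b *: ej)).
  by move=> b0t; apply: line_is_derive; apply/ddf/Ux.
have dH' : forall b : R, b \in `]0, t[ -> is_derive b 1 (fun s : R => partial i f (x + a *: ei + s *: ej))
    (partial j (partial i f) (x + a *: ei + b *: ej)).
  by move=> b; rewrite in_itv /= => /andP[b0 b1]; apply: dH; rewrite !ltW.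
have cH : {within `[0, t], continuous (fun s : R => partial i f (x + a *: ei + s *: ej))}.
  apply: continuous_in_subspaceT => b; rewrite inE /= in_itv /= => b0t.
  by apply: differentiable_continuous; apply/derivable1_diffP; have [] := dH b b0t.
have [b b0t Hb] := MVT t0 dH' cH.
exists a, b; split=> //.
  by move: b0t; rewrite in_itv /= => /andP[b0 b1]; rewrite !ltW.
move: Ga Hb; rewrite !scale0r !addr0 !subr0 [x + t *: ej + _]addrAC [x + t *: ej + a *: _]addrAC => -> ->.
ring.
Qed.

Lemma dist_half (a b u v e : R) :
  u = v -> `|b - u| < e / 2 -> `|a - v| < e / 2 -> `|a - b| <= e.
Proof.
move=> -> h1 h2; rewrite -(subrK v a) -addrA; apply: (le_trans (ler_normD _ _)).
rewrite [leRHS]splitr; apply: lerD; first exact: ltW.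
by rewrite distrC; exact: ltW.
Qed.

(** Both mixed derivatives represent the same second difference over a small square, so their values
    agree at two suitable points near x; continuity brings both values to x. *)
Lemma partialC U f i j x : open U -> U x -> smooth_on U f ->
  partial i (partial j f) x = partial j (partial i f) x.
Proof.
move=> oU Ux sf.
apply/eqP; rewrite -subr_eq0 -normr_le0; apply/ler_addgt0Pr => e e0; rewrite add0r.
have ci : {for x, continuous (partial i (partial j f))}.
  by apply/differentiable_continuous/(smooth_diff _ Ux)/smooth_partial/smooth_partial.
have cj : {for x, continuous (partial j (partial i f))}.
  by apply/differentiable_continuous/(smooth_diff _ Ux)/smooth_partial/smooth_partial.
have e2 : 0 < e / 2 by rewrite divr_gt0.
pose A := partial i (partial j f); pose B := partial j (partial i f).
have nA : \forall y \near x, `|A x - A y| < e / 2 by move/cvgrPdist_lt: ci => /(_ _ e2).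
have nB : \forall y \near x, `|B x - B y| < e / 2 by move/cvgrPdist_lt: cj => /(_ _ e2).
have nU : \forall y \near x, U y by exact: open_nbhs_nbhs.
have [r r0 rP] := (nbhs_ballP _ _).1 (filterI nU (filterI nA nB)).
(* Small enough for the whole square of side t to lie in the ball of radius r. *)
pose t := r / (2 * (`|delta_mx 0 i : 'rV[R]_n| + `|delta_mx 0 j : 'rV[R]_n| + 1)).
have d0 : 0 < `|delta_mx 0 i : 'rV[R]_n| + `|delta_mx 0 j : 'rV[R]_n| + 1.
  by rewrite ltr_wpDl // addr_ge0.
have t0 : 0 < t by rewrite divr_gt0 // mulr_gt0.
have inb a b : 0 <= a <= t -> 0 <= b <= t -> ball x r (x + a *: delta_mx 0 i + b *: delta_mx 0 j).
  move=> /andP[a0 a1] /andP[b0 b1]; rewrite -ball_normE /= -addrA opprD addNKr normrN.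
  apply: (le_lt_trans (ler_normD _ _)); rewrite !normrZ (ger0_norm a0) (ger0_norm b0).
  apply: (@le_lt_trans _ _ (t * (`|delta_mx 0 i : 'rV[R]_n| + `|delta_mx 0 j : 'rV[R]_n| + 1))).
    rewrite !mulrDr mulr1; apply: (@le_trans _ _ (t * `|delta_mx 0 i : 'rV[R]_n| + t * `|delta_mx 0 j : 'rV[R]_n|)).
      by apply: lerD; apply: ler_wpM2r.
    by rewrite lerDl ltW.
  rewrite /t invfM mulrA -mulrA mulVf ?gt_eqF // mulr1.
  by rewrite ltr_pdivrMr // mulr_natr mulr2n ltrDl.
have dU y : U y -> differentiable f y by exact: smooth_diff.
have [a [b [a0 b0 E1]]] := @second_difference U f i j x t t0
  (fun a b ha hb => (rP _ (inb a b ha hb)).1) dU (fun y => smooth_diff (smooth_partial i sf)).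
have inb' a' b' : 0 <= a' <= t -> 0 <= b' <= t -> ball x r (x + a' *: delta_mx 0 j + b' *: delta_mx 0 i).
  by move=> ha hb; rewrite addrAC; apply: inb.
have [c [d [c0 d0' E2]]] := @second_difference U f j i x t t0
  (fun a b ha hb => (rP _ (inb' a b ha hb)).1) dU (fun y => smooth_diff (smooth_partial j sf)).
have E : partial j (partial i f) (x + a *: delta_mx 0 i + b *: delta_mx 0 j) =
         partial i (partial j f) (x + c *: delta_mx 0 j + d *: delta_mx 0 i).
  apply: (mulfI (x := t ^+ 2)); first by rewrite expf_neq0 // gt_eqF.
  have cm : x + t *: delta_mx 0 j + t *: delta_mx 0 i = x + t *: delta_mx 0 i + t *: delta_mx 0 j.
    exact: addrAC.
  apply: etrans (esym E1) (etrans _ E2); rewrite cm.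
  move: (f (x + t *: delta_mx 0 i + t *: delta_mx 0 j)) (f (x + t *: delta_mx 0 i)) (f (x + t *: delta_mx 0 j)) (f x).
  by move=> a1 a2 a3 a4; ring.
have [_ [_ H1]] := rP _ (inb a b a0 b0).
have [_ [H2 _]] := rP _ (inb' c d c0 d0').
exact: (dist_half E H1 H2).
Qed.

Lemma rV_sum m (phi : 'rV[R]_n -> 'rV[R]_m) :
  phi = \sum_a (fun z => phi z 0 a *: delta_mx 0 a).
Proof. by apply/funext => z; rewrite fct_sumE [LHS]row_sum_delta. Qed.

Lemma differentiable_rV m (phi : 'rV[R]_n -> 'rV[R]_m) x :
  (forall a, differentiable (fun z => phi z 0 a) x) -> differentiable phi x.
Proof.
move=> dphi; rewrite (rV_sum phi).
by apply: differentiable_sum => a; apply: differentiableZl.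
Qed.

Lemma partial_comp m (f : 'rV[R]_m -> R) (phi : 'rV[R]_n -> 'rV[R]_m) i x :
  (forall a, differentiable (fun z => phi z 0 a) x) -> differentiable f (phi x) ->
  partial i (fun z => f (phi z)) x = \sum_a partial i (fun z => phi z 0 a) x * partial a f (phi x).
Proof.
move=> dphi df; have dp := differentiable_rV dphi.
rewrite partialE; last exact: differentiable_comp.
rewrite (_ : (fun z => f (phi z)) = f \o phi) // diff_comp //=.
have -> : 'd phi x (delta_mx 0 i) = \sum_a partial i (fun z => phi z 0 a) x *: delta_mx 0 a.
  rewrite -(deriveE _ dp) {1}(rV_sum phi) derive_sum; last first.
    by move=> a; apply/diff_derivable/differentiableZl.
  apply: eq_bigr => a _; rewrite deriveE; last exact: differentiableZl.
  by rewrite diffZl // -(partialE _ (dphi a)).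
rewrite raddf_sum; apply: eq_bigr => a _.
transitivity (partial i (fun z => phi z 0 a) x *: 'd f (phi x) (delta_mx 0 a)).
  exact: (linearZZ ('d f (phi x))).
by rewrite -(partialE _ df).
Qed.
End Schwarz.

(** * Levi-Civita connection and curvature *)

Definition dM (R : realType) (n : nat) (k : 'I_n) (A : 'rV[R]_n -> 'M[R]_n) x : 'M[R]_n :=
  \matrix_(i, j) partial k (fun y => A y i j) x.

(* Closes an identity which holds in the free abelian group on the matrix products. *)
Ltac mx_abel :=
  rewrite -?mulmxA;
  repeat match goal with |- context [?A *m ?B] => move: (A *m B) => ? end;
  repeat match goal with |- context [@dM ?R ?n ?k ?A ?x] => move: (@dM R n k A x) => ? end;
  let a := fresh in let b := fresh in
  apply/matrixP => a b; rewrite !mxE; ring.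

Section Metric.
Variables (R : realType) (n : nat) (U : set 'rV[R]_n) (g : 'rV[R]_n -> 'M[R]_n).
Hypothesis oU : open U.
Implicit Types (A B : 'rV[R]_n -> 'M[R]_n) (i j k l m p q r : 'I_n) (x y : 'rV[R]_n).

Lemma smooth_det (d : nat) (A : 'rV[R]_n -> 'M[R]_d) :
  (forall a b, smooth_on U (fun y => A y a b)) -> smooth_on U (fun y => \det (A y)).
Proof.
move=> sA; apply: smooth_sum => // s _; apply: smoothM => //; first exact: smooth_cst.
by apply: smooth_prod.
Qed.

Definition smooth_mx A := forall i j, smooth_on U (fun y => A y i j).

Lemma smooth_mulmx A B : smooth_mx A -> smooth_mx B -> smooth_mx (fun y => A y *m B y).
Proof.
move=> sA sB i j; under eq_fun do rewrite mxE.
by apply: smooth_sum => // p _; apply: smoothM => //.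
Qed.
Lemma smooth_trmx A : smooth_mx A -> smooth_mx (fun y => (A y)^T).
Proof. by move=> sA i j; under eq_fun do rewrite mxE; apply: sA. Qed.
Lemma smooth_addmx A B : smooth_mx A -> smooth_mx B -> smooth_mx (fun y => A y + B y).
Proof. by move=> sA sB i j; under eq_fun do rewrite mxE; apply: smoothD => //. Qed.
Lemma smooth_dM k A : smooth_mx A -> smooth_mx (dM k A).
Proof. by move=> sA i j; under eq_fun do rewrite mxE; apply/smooth_partial/sA. Qed.

Section At.
Variable x : 'rV[R]_n.
Hypothesis Ux : U x.

Lemma smx_diff A i j : smooth_mx A -> differentiable (fun y => A y i j) x.
Proof. by move=> sA; apply: smooth_diff (sA i j) Ux. Qed.

Lemma dM_mul k A B : smooth_mx A -> smooth_mx B ->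
  dM k (fun y => A y *m B y) x = dM k A x *m B x + A x *m dM k B x.
Proof.
move=> sA sB; apply/matrixP => i j; rewrite !mxE.
under eq_fun do rewrite mxE.
rewrite partial_sumf => [|p]; last by apply: differentiableM; apply: smx_diff.
rewrite -big_split; apply: eq_bigr => p _ /=.
by rewrite partialM; [rewrite !mxE|apply: smx_diff|apply: smx_diff].
Qed.
Lemma dM_add k A B : smooth_mx A -> smooth_mx B ->
  dM k (fun y => A y + B y) x = dM k A x + dM k B x.
Proof.
move=> sA sB; apply/matrixP => i j; rewrite !mxE.
under eq_fun do rewrite mxE.
by rewrite partialD //; apply: smx_diff.
Qed.
Lemma dM_opp k A : smooth_mx A -> dM k (fun y => - A y) x = - dM k A x.
Proof.
move=> sA; apply/matrixP => i j; rewrite !mxE.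
under eq_fun do rewrite mxE.
by rewrite partialN //; apply: smx_diff.
Qed.
Lemma dM_tr k A : dM k (fun y => (A y)^T) x = (dM k A x)^T.
Proof. by apply/matrixP => i j; rewrite !mxE; under eq_fun do rewrite mxE. Qed.
Lemma dM_eq k A B : (forall y, U y -> A y = B y) -> dM k A x = dM k B x.
Proof.
move=> AB; apply/matrixP => i j; rewrite !mxE.
by apply: (eq_on_partial _ oU Ux) => y Uy; rewrite AB.
Qed.
Lemma dMC j k A : smooth_mx A -> dM j (dM k A) x = dM k (dM j A) x.
Proof.
move=> sA; apply/matrixP => a b.
have e c : (fun y => dM c A y a b) = partial c (fun y => A y a b).
  by apply/funext => y; rewrite mxE.
rewrite [LHS]mxE [RHS]mxE !e.
exact: (partialC j k oU Ux (sA a b)).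
Qed.
End At.

Hypothesis gsm : smooth_mx g.
Hypothesis gs : forall x, U x -> (g x)^T = g x.
Hypothesis gu : forall x, U x -> g x \in unitmx.
Local Notation gi y := (invmx (g y)).
Local Notation Gm m i j := (christoffel g m i j).

Lemma gVg x : U x -> gi x *m g x = 1%:M.
Proof. by move=> Ux; rewrite mulVmx ?gu. Qed.
Lemma ggV x : U x -> g x *m gi x = 1%:M.
Proof. by move=> Ux; rewrite mulmxV ?gu. Qed.
Lemma gis x : U x -> (gi x)^T = gi x.
Proof. by move=> Ux; rewrite trmx_inv gs. Qed.
Lemma gsC x i j : U x -> g x i j = g x j i.
Proof. by move=> Ux; rewrite -{1}(gs Ux) mxE. Qed.

Lemma ginv_smooth : smooth_mx (fun y => gi y).
Proof.
move=> i j.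
apply: (@eq_smooth _ _ U oU (fun y => (\det (g y))^-1 * (\adj (g y)) i j)).
  by move=> y Uy; rewrite /invmx gu // [RHS]mxE.
apply: smoothM => //.
  by apply: smoothV => //; [move=> y Uy; have := gu Uy; rewrite unitmxE unitfE|apply: smooth_det; exact: gsm].
apply: (@eq_smooth _ _ U oU (fun y => (-1) ^+ (j + i) * \det (row' j (col' i (g y))))).
  by move=> y Uy; rewrite mxE.
apply: smoothM => //; first exact: smooth_cst.
by apply: smooth_det => a b; under eq_fun do rewrite !mxE; apply: gsm.
Qed.

Lemma christoffel_smooth m i j : smooth_on U (Gm m i j).
Proof.
apply: smoothM => //; first exact: smooth_cst.
apply: smooth_sum => // p _; apply: smoothM => //; first exact: ginv_smooth.
by apply: smoothB => //; [apply: smoothD => //|]; apply: smooth_partial.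
Qed.

Lemma christoffelC m i j x : U x -> Gm m i j x = Gm m j i x.
Proof.
move=> Ux; rewrite /christoffel; congr (_ * _); apply: eq_bigr => p _; congr (_ * _).
rewrite [partial i _ x + _]addrC; congr (_ - _).
by apply: (eq_on_partial _ oU Ux) => y Uy; apply: gsC.
Qed.

Lemma christoffel_lower i j q x : U x ->
  \sum_m Gm m i j x * g x m q = 2^-1 * (partial i (fun y => g y j q) x + partial j (fun y => g y i q) x
     - partial q (fun y => g y i j) x).
Proof.
move=> Ux; set D := fun p => partial i (fun y => g y j p) x + partial j (fun y => g y i p) x
     - partial p (fun y => g y i j) x.
rewrite -/(D q) -(ctr_lg (gVg Ux) (gis Ux) q D) /ctr mulr_sumr; apply: eq_bigr => m _.
rewrite /christoffel -mulrA mulr_suml; congr (_ * _); apply: eq_bigr => p _.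
by rewrite -mulrA.
Qed.

(** The lower index is the row, so that nabla_k of a covariant 2-tensor T is dM k T - Gam k T - T
    (Gam k)^T and the quadratic part of the curvature is a commutator. *)
Definition Gam k x : 'M[R]_n := \matrix_(l, m) Gm m k l x.

Lemma Gam_smooth k : smooth_mx (Gam k).
Proof. by move=> i j; under eq_fun do rewrite mxE; apply: christoffel_smooth. Qed.

Lemma metric_compat k x : U x -> dM k g x = Gam k x *m g x + g x *m (Gam k x)^T.
Proof.
move=> Ux; apply/matrixP => i j; rewrite !mxE.
have -> : \sum_p Gam k x i p * g x p j = \sum_p Gm p k i x * g x p j.
  by apply: eq_bigr => p _; rewrite mxE.
have -> : \sum_p g x i p * (Gam k x)^T p j = \sum_p Gm p k j x * g x p i.
  by apply: eq_bigr => p _; rewrite !mxE gsC // mulrC.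
rewrite !christoffel_lower //.
have -> : partial k (fun y => g y j i) x = partial k (fun y => g y i j) x.
  by apply: (eq_on_partial _ oU Ux) => y Uy; apply: gsC.
lra.
Qed.

Lemma dM_ginv k x : U x -> dM k (fun y => gi y) x = - (gi x *m Gam k x + (Gam k x)^T *m gi x).
Proof.
move=> Ux.
have e : dM k (fun y => gi y *m g y) x = 0.
  rewrite (dM_eq Ux k (B := fun=> 1%:M)); last by move=> y Uy; rewrite gVg.
  by apply/matrixP => i j; rewrite !mxE partial_cst.
rewrite dM_mul // in e; last exact: ginv_smooth.
have {}e : dM k (fun y => gi y) x *m g x = - (gi x *m dM k g x) by apply/eqP; rewrite -addr_eq0 e.
rewrite -[LHS]mulmx1 -(ggV Ux) mulmxA e metric_compat // mulNmx; congr (- _).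
by rewrite mulmxDr mulmxDl -!mulmxA ggV // mulmx1 !mulmxA gVg // mul1mx.
Qed.

Definition Rmat j k x : 'M[R]_n := \matrix_(l, m) riemann g j k l m x.

Lemma RmatE j k x : Rmat j k x = dM k (Gam j) x - dM j (Gam k) x
   + (Gam j x *m Gam k x - Gam k x *m Gam j x).
Proof.
apply/matrixP => l m; rewrite !mxE /riemann; congr (_ - _ + _).
- by congr (partial _ _ _); apply/funext => y; rewrite mxE.
- by congr (partial _ _ _); apply/funext => y; rewrite mxE.
- by rewrite -sumrB; apply: eq_bigr => p _; rewrite !mxE.
Qed.

Lemma Rmat_smooth j k : smooth_mx (Rmat j k).
Proof.
move=> a b; under eq_fun do rewrite mxE; rewrite /riemann.
apply: smoothD => //.
  by apply: smoothB => //; apply/smooth_partial/christoffel_smooth.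
by apply: smooth_sum => // p _; apply: smoothB => //; apply: smoothM => //; apply: christoffel_smooth.
Qed.

Lemma Rmat_anti j k x : Rmat j k x = - Rmat k j x.
Proof. by rewrite !RmatE !opprD !opprK; congr (_ + _); rewrite addrC. Qed.

(** The integrability condition of nabla T = 0: the second derivatives of T, computed from the
    equation itself, must be symmetric, and their antisymmetric part is the action of the curvature
    on T. *)
Lemma parallel_Rmat (T : 'rV[R]_n -> 'M[R]_n) : smooth_mx T ->
  (forall y, U y -> forall k, dM k T y = Gam k y *m T y + T y *m (Gam k y)^T) ->
  forall x, U x -> forall j k, Rmat j k x *m T x + T x *m (Rmat j k x)^T = 0.
Proof.
move=> sT dT x Ux j k.
have [Z [ZR d2]] : exists Z : 'I_n -> 'I_n -> 'M[R]_n, Rmat j k x = Z k j - Z j k /\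
    forall a b, dM a (dM b T) x = Z a b *m T x + T x *m (Z a b)^T
    + Gam b x *m T x *m (Gam a x)^T + Gam a x *m T x *m (Gam b x)^T.
  exists (fun a b => dM a (Gam b) x + Gam b x *m Gam a x); split=> [|a b].
    rewrite RmatE; mx_abel.
  rewrite (dM_eq Ux a (B := fun y => Gam b y *m T y + T y *m (Gam b y)^T)); last by move=> y Uy; apply: dT.
  have sG := Gam_smooth b; have sGt := smooth_trmx sG.
  rewrite dM_add //; [|exact: smooth_mulmx|exact: smooth_mulmx].
  rewrite !dM_mul // dM_tr dT // [(_ + _)^T]linearD /= trmx_mul !mulmxDr !mulmxDl !mulmxA.
  mx_abel.
have h : dM j (dM k T) x - dM k (dM j T) x = 0 by rewrite dMC ?subrr.
rewrite -[RHS]oppr0 -h !d2 ZR [(_ - _)^T]linearB /= mulmxBl mulmxBr; mx_abel.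
Qed.
End Metric.

(* The Jacobi identity behind the second Bianchi identity: [G], [D1], [D2] are the
   connection matrices and their first and second derivatives. *)
Lemma curvature_jacobi (R : comNzRingType) (n : nat) (I : Type) (G : I -> 'M[R]_n)
    (D1 : I -> I -> 'M[R]_n) (D2 : I -> I -> I -> 'M[R]_n) (i j k : I) :
  (forall a b c, D2 a b c = D2 b a c) ->
  let F j k := D1 k j - D1 j k + (G j *m G k - G k *m G j) in
  let dF i j k := D2 i k j - D2 i j k + (D1 i j *m G k + G j *m D1 i k
                  - (D1 i k *m G j + G k *m D1 i j)) in
  let B i j k := dF i j k - G i *m F j k + F j k *m G i in
  B i j k + B j k i + B k i j = 0.
Proof.
move=> D2C F dF B; rewrite /B /dF /F (D2C i k j) (D2C j i k) (D2C k j i).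
rewrite !(mulmxDl, mulmxDr, mulmxBl, mulmxBr, mulNmx, mulmxN); mx_abel.
Qed.

Lemma mulmx_sum3 (R : comNzRingType) (n : nat) (A B C : 'M[R]_n) (G : 'M[R]_n) l m :
  A + B + C = 0 -> (A *m G) l m + (B *m G) l m + (C *m G) l m = 0.
Proof.
move=> e; transitivity (((A + B + C) *m G) l m); last by rewrite e mul0mx mxE.
by rewrite !mulmxDl [RHS]mxE [X in _ = X + _]mxE.
Qed.

(** * Symmetries of the curvature tensor and the second Bianchi identity *)

Section Curvature.
Variables (R : realType) (n : nat) (U : set 'rV[R]_n) (g : 'rV[R]_n -> 'M[R]_n).
Hypothesis oU : open U.
Implicit Types (A B : 'rV[R]_n -> 'M[R]_n) (i j k l m p q r : 'I_n) (x y : 'rV[R]_n).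
Hypothesis gsm : smooth_mx U g.
Hypothesis gs : forall x, U x -> (g x)^T = g x.
Hypothesis gu : forall x, U x -> g x \in unitmx.
Local Notation Gm m i j := (christoffel g m i j).
Local Notation Gam := (Gam g).
Local Notation Rmat := (Rmat g).
Let Gsm := Gam_smooth oU gsm gu.
Let Rsm := Rmat_smooth oU gsm gu.

(* R_{jklm} *)
Definition Rl j k l m x : R := (Rmat j k x *m g x) l m.

Lemma RlE j k l m x : Rl j k l m x = \sum_p riemann g j k l p x * g x p m.
Proof. by rewrite [LHS]mxE; apply: eq_bigr => p _; rewrite mxE. Qed.

Lemma Rl12 j k l m x : Rl j k l m x = - Rl k j l m x.
Proof. by rewrite /Rl Rmat_anti mulNmx [LHS]mxE. Qed.

(** The metric is parallel, so the curvature annihilates it. *)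
Lemma Rl34 j k l m x : U x -> Rl j k l m x = - Rl j k m l x.
Proof.
move=> Ux.
have := parallel_Rmat oU gsm gu gsm (fun y Uy k => metric_compat oU gs gu k Uy) Ux j k.
rewrite -{2}(gs Ux) -trmx_mul => /matrixP/(_ l m); rewrite [LHS]mxE [RHS]mxE [X in _ + X]mxE.
by move=> /eqP; rewrite addr_eq0 => /eqP.
Qed.

Lemma riemann_cyc j k l m x : U x ->
  riemann g j k l m x + riemann g k l j m x + riemann g l j k m x = 0.
Proof.
move=> Ux; rewrite /riemann.
have e a b c : partial a (Gm m b c) x = partial a (Gm m c b) x.
  by apply: (eq_on_partial _ oU Ux) => y Uy; apply: (christoffelC oU gs).
have s0 : \sum_p (Gm p j l x * Gm m k p x - Gm p k l x * Gm m j p x)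
   + \sum_p (Gm p k j x * Gm m l p x - Gm p l j x * Gm m k p x)
   + \sum_p (Gm p l k x * Gm m j p x - Gm p j k x * Gm m l p x) = 0.
  rewrite -!big_split big1 //= => p _.
  rewrite (christoffelC oU gs p l k) // (christoffelC oU gs p j k) // (christoffelC oU gs p l j) //.
  move: (Gm p j l x) (Gm p k l x) (Gm p k j x) (Gm m k p x) (Gm m j p x) (Gm m l p x) => *; ring.
rewrite -[RHS]s0.
rewrite (e k j l) (e j k l) (e l k j).
have cancel (a b c s1 s2 s3 : R) : a - b + s1 + (c - a + s2) + (b - c + s3) = s1 + s2 + s3 by ring.
exact: cancel.
Qed.

Lemma Rlcyc j k l m x : U x -> Rl j k l m x + Rl k l j m x + Rl l j k m x = 0.
Proof.
move=> Ux; rewrite !RlE -!big_split big1 // => p _ /=; rewrite -!mulrDl.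
by rewrite riemann_cyc // mul0r.
Qed.

Lemma Rl_pair j k l m x : U x -> Rl j k l m x = Rl l m j k x.
Proof.
move=> Ux; apply: (pair_sym (T := fun j k l m => Rl j k l m x)) => *.
- exact: Rl12.
- exact: Rl34.
- exact: Rlcyc.
Qed.

Definition Cov i A x : 'M[R]_n := dM i A x - Gam i x *m A x - A x *m (Gam i x)^T.

(* nabla_i R_{jkl}^m without the correction terms for [j] and [k], which cancel in the
   cyclic sum. *)
Definition covR i j k x : 'M[R]_n :=
  dM i (Rmat j k) x - Gam i x *m Rmat j k x + Rmat j k x *m Gam i x.

Lemma covR_cyc i j k x : U x -> covR i j k x + covR j k i x + covR k i j x = 0.
Proof.
move=> Ux.
have e a b c : dM a (Rmat b c) x = dM a (dM c (Gam b)) x - dM a (dM b (Gam c)) x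
    + (dM a (Gam b) x *m Gam c x + Gam b x *m dM a (Gam c) x
       - (dM a (Gam c) x *m Gam b x + Gam c x *m dM a (Gam b) x)).
  rewrite (dM_eq oU Ux a (B := fun y => dM c (Gam b) y - dM b (Gam c) y
     + (Gam b y *m Gam c y - Gam c y *m Gam b y))); last by move=> y Uy; rewrite RmatE.
  have s1 := smooth_dM c (Gsm b); have s2 := smooth_dM b (Gsm c).
  have s3 := smooth_mulmx oU (Gsm b) (Gsm c); have s4 := smooth_mulmx oU (Gsm c) (Gsm b).
  have smN A : smooth_mx U A -> smooth_mx U (fun y => - A y).
    by move=> sA a' b'; under eq_fun do rewrite mxE; apply: smoothN.
  rewrite (dM_add Ux a (smooth_addmx oU s1 (smN _ s2)) (smooth_addmx oU s3 (smN _ s4))).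
  rewrite (dM_add Ux a s1 (smN _ s2)) (dM_add Ux a s3 (smN _ s4)) !(dM_opp Ux a) //.
  by rewrite !(dM_mul Ux).
rewrite /covR !e !RmatE.
exact: (@curvature_jacobi _ _ _ (fun a => Gam a x) (fun a b => dM a (Gam b) x)
  (fun a b c => dM a (dM b (Gam c)) x) i j k (fun a b c => dMC oU Ux a b (Gsm c))).
Qed.

Lemma Cov_lower i j k x : U x -> Cov i (fun y => Rmat j k y *m g y) x = covR i j k x *m g x.
Proof.
move=> Ux; rewrite /Cov /covR (dM_mul Ux) // (metric_compat oU gs gu) //.
rewrite !(mulmxDl, mulmxDr, mulNmx); mx_abel.
Qed.

(* Minus the correction term of nabla_k for a lower index [i]. *)
Definition act k x i (F : 'I_n -> R) : R := \sum_p Gm p k i x * F p.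

Lemma actD k x i F G : act k x i (fun p => F p + G p) = act k x i F + act k x i G.
Proof. by rewrite /act -big_split; apply: eq_bigr => p _; rewrite mulrDr. Qed.
Lemma actN k x i F : act k x i (fun p => - F p) = - act k x i F.
Proof. by rewrite /act -sumrN; apply: eq_bigr => p _; rewrite mulrN. Qed.
Lemma actMl k x i c F : act k x i (fun p => c * F p) = c * act k x i F.
Proof. by rewrite /act mulr_sumr; apply: eq_bigr => p _; rewrite mulrCA. Qed.
Lemma actMr k x i c F : act k x i (fun p => F p * c) = act k x i F * c.
Proof. by rewrite /act mulr_suml; apply: eq_bigr => p _; rewrite mulrA. Qed.
Lemma act0 k x i : act k x i (fun=> 0) = 0.
Proof. by rewrite /act big1 // => p _; rewrite mulr0. Qed.
Lemma eq_act k x i F G : F =1 G -> act k x i F = act k x i G.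
Proof. by move=> FG; apply: eq_bigr => p _; rewrite FG. Qed.
Lemma act_sym i j x (F : 'I_n -> R) : U x -> act i x j F = act j x i F.
Proof. by move=> Ux; apply: eq_bigr => p _; rewrite (christoffelC oU gs). Qed.

Lemma nabla4E T i j k l m x : nabla4 g T i j k l m x =
  partial i (T j k l m) x - act i x j (fun p => T p k l m x) - act i x k (fun p => T j p l m x)
  - act i x l (fun p => T j k p m x) - act i x m (fun p => T j k l p x).
Proof. by []. Qed.
Lemma nabla2E T k i j x : nabla2 g T k i j x =
  partial k (T i j) x - act k x i (fun p => T p j x) - act k x j (fun p => T i p x).
Proof. by []. Qed.

Lemma nabla4_Rl i j k l m x : nabla4 g Rl i j k l m x =
  Cov i (fun y => Rmat j k y *m g y) x l m - act i x j (fun p => Rl p k l m x) - act i x k (fun p => Rl j p l m x).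
Proof.
rewrite nabla4E.
have -> : Cov i (fun y => Rmat j k y *m g y) x l m = dM i (fun y => Rmat j k y *m g y) x l m
    - (Gam i x *m (Rmat j k x *m g x)) l m - (Rmat j k x *m g x *m (Gam i x)^T) l m.
  by rewrite [LHS]mxE [X in X + _]mxE [X in _ + X]mxE [X in _ + X + _]mxE.
have -> : act i x l (fun p => Rl j k p m x) = (Gam i x *m (Rmat j k x *m g x)) l m.
  by rewrite [RHS]mxE; apply: eq_bigr => p _; rewrite /Rl !mxE.
have -> : act i x m (fun p => Rl j k l p x) = (Rmat j k x *m g x *m (Gam i x)^T) l m.
  by rewrite [RHS]mxE; apply: eq_bigr => p _; rewrite /Rl !mxE mulrC.
have -> : dM i (fun y => Rmat j k y *m g y) x l m = partial i (Rl j k l m) x by rewrite mxE.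
have swap (P a b c d : R) : P - a - b - c - d = P - c - d - a - b by ring.
exact: swap.
Qed.

Lemma second_bianchi i j k l m x : U x ->
  nabla4 g Rl i j k l m x + nabla4 g Rl j k i l m x + nabla4 g Rl k i j l m x = 0.
Proof.
move=> Ux; rewrite !nabla4_Rl !Cov_lower //.
have e := mulmx_sum3 (g x) l m (covR_cyc i j k Ux).
have an a b c : act a x b (fun p => Rl p c l m x) = - act a x b (fun p => Rl c p l m x).
  by rewrite -actN; apply: eq_act => p; apply: Rl12.
have sy a b c : act a x b (fun p => Rl c p l m x) = - act b x a (fun p => Rl p c l m x).
  by apply: etrans (@act_sym a b x _ Ux) (etrans (esym (opprK _)) (congr1 -%R (esym (an b a c)))).
have cancel (A1 A2 A3 a1 a2 b1 b2 c1 c2 : R) : A1 + A2 + A3 = 0 -> a2 = - c1 -> b2 = - a1 -> c2 = - b1 ->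
    A1 - a1 - a2 + (A2 - b1 - b2) + (A3 - c1 - c2) = 0.
  by move=> e0 -> -> ->; rewrite -[RHS]e0; ring.
exact: cancel e (sy i k j) (sy j i k) (sy k j i).
Qed.
End Curvature.

(** * The Weyl tensor, its symmetries and its covariant derivative *)

Section Weyl.
Variables (R : realType) (n : nat) (U : set 'rV[R]_n) (g : 'rV[R]_n -> 'M[R]_n).
Hypothesis n5 : (5 <= n)%N.
Hypothesis oU : open U.
Implicit Types (A B : 'rV[R]_n -> 'M[R]_n) (i j k l m p q r : 'I_n) (x y : 'rV[R]_n).
Hypothesis gsm : smooth_mx U g.
Hypothesis gs : forall x, U x -> (g x)^T = g x.
Hypothesis gu : forall x, U x -> g x \in unitmx.
Local Notation gi y := (invmx (g y)).
Local Notation Rl := (Rl g).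
Local Notation act := (act g).
Local Notation N := (n%:R : R).

(** Normalised so that it absorbs the scalar curvature term: by [weylE], C - R is a product of g
    with this one symmetric tensor. *)
Definition schouten k l x : R :=
  (N - 2)^-1 * (ricci g k l x - scalar_curv g x / (2 * (N - 1)) * g x k l).
Local Notation S := schouten.

Lemma Nsub_neq0 (d : nat) : (d < 5)%N -> N - d%:R != 0.
Proof. by move=> d5; apply/Nsub/(leq_trans d5). Qed.
Lemma Nm1 : N - 1 != 0. Proof. exact: (@Nsub_neq0 1). Qed.
Lemma Nm2 : N - 2 != 0. Proof. exact: (@Nsub_neq0 2). Qed.

Lemma ricciE k l x : ricci g k l x = (N - 2) * S k l x + scalar_curv g x / (2 * (N - 1)) * g x k l.
Proof. by rewrite /schouten mulrA mulfV ?Nm2 // mul1r subrK. Qed.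

Section At.
Variable x : 'rV[R]_n.
Hypothesis Ux : U x.
Let gKx := gVg gu Ux.
Let gsx := gs Ux.
Let gisx := gis gs Ux.

Lemma ctr_Rl k l : ctr (gi x) (fun p q => Rl p k l q x) = - ricci g k l x.
Proof.
rewrite /ricci opprK; apply: eq_bigr => p _.
transitivity (\sum_q \sum_r riemann g p k l r x * (gi x p q * g x q r)).
  apply: eq_bigr => q _; rewrite RlE mulr_sumr; apply: eq_bigr => r _.
  by rewrite mulrCA (gsC gs r q Ux).
rewrite exchange_big (bigD1 p) //= [X in _ + X]big1 ?addr0 => [|r rp].
  by rewrite -mulr_sumr; have /matrixP/(_ p p) := gKx; rewrite !mxE eqxx => ->; rewrite mulr1.
by rewrite -mulr_sumr; have /matrixP/(_ p r) := gKx; rewrite !mxE eq_sym (negbTE rp) => ->; rewrite mulr0.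
Qed.

Lemma ricciC k l : ricci g k l x = ricci g l k x.
Proof.
apply: oppr_inj; rewrite -!ctr_Rl (ctr_swap _ gisx); apply: eq_ctr => p q.
by rewrite (Rl_pair oU gsm gs gu) // Rl12 (Rl34 oU gsm gs gu) // opprK.
Qed.

Lemma schoutenC k l : S k l x = S l k x.
Proof. by rewrite /schouten ricciC (gsC gs k l Ux). Qed.

Lemma ctr_schouten : ctr (gi x) (fun p q => S p q x) = scalar_curv g x / (2 * (N - 1)).
Proof.
rewrite /schouten; apply: ctr_eval; first by ctr_solve (g x) gKx gsx gisx ltac:(fail).
rewrite -/(scalar_curv g x) -[ctr _ _]/(scalar_curv g x); field.
by rewrite ?Nm2 ?Nm1.
Qed.

Lemma weylE j k l m : weyl g j k l m x = Rl j k l m x +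
  (g x j m * S k l x - g x k m * S j l x + S j m x * g x k l - S k m x * g x j l).
Proof.
have kr i : ev (fun p => g x p m) (fun p => kron R i p) (g x i m).
  rewrite /ev /app (bigD1 i) //= big1 ?addr0 => [|p pi]; first by rewrite /kron eqxx mulr1.
  by rewrite /kron eq_sym (negbTE pi) mulr0.
have ru i : ev (fun p => g x p m) (fun p => ricci_up g i p x) (ricci g i m x).
  transitivity (ctr (gi x) (fun r p => ricci g i r x * g x p m)); last exact: (ctr_rg gKx gisx).
  rewrite /app /ricci_up /ctr exchange_big; apply: eq_bigr => p _; rewrite mulr_sumr.
  by apply: eq_bigr => r _; rewrite mulrC -mulrA mulrCA mulrA.
transitivity (app (fun p => g x p m) (fun p => weyl_up g j k l p x)).
  by apply: eq_bigr => p _; rewrite mulrC.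
rewrite /weyl_up; apply: ev_eval.
  ev_solve ltac:(first [exact: kr | exact: ru]).
have -> : app (fun p => g x p m) (fun p => riemann g j k l p x) = Rl j k l m x.
  by rewrite RlE; apply: eq_bigr => p _; rewrite mulrC.
rewrite !ricciE; field.
by rewrite ?Nm2 ?Nm1.
Qed.

Lemma weyl_pt : weyl_tensor (g x) (gi x) (fun j k l m => weyl g j k l m x).
Proof.
split=> //.
- by move=> j k l m; rewrite !weylE Rl12; ring.
- by move=> j k l m; rewrite !weylE (Rl34 oU gsm gs gu) //; ring.
- move=> j k l m; rewrite !weylE.
  rewrite -[RHS](Rlcyc oU gs j k l m Ux) (schoutenC l j) (schoutenC l k) (schoutenC k j).
  rewrite (gsC gs l j Ux) (gsC gs l k Ux) (gsC gs k j Ux); ring.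
- move=> k l.
  rewrite (eq_ctr _ (Y := fun j m => Rl j k l m x +
    (g x j m * S k l x - g x k m * S j l x + S j m x * g x k l - S k m x * g x j l))); last first.
    by move=> p q; rewrite weylE.
  apply: ctr_eval; first by ctr_solve (g x) gKx gsx gisx ltac:(first [exact: ctr_Rl | exact: ctr_schouten]).
  rewrite ricciE; ring.
Qed.
End At.

Lemma riemann_smooth j k l m : smooth_on U (riemann g j k l m).
Proof.
have := Rmat_smooth oU gsm gu j k l m.
by under eq_fun do rewrite mxE.
Qed.
Lemma Rl_smooth j k l m : smooth_on U (Rl j k l m).
Proof. by apply: smooth_mulmx => //; apply: Rmat_smooth. Qed.
Lemma ricci_smooth k l : smooth_on U (ricci g k l).
Proof. by apply: smoothN => //; apply: smooth_sum => // m _; apply: riemann_smooth. Qed.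
Lemma scal_smooth : smooth_on U (scalar_curv g).
Proof.
apply: smooth_sum => // i _; apply: smooth_sum => // j _; apply: smoothM => //; last exact: ricci_smooth.
exact: (ginv_smooth oU gsm gu).
Qed.
Lemma schouten_smooth k l : smooth_on U (S k l).
Proof.
apply: smoothM => //; first exact: smooth_cst.
apply: smoothB => //; first exact: ricci_smooth.
apply: smoothM => //; apply: smoothM => //; [exact: scal_smooth|exact: smooth_cst].
Qed.
Lemma weyl_smooth j k l m : smooth_on U (weyl g j k l m).
Proof.
apply: (@eq_smooth _ _ U oU (fun x => Rl j k l m x +
  (g x j m * S k l x - g x k m * S j l x + S j m x * g x k l - S k m x * g x j l))).
  by move=> y Uy; rewrite weylE.
apply: smoothD => //; first exact: Rl_smooth.
by apply: smoothB => //; first apply: smoothD => //; first apply: smoothB => //; apply: smoothM => //;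
  (exact: gsm || exact: schouten_smooth).
Qed.

Section At2.
Variable x : 'rV[R]_n.
Hypothesis Ux : U x.

Lemma nabla4_eq T T' i j k l m : (forall j k l m y, U y -> T j k l m y = T' j k l m y) ->
  nabla4 g T i j k l m x = nabla4 g T' i j k l m x.
Proof.
move=> TT; rewrite !nabla4E (eq_on_partial i oU Ux (TT j k l m)).
congr (_ - _ - _ - _ - _); apply: eq_act => p; exact: TT.
Qed.

Lemma nabla2_g k i j : nabla2 g (fun i j y => g y i j) k i j x = 0.
Proof.
have := congr1 (fun M : 'M[R]_n => M i j) (metric_compat oU gs gu k Ux).
rewrite [LHS]mxE [RHS]mxE nabla2E => ->.
have -> : act k x i (fun p => g x p j) = (Gam g k x *m g x) i j.
  by rewrite [RHS]mxE; apply: eq_bigr => p _; rewrite mxE.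
have -> : act k x j (fun p => g x i p) = (g x *m (Gam g k x)^T) i j.
  by rewrite [RHS]mxE; apply: eq_bigr => p _; rewrite !mxE mulrC.
move: ((_ *m _) i j) ((_ *m _) i j) => *; ring.
Qed.

(** The digits record the slots taken by the two factors: 1 and 4 by [A], 2 and 3 by [B]. *)
Lemma nabla4_1423 (A B : 'I_n -> 'I_n -> 'rV[R]_n -> R) i j k l m :
  (forall a b, differentiable (A a b) x) -> (forall a b, differentiable (B a b) x) ->
  nabla4 g (fun j k l m y => A j m y * B k l y) i j k l m x =
  nabla2 g A i j m x * B k l x + A j m x * nabla2 g B i k l x.
Proof. by move=> dA dB; rewrite nabla4E !nabla2E partialM // !actMl !actMr; ring. Qed.
Lemma nabla4_2413 (A B : 'I_n -> 'I_n -> 'rV[R]_n -> R) i j k l m :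
  (forall a b, differentiable (A a b) x) -> (forall a b, differentiable (B a b) x) ->
  nabla4 g (fun j k l m y => A k m y * B j l y) i j k l m x =
  nabla2 g A i k m x * B j l x + A k m x * nabla2 g B i j l x.
Proof. by move=> dA dB; rewrite nabla4E !nabla2E partialM // !actMl !actMr; ring. Qed.

Lemma nabla4_add T T' i j k l m :
  (forall j k l m, differentiable (T j k l m) x) -> (forall j k l m, differentiable (T' j k l m) x) ->
  nabla4 g (fun j k l m y => T j k l m y + T' j k l m y) i j k l m x =
  nabla4 g T i j k l m x + nabla4 g T' i j k l m x.
Proof. by move=> dT dT'; rewrite !nabla4E partialD // !actD; ring. Qed.
Lemma nabla4_opp T i j k l m : (forall j k l m, differentiable (T j k l m) x) ->
  nabla4 g (fun j k l m y => - T j k l m y) i j k l m x = - nabla4 g T i j k l m x.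
Proof. by move=> dT; rewrite !nabla4E partialN // !actN; ring. Qed.

Lemma nabla4_weyl i j k l m : nabla4 g (weyl g) i j k l m x = nabla4 g Rl i j k l m x +
  (g x j m * nabla2 g S i k l x - g x k m * nabla2 g S i j l x
   + nabla2 g S i j m x * g x k l - nabla2 g S i k m x * g x j l).
Proof.
pose G i j (y : 'rV[R]_n) := g y i j.
have dg a b : differentiable (G a b) x by apply: smooth_diff (gsm a b) Ux.
have dS a b : differentiable (S a b) x by apply: smooth_diff (schouten_smooth a b) Ux.
have dR a b c d : differentiable (Rl a b c d) x by apply: smooth_diff (Rl_smooth a b c d) Ux.
have dgS a b c d : differentiable (fun y => G a b y * S c d y) x by exact: differentiableM.
have dSg a b c d : differentiable (fun y => S a b y * G c d y) x by exact: differentiableM.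
have ng a b c : nabla2 g G a b c x = 0 by exact: nabla2_g.
rewrite (@nabla4_eq (weyl g) (fun j k l m y => Rl j k l m y +
  (G j m y * S k l y + - (G k m y * S j l y) + S j m y * G k l y + - (S k m y * G j l y)))); last first.
  by move=> *; rewrite weylE.
rewrite nabla4_add //; last first.
  by move=> *; do ?apply: differentiableD => //; apply: differentiableN.
rewrite nabla4_add //; [|by move=> *; do ?apply: differentiableD => //; apply: differentiableN|by move=> *; apply: differentiableN].
rewrite nabla4_add //; [|by move=> *; do ?apply: differentiableD => //; apply: differentiableN].
rewrite nabla4_add //; [|by move=> *; apply: differentiableN].
rewrite !nabla4_opp // !nabla4_1423 // !nabla4_2413 // !ng; rewrite /G; ring.
Qed.

(** The curvature drops out of the cyclic sum of nabla C by the second Bianchi identity. What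
    remains are products of the metric with the Cotton tensor [Y], as [cotton_bianchi] requires. *)
Lemma weyl_bianchi (al : 'I_n -> R) :
  (forall i j k l m, nabla4 g (weyl g) i j k l m x = al i * weyl g j k l m x) ->
  bianchi (g x) (gi x) (fun j k l m => weyl g j k l m x) al.
Proof.
move=> rec; have [_ gK gs' gis' h12 h34 hc ht] := weyl_pt Ux.
pose Y j k l := nabla2 g S j k l x - nabla2 g S k j l x.
apply: (cotton_bianchi n5 gK gs' gis' h12 h34 ht (Y := Y)).
  move=> j k l; by rewrite /Y [RHS]opprB.
move=> i j k l m; rewrite -!rec !nabla4_weyl.
have := second_bianchi oU gsm gs gu i j k l m Ux.
rewrite /Y; move: (nabla2 g S) (nabla4 g Rl) => nS V e.
by rewrite -[LHS]subr0 -e; ring.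
Qed.
End At2.
End Weyl.

(** * Conformally recurrent metrics *)

(** Reconciles iterated [ctr], which sums over indices pair by pair, with [weyl_contr], which first
    raises three indices and then sums. *)
Lemma big_interleave (R : nmodType) (I : finType) (F : I -> I -> I -> I -> I -> I -> R) :
  \sum_k \sum_k' \sum_l \sum_l' \sum_m \sum_m' F k k' l l' m m' =
  \sum_k' \sum_l' \sum_m' \sum_k \sum_l \sum_m F k k' l l' m m'.
Proof.
rewrite exchange_big; apply: eq_bigr => k' _.
transitivity (\sum_l' \sum_k \sum_l \sum_m \sum_m' F k k' l l' m m').
  by rewrite [RHS]exchange_big; apply: eq_bigr => k _; rewrite exchange_big.
apply: eq_bigr => l' _; rewrite [RHS]exchange_big; apply: eq_bigr => k _.
by rewrite [RHS]exchange_big; apply: eq_bigr => l _; rewrite exchange_big.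
Qed.

Lemma ctr3E (K : comNzRingType) n (gi : 'M[K]_n) (F : 'I_n -> 'I_n -> 'I_n -> 'I_n -> 'I_n -> 'I_n -> K) :
  ctr gi (fun k k' => ctr gi (fun l l' => ctr gi (fun m m' => F k k' l l' m m'))) =
  \sum_k \sum_k' \sum_l \sum_l' \sum_m \sum_m' gi k k' * gi l l' * gi m m' * F k k' l l' m m'.
Proof.
apply: eq_bigr => k _; apply: eq_bigr => k' _; rewrite /ctr mulr_sumr.
apply: eq_bigr => l _; rewrite mulr_sumr; apply: eq_bigr => l' _; rewrite !mulr_sumr.
apply: eq_bigr => m _; rewrite !mulr_sumr; apply: eq_bigr => m' _.
by rewrite !mulrA.
Qed.

Section Parallel.
Variables (R : realType) (n : nat) (U : set 'rV[R]_n) (g : 'rV[R]_n -> 'M[R]_n).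
Hypothesis n5 : (5 <= n)%N.
Hypothesis oU : open U.
Implicit Types (A B : 'rV[R]_n -> 'M[R]_n) (i j k l m p q r : 'I_n) (x y : 'rV[R]_n).
Hypothesis gsm : smooth_mx U g.
Hypothesis gs : forall x, U x -> (g x)^T = g x.
Hypothesis gu : forall x, U x -> g x \in unitmx.
Local Notation gi y := (invmx (g y)).
Local Notation Gm m i j := (christoffel g m i j).
Local Notation act := (act g).
Local Notation N := (n%:R : R).
Local Notation C y := (fun j k l m => weyl g j k l m y).

Lemma weyl_contrE i j x : weyl_contr g i j x = Hc (gi x) (C x) i j.
Proof.
rewrite /Hc ctr3E big_interleave; apply: eq_bigr => k _; apply: eq_bigr => l _.
apply: eq_bigr => m _; rewrite mulr_suml; apply: eq_bigr => p _.
rewrite mulr_suml; apply: eq_bigr => q _; rewrite mulr_suml; apply: eq_bigr => r _.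
rewrite /ginv; move: (weyl _ _ _ _ _ _) (weyl _ _ _ _ _ _) (gi x p k) (gi x q l) (gi x r m) => *; ring.
Qed.

Lemma weyl_sqE x : weyl_sq g x = C2 (gi x) (C x).
Proof. by apply: eq_bigr => i _; apply: eq_bigr => j _; rewrite weyl_contrE. Qed.

Lemma htensorE i j x : htensor g i j x = hC (gi x) (C x) i j.
Proof. by rewrite /htensor /hC weyl_contrE weyl_sqE. Qed.

Lemma act_ctr k x i gx (Y : 'I_n -> 'I_n -> 'I_n -> R) :
  act k x i (fun r => ctr gx (Y r)) = ctr gx (fun u v => act k x i (fun r => Y r u v)).
Proof.
rewrite /act /ctr; under eq_bigr do rewrite mulr_sumr.
rewrite exchange_big; apply: eq_bigr => u _.
under eq_bigr do rewrite mulr_sumr.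
rewrite exchange_big; apply: eq_bigr => v _.
by rewrite mulr_sumr; apply: eq_bigr => r _; rewrite mulrCA.
Qed.

Lemma ctrB3 (gx : 'M[R]_n) X Y Z :
  ctr gx X - ctr gx Y - ctr gx Z = ctr gx (fun p q => X p q - Y p q - Z p q).
Proof. by rewrite (ctrD (ctrD (ctr_refl _ _) (ctrN (ctr_refl _ _))) (ctrN (ctr_refl _ _))). Qed.

Section At.
Variable x : 'rV[R]_n.
Hypothesis Ux : U x.

Lemma diff_ctr X : (forall p q, differentiable (X p q) x) ->
  differentiable (fun y => ctr (gi y) (fun p q => X p q y)) x.
Proof.
move=> dX; apply: differentiable_sumf => p; apply: differentiable_sumf => q.
by apply: differentiableM => //; apply: smooth_diff (ginv_smooth oU gsm gu p q) Ux.
Qed.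

(** Parallelism of the inverse metric in non-covariant form: its Christoffel terms are moved onto
    the two contracted slots of X. *)
Lemma partial_ctr k X : (forall p q, differentiable (X p q) x) ->
  partial k (fun y => ctr (gi y) (fun p q => X p q y)) x =
  ctr (gi x) (fun p q => partial k (X p q) x - act k x p (fun r => X r q x) - act k x q (fun r => X p r x)).
Proof.
move=> dX; have dg p q : differentiable (fun y => gi y p q) x.
  by apply: smooth_diff (ginv_smooth oU gsm gu p q) Ux.
have dgX p q : differentiable (fun y => gi y p q * X p q y) x by apply: differentiableM.
rewrite /ctr partial_sumf => [|p]; last exact: differentiable_sumf.
under eq_bigr => p _ do rewrite partial_sumf //.
have e p q : partial k (fun y => gi y p q * X p q y) x =
  - (\sum_r gi x p r * Gm q k r x) * X p q x - (\sum_r Gm p k r x * gi x r q) * X p q x + gi x p q * partial k (X p q) x.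
  rewrite partialM //; congr (_ + _).
  have := congr1 (fun M : 'M[R]_n => M p q) (dM_ginv oU gsm gs gu k Ux).
  rewrite [LHS]mxE [RHS]mxE [X in - X]mxE => ->.
  have -> : (gi x *m Gam g k x) p q = \sum_r gi x p r * Gm q k r x.
    by rewrite mxE; apply: eq_bigr => r _; rewrite mxE.
  have -> : ((Gam g k x)^T *m gi x) p q = \sum_r Gm p k r x * gi x r q.
    by rewrite mxE; apply: eq_bigr => r _; rewrite !mxE.
  by rewrite opprD mulrDl !mulNr.
under eq_bigr => p _ do under eq_bigr => q _ do rewrite e.
have -> : \sum_p \sum_q (- (\sum_r gi x p r * Gm q k r x) * X p q x - (\sum_r Gm p k r x * gi x r q) * X p q x + gi x p q * partial k (X p q) x) =
   - (\sum_p \sum_q (\sum_r gi x p r * Gm q k r x) * X p q x) - (\sum_p \sum_q (\sum_r Gm p k r x * gi x r q) * X p q x)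
   + \sum_p \sum_q gi x p q * partial k (X p q) x.
  rewrite -!sumrN -!big_split; apply: eq_bigr => p _ /=.
  by rewrite -!sumrN -!big_split; apply: eq_bigr => q _ /=; rewrite mulNr.
have -> : \sum_p \sum_q (\sum_r gi x p r * Gm q k r x) * X p q x = ctr (gi x) (fun p q => act k x q (fun r => X p r x)).
  apply: eq_bigr => p _; under eq_bigr do rewrite mulr_suml.
  rewrite exchange_big; apply: eq_bigr => r _; rewrite mulr_sumr.
  by apply: eq_bigr => q _; rewrite -mulrA.
have -> : \sum_p \sum_q (\sum_r Gm p k r x * gi x r q) * X p q x = ctr (gi x) (fun p q => act k x p (fun r => X r q x)).
  rewrite exchange_big /ctr [RHS]exchange_big; apply: eq_bigr => q _.
  under eq_bigr do rewrite mulr_suml.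
  rewrite exchange_big; apply: eq_bigr => r _; rewrite mulr_sumr.
  by apply: eq_bigr => p _; rewrite -mulrA mulrCA.
rewrite -/(ctr (gi x) (fun p q => partial k (X p q) x)) -/(ctr (gi x) (fun p q => partial k (X p q) x - act k x p (fun r => X r q x) - act k x q (fun r => X p r x))).
rewrite -ctrB3.
by move: (ctr _ _) (ctr _ _) (ctr _ _) => *; ring.
Qed.

Variable al : 'I_n -> R.
Hypothesis rec : forall i j k l m, nabla4 g (weyl g) i j k l m x = al i * weyl g j k l m x.

Lemma dweyl a b c d : differentiable (weyl g a b c d) x.
Proof. by apply: smooth_diff (weyl_smooth n5 oU gsm gs gu a b c d) Ux. Qed.

Lemma partial_weyl i j k l m : partial i (weyl g j k l m) x = al i * weyl g j k l m x
  + act i x j (fun p => weyl g p k l m x) + act i x k (fun p => weyl g j p l m x)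
  + act i x l (fun p => weyl g j k p m x) + act i x m (fun p => weyl g j k l p x).
Proof. by rewrite -rec nabla4E; ring. Qed.

(** The product rule applied to C C under three contractions, which are peeled off from the inside.
    At each level [partial_ctr] cancels the Christoffel terms of the slots just contracted; those of
    i and j, and the two recurrence terms, form [P] and survive. *)
Lemma partial_contr k i j : partial k (weyl_contr g i j) x = 2 * al k * weyl_contr g i j x
  + act k x i (fun r => weyl_contr g r j x) + act k x j (fun r => weyl_contr g i r x).
Proof.
pose Z i j a a' b b' c c' (y : 'rV[R]_n) := weyl g i a b c y * weyl g j a' b' c' y.
have dZ i' j' a a' b b' c c' : differentiable (Z i' j' a a' b b' c c') x.
  by apply: differentiableM; apply: dweyl.
pose Z3 i j a a' b b' y := ctr (gi y) (fun c c' => Z i j a a' b b' c c' y).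
pose Z2 i j a a' y := ctr (gi y) (fun b b' => Z3 i j a a' b b' y).
have dZ3 i' j' a a' b b' : differentiable (Z3 i' j' a a' b b') x by exact: diff_ctr.
have dZ2 i' j' a a' : differentiable (Z2 i' j' a a') x by exact: diff_ctr.
have wE i' j' y : weyl_contr g i' j' y = ctr (gi y) (fun a a' => Z2 i' j' a a' y) by exact: weyl_contrE.
have -> : partial k (weyl_contr g i j) = partial k (fun y => ctr (gi y) (fun a a' => Z2 i j a a' y)).
  by congr partial; apply/funext => y; exact: wE.
rewrite partial_ctr //.
pose P a a' b b' c c' := 2 * al k * Z i j a a' b b' c c' x + act k x i (fun r => Z r j a a' b b' c c' x)
  + act k x j (fun r => Z i r a a' b b' c c' x).
have h3 a a' b b' : partial k (Z3 i j a a' b b') x = ctr (gi x) (fun c c' =>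
    P a a' b b' c c' + act k x a (fun r => Z i j r a' b b' c c' x) + act k x a' (fun r => Z i j a r b b' c c' x)
    + act k x b (fun r => Z i j a a' r b' c c' x) + act k x b' (fun r => Z i j a a' b r c c' x)).
  rewrite partial_ctr //; apply: eq_ctr => c c'; rewrite /P /Z partialM; [|exact: dweyl|exact: dweyl].
  rewrite !partial_weyl !actMl !actMr.
  move: (act k x i _) (act k x j _) (act k x a _) (act k x a' _) (act k x b _) (act k x b' _) (act k x c _) (act k x c' _) (weyl _ _ _ _ _ _) (weyl _ _ _ _ _ _) => *; ring.
have h2 a a' : partial k (Z2 i j a a') x = ctr (gi x) (fun b b' => ctr (gi x) (fun c c' =>
    P a a' b b' c c' + act k x a (fun r => Z i j r a' b b' c c' x) + act k x a' (fun r => Z i j a r b b' c c' x))).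
  rewrite partial_ctr //; apply: eq_ctr => b b'; rewrite h3 /Z3 !act_ctr ctrB3; apply: eq_ctr => c c'.
  move: (P a a' b b' c c') (act _ _ _ _) (act _ _ _ _) (act _ _ _ _) (act _ _ _ _) => *; ring.
transitivity (ctr (gi x) (fun a a' => ctr (gi x) (fun b b' => ctr (gi x) (fun c c' => P a a' b b' c c')))).
  apply: eq_ctr => a a'; rewrite h2 /Z2 /Z3 !act_ctr ctrB3; apply: eq_ctr => b b'; rewrite !act_ctr ctrB3.
  apply: eq_ctr => c c'.
  move: (P a a' b b' c c') (act _ _ _ _) (act _ _ _ _) => *; ring.
have -> : act k x i (fun r => weyl_contr g r j x) = act k x i (fun r => ctr (gi x) (fun a a' => Z2 r j a a' x)).
  by apply: eq_act => r; apply: wE.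
have -> : act k x j (fun r => weyl_contr g i r x) = act k x j (fun r => ctr (gi x) (fun a a' => Z2 i r a a' x)).
  by apply: eq_act => r; apply: wE.
rewrite wE !act_ctr -(ctrD (ctrD (ctrMl _ (ctr_refl _ _)) (ctr_refl _ _)) (ctr_refl _ _)).
apply: eq_ctr => a a'; rewrite /Z2 !act_ctr -(ctrD (ctrD (ctrMl _ (ctr_refl _ _)) (ctr_refl _ _)) (ctr_refl _ _)).
by apply: eq_ctr => b b'; rewrite /Z3 !act_ctr -(ctrD (ctrD (ctrMl _ (ctr_refl _ _)) (ctr_refl _ _)) (ctr_refl _ _)).
Qed.

Lemma partial_sq k : partial k (weyl_sq g) x = 2 * al k * weyl_sq g x.
Proof.
have dw i j : differentiable (weyl_contr g i j) x.
  have -> : weyl_contr g i j = fun y => ctr (gi y) (fun a a' => ctr (gi y) (fun b b' => ctr (gi y) (fun c c' =>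
     weyl g i a b c y * weyl g j a' b' c' y))).
    by apply/funext => y; exact: weyl_contrE.
  by do 3 (apply: diff_ctr => ? ?); apply: differentiableM; apply: dweyl.
rewrite [LHS](partial_ctr k dw).
rewrite -[RHS](ctrMl _ (ctr_refl (gi x) (fun p q => weyl_contr g p q x))); apply: eq_ctr => p q.
rewrite partial_contr; move: (act _ _ _ _) (act _ _ _ _) => *; ring.
Qed.

(** Under nabla_k the numerator and C^2 are both multiplied by 2 al_k, which cancels in the
    quotient. *)
Lemma htensor_parallel_at k i j : weyl_sq g x != 0 -> nabla2 g (htensor g) k i j x = 0.
Proof.
move=> sq0.
have dw a b : differentiable (weyl_contr g a b) x.
  have -> : weyl_contr g a b = fun y => ctr (gi y) (fun a' b' => ctr (gi y) (fun c c' => ctr (gi y) (fun d d' =>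
     weyl g a a' c d y * weyl g b b' c' d' y))).
    by apply/funext => y; exact: weyl_contrE.
  by do 3 (apply: diff_ctr => ? ?); apply: differentiableM; apply: dweyl.
have ds : differentiable (weyl_sq g) x by apply: diff_ctr.
have dsV : differentiable (fun y => (weyl_sq g y)^-1) x by exact: differentiableV.
rewrite nabla2E /htensor partialM // partialV // partial_sq partial_contr !actMl.
move: (act _ _ _ _) (act _ _ _ _) (weyl_contr _ _ _ _) sq0 => a1 a2 w.
by move: (weyl_sq g x) => s s0; field.
Qed.

End At.

Lemma weyl_contr_smooth i j : smooth_on U (weyl_contr g i j).
Proof.
have ws := weyl_smooth n5 oU gsm gs gu; have gis' := ginv_smooth oU gsm gu.
apply: smooth_sum => // k _; apply: smooth_sum => // l _; apply: smooth_sum => // m _.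
apply: smoothM => //; apply: smooth_sum => // p _; apply: smooth_sum => // q _; apply: smooth_sum => // r _.
by do ?apply: smoothM => //; apply: gis'.
Qed.
Lemma weyl_sq_smooth : smooth_on U (weyl_sq g).
Proof.
have gis' := ginv_smooth oU gsm gu.
apply: smooth_sum => // k _; apply: smooth_sum => // l _.
by apply: smoothM => //; [apply: gis'|apply: weyl_contr_smooth].
Qed.
Hypothesis sq0 : forall x, U x -> weyl_sq g x != 0.
Lemma htensor_smooth i j : smooth_on U (htensor g i j).
Proof.
apply: smoothM => //; last exact: weyl_contr_smooth.
by apply: smoothV => //; exact: weyl_sq_smooth.
Qed.

Definition mx_of (T : 'I_n -> 'I_n -> 'rV[R]_n -> R) y : 'M[R]_n := \matrix_(i, j) T i j y.

Lemma parallel_mx T x k : (forall i j, nabla2 g T k i j x = 0) ->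
  dM k (mx_of T) x = Gam g k x *m mx_of T x + mx_of T x *m (Gam g k x)^T.
Proof.
move=> nT; apply/matrixP => i j; rewrite [LHS]mxE [RHS]mxE.
have -> : (fun y => mx_of T y i j) = T i j by apply/funext => y; rewrite mxE.
have -> : (Gam g k x *m mx_of T x) i j = act k x i (fun p => T p j x).
  by rewrite mxE; apply: eq_bigr => p _; rewrite !mxE.
have -> : (mx_of T x *m (Gam g k x)^T) i j = act k x j (fun p => T i p x).
  by rewrite mxE; apply: eq_bigr => p _; rewrite !mxE mulrC.
apply/eqP; rewrite -subr_eq0 opprD addrA; apply/eqP; exact: nT.
Qed.

Lemma parallel_Rl T x : (forall i j, smooth_on U (T i j)) ->
  (forall y, U y -> forall k i j, nabla2 g T k i j y = 0) -> U x -> forall j k l q,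
  \sum_m riemann g j k l m x * T m q x + \sum_m riemann g j k q m x * T l m x = 0.
Proof.
move=> sT nT Ux j k l q.
have sm : smooth_mx U (mx_of T).
  by move=> a b; under eq_fun do rewrite mxE; apply: sT.
have := parallel_Rmat oU gsm gu sm (fun y Uy k => parallel_mx (nT y Uy k)) Ux j k.
move=> /matrixP/(_ l q); rewrite [LHS]mxE [RHS]mxE => e; rewrite -[RHS]e; congr (_ + _).
  by rewrite mxE; apply: eq_bigr => m _; rewrite !mxE.
by rewrite mxE; apply: eq_bigr => m _; rewrite !mxE mulrC.
Qed.

(* The analogue of [ev] for partial derivatives. *)
Definition pd k x (f : 'rV[R]_n -> R) (d : R) := differentiable f x /\ partial k f x = d.
Lemma pdD k x f h a b : pd k x f a -> pd k x h b -> pd k x (fun y => f y + h y) (a + b).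
Proof. by move=> [df <-] [dh <-]; split; [exact: differentiableD|exact: partialD]. Qed.
Lemma pdN k x f a : pd k x f a -> pd k x (fun y => - f y) (- a).
Proof. by move=> [df <-]; split; [exact: differentiableN|exact: partialN]. Qed.
Lemma pdM k x f h a b : pd k x f a -> pd k x h b -> pd k x (fun y => f y * h y) (a * h x + f x * b).
Proof. by move=> [df <-] [dh <-]; split; [exact: differentiableM|exact: partialM]. Qed.
Lemma pdZ k x c f a : pd k x f a -> pd k x (fun y => c * f y) (c * a).
Proof.
move=> [df <-]; split; first by apply: differentiableM => //; apply: differentiable_cst.
by rewrite partialM ?partial_cst ?mul0r ?add0r //; apply: differentiable_cst.
Qed.
Lemma pd_uniq k x f a b : pd k x f a -> pd k x f b -> a = b.
Proof. by move=> [_ <-] [_ <-]. Qed.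

Ltac pd_solve lf :=
  first [ solve [lf]
        | lazymatch goal with
          | |- pd _ _ (fun y => _ + _) _ => eapply pdD; [pd_solve lf | pd_solve lf]
          | |- pd _ _ (fun y => - _) _ => eapply pdN; pd_solve lf
          | |- pd _ _ (fun y => _ * _) _ =>
             first [eapply pdM; [solve [lf] | solve [lf]] | eapply pdZ; pd_solve lf | eapply pdM; [pd_solve lf | pd_solve lf]]
          end ].

Lemma act_I0 k i x (F : 'I_n -> R) : (forall p, F p = 0) -> act k x i F = 0.
Proof. by move=> F0; rewrite (eq_act _ _ _ _ F0) act0. Qed.

Section Bianchi.
Variable al : 'I_n -> 'rV[R]_n -> R.
Hypothesis als : forall i, smooth_on U (al i).
Hypothesis rec : forall y, U y -> forall i j k l m,
  nabla4 g (weyl g) i j k l m y = al i y * weyl g j k l m y.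

Definition nabla1 k i x := partial k (al i) x - act k x i (fun p => al p x).

Let D y j k l := Dv (gi y) (C y) (fun i => al i y) j k l.

Lemma DvE (gx : 'M[R]_n) (b : 'I_n -> R) Cx j k l : gx^T = gx ->
  Dv gx Cx b j k l = ctr gx (fun p q => b p * Cx j k l q).
Proof. by move=> gxs; rewrite (ctr_vl gxs (ev_refl _ _)). Qed.

(** Apply nabla_k to [bianchi] for al. As nabla g = 0 and nabla_k C = al_k C, the result is the same
    identity for nabla_k al plus al_k times the original one. The computation uses partial
    derivatives, and [I] is the difference of the two sides. *)
Lemma bianchi_nabla x k : U x -> bianchi (g x) (gi x) (C x) (fun i => nabla1 k i x).
Proof.
move=> Ux.
have dal i : differentiable (al i) x by apply: smooth_diff (als i) Ux.
have dW := dweyl Ux.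
have dg i j : differentiable (fun y => g y i j) x by apply: smooth_diff (gsm i j) Ux.
pose T j k l y := ctr (gi y) (fun p q => al p y * weyl g j k l q y).
have dT a b c : differentiable (T a b c) x by apply: diff_ctr => // p q; apply: differentiableM.
have DT y a b c : U y -> D y a b c = T a b c y by move=> Uy; rewrite /D DvE //; exact: (gis gs Uy).
pose w i := nabla1 k i x.
pose Dw := Dv (gi x) (C x) w.
have dD a b c : partial k (T a b c) x = Dw a b c + al k x * T a b c x
   + act k x a (fun p => T p b c x) + act k x b (fun p => T a p c x) + act k x c (fun p => T a b p x).
  rewrite partial_ctr //; last by move=> p q; apply: differentiableM.
  rewrite /Dw (DvE _ _ _ _ _ (gis gs Ux)) /T !act_ctr -(ctrMl _ (ctr_refl _ _)).
  rewrite -!(ctrD (ctr_refl _ _) (ctr_refl _ _)); apply: eq_ctr => p q.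
  rewrite partialM // (partial_weyl (rec Ux)) !actMl !actMr /w /nabla1.
  move: (act k x p _) (act k x a _) (act k x b _) (act k x c _) (act k x q _) (partial _ _ _) (weyl _ _ _ _ _ _) => *; ring.
have dgE i j : partial k (fun y => g y i j) x = act k x i (fun p => g x p j) + act k x j (fun p => g x i p).
  have := nabla2_g oU gs gu Ux k i j; rewrite nabla2E => /eqP.
  by rewrite -addrA -opprD subr_eq0 => /eqP.
pose I i j k' l m y := (N - 3) * (al i y * weyl g j k' l m y + al j y * weyl g k' i l m y + al k' y * weyl g i j l m y)
  + (g y i l * T j k' m y - g y i m * T j k' l y + (g y j l * T k' i m y - g y j m * T k' i l y)
   + (g y k' l * T i j m y - g y k' m * T i j l y)).
have I0 y : U y -> forall i j k' l m, I i j k' l m y = 0.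
  move=> Uy i j k' l m; have := weyl_bianchi n5 oU gsm gs gu Uy (rec Uy) i j k' l m.
  rewrite -/(D y j k' m) -/(D y j k' l) -/(D y k' i m) -/(D y k' i l) -/(D y i j m) -/(D y i j l) !DT //.
  by rewrite /I => ->; rewrite addNr.
have dI i j k' l m : pd k x (I i j k' l m) 0.
  split; last first.
    by rewrite (eq_on_partial k oU Ux (fun y Uy => I0 y Uy i j k' l m)) partial_cst.
  by apply: (eq_on_diff oU Ux (fun y Uy => esym (I0 y Uy i j k' l m))); apply: differentiable_cst.
move=> i j k' l m.
have pal a : pd k x (al a) (w a + act k x a (fun p => al p x)).
  by split; [exact: dal|rewrite /w /nabla1 subrK].
have pW a b c d : pd k x (weyl g a b c d) _ := conj (dW a b c d) (partial_weyl (rec Ux) k a b c d).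
have pT a b c : pd k x (T a b c) _ := conj (dT a b c) (dD a b c).
have pg a b : pd k x (fun y => g y a b) _ := conj (dg a b) (dgE a b).
(* The derivative of [I] is not written down: [pd_solve] synthesises it from the product rule, and
   it is then compared with 0. *)
evar (d : Real.sort R).
have e : pd k x (I i j k' l m) d.
  by rewrite /I /d; pd_solve ltac:(first [exact: pal | exact: pW | exact: pT | exact: pg]).
have {}e := pd_uniq e (dI i j k' l m); rewrite /d {d} in e.
(* The Christoffel terms of the derivative of [I] are the actions on its five indices. *)
have a1 := @act_I0 k i x _ (fun p => I0 x Ux p j k' l m).
have a2 := @act_I0 k j x _ (fun p => I0 x Ux i p k' l m).
have a3 := @act_I0 k k' x _ (fun p => I0 x Ux i j p l m).
have a4 := @act_I0 k l x _ (fun p => I0 x Ux i j k' p m).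
have a5 := @act_I0 k m x _ (fun p => I0 x Ux i j k' l p).
have i0 := I0 x Ux i j k' l m.
rewrite /I !(actD, actN, actMl, actMr) in a1 a2 a3 a4 a5 i0 e *.
(* The identity enters the final combination multiplied by al_k; [lra] only finds linear
   combinations, so the product is supplied. *)
have {}i0 := congr1 ( *%R (al k x)) i0; rewrite mulr0 in i0.
rewrite -/w -/(Dw j k' m) -/(Dw j k' l) -/(Dw k' i m) -/(Dw k' i l) -/(Dw i j m) -/(Dw i j l) -![nabla1 k _ x]/(w _).
move: a1 a2 a3 a4 a5 i0 e.
repeat match goal with |- context [act k x ?i ?F] => move: (act k x i F) => ? end.
repeat match goal with |- context [Dw ?a ?b ?c] => move: (Dw a b c) => ? end.
repeat match goal with |- context [T ?a ?b ?c x] => move: (T a b c x) => ? end.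
repeat match goal with |- context [weyl g ?a ?b ?c ?d x] => move: (weyl g a b c d x) => ? end.
repeat match goal with |- context [w ?a] => move: (w a) => ? end.
repeat match goal with |- context [al ?a x] => move: (al a x) => ? end.
repeat match goal with |- context [g x ?a ?b] => move: (g x a b) => ? end.
clear; move: (n%:R) => N' *.
lra.
Qed.
End Bianchi.
End Parallel.

(** * Contraction of the relation R.h = 0 *)

Section RicciH.
Variables (K : numFieldType) (n : nat) (g gi : 'M[K]_n) (C : 'I_n -> 'I_n -> 'I_n -> 'I_n -> K).
Hypothesis W : weyl_tensor g gi C.
Variables (S h : 'I_n -> 'I_n -> K).
Hypothesis SC : forall i j, S i j = S j i.
Hypothesis hC' : forall i j, h i j = h j i.
Hypothesis htr : ctr gi h = 1.
Local Notation N := (n%:R : K).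
Let Rm j k l m := C j k l m - (g j m * S k l - g k m * S j l + S j m * g k l - S k m * g j l).
Hypothesis Rh : forall j k l q,
  ctr gi (fun p m => Rm j k l p * h m q) + ctr gi (fun p m => Rm j k q p * h l m) = 0.

(** Contracting R.h = 0 over k and l gives [e], in which S h occurs as (n - 1) a_jq + a_qj while all
    other terms are symmetric in j and q. Exchanging j and q yields (n - 2)(a_jq - a_qj) = 0: S and
    h commute, and the two occurrences merge into n S h. *)
Lemma schouten_commutes : forall i l,
  N * ctr gi (fun p q => S i p * h q l) + ctr gi S * h i l - S i l
  - ctr gi (fun i i' => ctr gi (fun j j' => S i j * h i' j')) * g i l =
    ctr gi (fun j j' => ctr gi (fun m m' => C i j l m * h j' m')).
Proof.
case: W => n5 gK gs gis h12 h34 hc ht.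
pose a j q := ctr gi (fun p m => S j p * h m q).
have aE j q : ev2 gi (fun p m => S j p * h m q) (a j q) by [].
have aE' j q : ev2 gi (fun p m => S j m * h p q) (a j q) by apply: (ctr_C gis (aE j q)).
have aE2 j q : ev2 gi (fun p m => S j p * h q m) (a j q).
  by apply: eq_ctr => p m; rewrite (hC' q).
have aE3 j q : ev2 gi (fun k l => S k q * h l j) (a q j).
  by apply: eq_ctr => p m; rewrite (SC p).
pose t := ctr gi (fun i i' => ctr gi (fun j j' => S i j * h i' j')).
have C0 j q : ev2 gi (fun k l => ctr gi (fun p m => C j k l p * h m q)) 0.
  rewrite /ev2 ctr_exch; apply: ctr_eq0 => p m.
  by rewrite (ctrMr _ (tr23 h12 h34 ht j p)) mul0r.
pose X j q := ctr gi (fun k l => ctr gi (fun p m => C j k q p * h l m)).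
have e j q : (N - 1) * a j q + ctr gi S * h j q + a q j - S j q - t * g j q = X j q.
  have := eq_ctr gi (fun k l => Rh j k l q).
  rewrite [X in _ = X](_ : _ = 0); last by apply: ctr_eq0.
  rewrite /Rm => e0.
  apply/eqP; rewrite -subr_eq0; apply/eqP; rewrite -[RHS]oppr0 -[in RHS]e0.
  apply/esym; rewrite -[RHS]opprK; congr (- _); apply: ctr_eval.
    ctr_solve g gK gs gis ltac:(idtac; lazymatch goal with
     | |- ev2 _ (fun p m => S _ p * h m _) _ => exact: aE
     | |- ev2 _ (fun p m => S _ m * h p _) _ => exact: aE'
     | |- ev2 _ (fun p m => S _ p * h _ m) _ => exact: aE2
     | |- ev2 _ (fun p m => S p _ * h m _) _ => exact: aE3
     | |- ev2 _ (fun p m => h p m) _ => exact: htr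
     | |- ev2 _ (fun p m => h m p) _ => exact: (ctr_C gis htr)
     | |- ev2 _ (fun k l => ctr gi (fun p m => C _ k l p * h m _)) _ => exact: C0
     end).
  have -> : ctr gi (fun p q => a p q) = t.
    by apply: eq_ctr => u u'; apply: eq_ctr => v v'; rewrite (hC' u').
  rewrite -/(X j q); ring.
have XC j q : X j q = X q j.
  rewrite /X ctr_exch; apply: eq_ctr => k l; apply: eq_ctr => p m.
  by rewrite (Cpair h12 h34 hc) hC'.
have aC j q : a j q = a q j.
  have N2 : N - 2 != 0 by apply/Nsub/(leq_trans _ n5).
  apply: (mulfI N2); have e1 := e j q; have e2 := e q j.
  rewrite -XC -e1 (SC q j) (hC' q j) (gC gs q j) in e2.
  transitivity (((N - 1) * a j q + ctr gi S * h j q + a q j - S j q - t * g j q)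
    - (ctr gi S * h j q - S j q - t * g j q + a j q + a q j)); first by ring.
  rewrite -e2; ring.
move=> i l; rewrite -/(a i l) -/t -/(X i l) -e (aC l i); ring.
Qed.
End RicciH.

Lemma smooth_sub (R : realType) n (U V : set 'rV[R]_n) f : V `<=` U -> smooth_on U f -> smooth_on V f.
Proof. by move=> VU sf s x Vx; apply: sf; apply: VU. Qed.

Section RiemCtr.
Variables (R : realType) (n : nat) (U : set 'rV[R]_n) (g : 'rV[R]_n -> 'M[R]_n).
Hypothesis gs : forall x, U x -> (g x)^T = g x.
Hypothesis gu : forall x, U x -> g x \in unitmx.
Lemma riem_ctr x j k l (F : 'I_n -> R) : U x ->
  ctr (invmx (g x)) (fun p m => Rl g j k l p x * F m) = \sum_m riemann g j k l m x * F m.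
Proof.
move=> Ux.
transitivity (ctr (invmx (g x)) (fun p m => app (fun r => riemann g j k l r x) (fun r => g x r p * F m))).
  apply: eq_ctr => p m; rewrite RlE /app mulr_suml; apply: eq_bigr => r _; exact: esym (mulrA _ _ _).
rewrite ctr_appE; apply: eq_bigr => r _; congr (_ * _).
exact: (ctr_gl' (gVg gu Ux) (gs Ux) (gis gs Ux)).
Qed.
End RiemCtr.

(** * Excluding a non-null recurrence vector with nabla_k al proportional to al *)

Section Flat.
Variables (R : realType) (n : nat) (U : set 'rV[R]_n) (g : 'rV[R]_n -> 'M[R]_n).
Hypothesis n5 : (5 <= n)%N.
Hypothesis oU : open U.
Implicit Types (i j k l m p q r : 'I_n) (x y : 'rV[R]_n).
Hypothesis gsm : smooth_mx U g.
Hypothesis gs : forall x, U x -> (g x)^T = g x.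
Hypothesis gu : forall x, U x -> g x \in unitmx.
Hypothesis sq0 : forall x, U x -> weyl_sq g x != 0.
Variable al : 'I_n -> 'rV[R]_n -> R.
Hypothesis als : forall i, smooth_on U (al i).
Hypothesis rec : forall y, U y -> forall i j k l m,
  nabla4 g (weyl g) i j k l m y = al i y * weyl g j k l m y.
Local Notation gi y := (invmx (g y)).
Local Notation act := (act g).
Local Notation S := (schouten g).
Local Notation C y := (fun j k l m => weyl g j k l m y).
Local Notation N := (n%:R : R).
Local Notation nabla1 := (nabla1 g al).
Definition sqnorm y := ctr (gi y) (fun p q => al p y * al q y).
Hypothesis s0 : forall y, U y -> sqnorm y != 0.
Hypothesis prop : forall y, U y -> forall k, exists c, forall i, nabla1 k i y = c * al i y.

Lemma al_smooth_diff i x : U x -> differentiable (al i) x.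
Proof. by move=> Ux; apply: smooth_diff (als i) Ux. Qed.

Lemma partial_al x k c i : (forall i, nabla1 k i x = c * al i x) ->
  partial k (al i) x = c * al i x + act k x i (fun p => al p x).
Proof. by move=> e; rewrite -e /nabla1 subrK. Qed.

Lemma partial_sqnorm x k c : U x -> (forall i, nabla1 k i x = c * al i x) ->
  partial k sqnorm x = 2 * c * sqnorm x.
Proof.
move=> Ux e; have dal i := al_smooth_diff i Ux.
rewrite [LHS](partial_ctr oU gsm gs gu Ux); last by move=> p q; apply: differentiableM.
rewrite -[RHS](ctrMl _ (ctr_refl _ _)); apply: eq_ctr => p q.
rewrite partialM // !(partial_al _ e) actMl actMr.
move: (act _ _ _ _) (act _ _ _ _) (al _ _) (al _ _) => *; ring.
Qed.

Lemma sqnorm_smooth : smooth_on U sqnorm.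
Proof.
apply: smooth_sum => // p _; apply: smooth_sum => // q _.
by apply: smoothM => //; [apply: (ginv_smooth oU gsm gu)|apply: smoothM].
Qed.

Let P i j y := al i y * al j y * (sqnorm y)^-1.

Lemma P_smooth i j : smooth_on U (P i j).
Proof. by apply: smoothM => //; [apply: smoothM|apply: smoothV => //; exact: sqnorm_smooth]. Qed.

Lemma P_parallel x k i j : U x -> nabla2 g P k i j x = 0.
Proof.
move=> Ux; have [c e] := prop Ux k; have dal a := al_smooth_diff a Ux.
have ds : differentiable sqnorm x by apply: smooth_diff sqnorm_smooth Ux.
have dsV : differentiable (fun y => (sqnorm y)^-1) x by apply: differentiableV; rewrite ?s0.
have daa : differentiable (fun y => al i y * al j y) x by exact: differentiableM.
rewrite nabla2E /P partialM // partialM // partialV ?s0 // (partial_sqnorm Ux e) !(partial_al _ e).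
rewrite !actMr actMl.
move: (s0 Ux) (act _ _ _ _) (act _ _ _ _) (al i x) (al j x).
by move: (sqnorm x) => s sn0 a1 a2 b1 b2; field.
Qed.

(** With r_l = R_jkl^m al_m, the relation R.P = 0 reads r_l al_q + r_q al_l = 0; evaluated at an
    index where al is non-zero, it gives r = 0. *)
Lemma riem_al x j k l : U x -> ctr (gi x) (fun p m => Rl g j k l p x * al m x) = 0.
Proof.
move=> Ux; rewrite (riem_ctr gs gu _ _ _ _ Ux).
pose r l := \sum_m riemann g j k l m x * al m x.
have e l' q : r l' * al q x + r q * al l' x = 0.
  have := parallel_Rl oU gsm gu P_smooth (fun y Uy k i j => P_parallel k i j Uy) Ux j k l' q.
  have -> : \sum_m riemann g j k l' m x * P m q x = r l' * al q x / sqnorm x.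
    rewrite /r !mulr_suml; apply: eq_bigr => m _; rewrite /P.
    by move: (riemann _ _ _ _ _ _) (al _ _) (al _ _) ((sqnorm x)^-1) => *; ring.
  have -> : \sum_m riemann g j k q m x * P l' m x = r q * al l' x / sqnorm x.
    rewrite /r !mulr_suml; apply: eq_bigr => m _; rewrite /P.
    by move: (riemann _ _ _ _ _ _) (al _ _) (al _ _) ((sqnorm x)^-1) => *; ring.
  by rewrite -mulrDl => /eqP; rewrite mulf_eq0 invr_eq0 (negbTE (s0 Ux)) orbF => /eqP.
have [i0 ai0] : exists i, al i x != 0.
  apply/existsP; apply: contraNT (s0 Ux) => /existsPn a0; apply/eqP; apply: ctr_eq0 => p q.
  by rewrite (eqP (negPn (a0 p))) mul0r.
have r0 : r i0 = 0.
  have /eqP : r i0 * al i0 x = 0 by apply/self_opp/eqP; rewrite -addr_eq0; apply/eqP; exact: e.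
  by rewrite mulf_eq0 (negbTE ai0) orbF => /eqP.
have /eqP := e l i0; rewrite r0 mul0r addr0 mulf_eq0 (negbTE ai0) orbF => /eqP; exact.
Qed.

(* Here [al] is non-null and nabla_k al is proportional to [al], so that [P] is parallel; hence
   R_{jkl}^m al_m = 0, and the second Bianchi identity gives al^i nabla_i R_{jklm} = 0.
   Then al^i al_i C_{jklm} has the algebraic form of a Ricci part, so C = 0. *)
Lemma flat_absurd x : U x -> False.
Proof.
move=> Ux.
pose V i j k l m := nabla4 g (Rl g) i j k l m x.
pose a := up (gi x) (al^~ x).
have dal i := al_smooth_diff i Ux.
have dR a' b c d : differentiable (Rl g a' b c d) x.
  by apply: smooth_diff (Rl_smooth oU gsm gu a' b c d) Ux.
have gKx := gVg gu Ux; have gsx := gs Ux; have gisx := gis gs Ux.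
(* The derivative of R_jklm al^m = 0; since nabla_i al is a multiple of al, the term in which al is
   differentiated vanishes too. *)
have Va i j k l : app a (V i j k l) = 0.
  pose Q j k l y := ctr (gi y) (fun p m => Rl g j k l p y * al m y).
  have Q0 j' k' l' : Q j' k' l' x = 0 by exact: riem_al.
  have : partial i (Q j k l) x = 0.
    rewrite (eq_on_partial (h := fun=> 0) i oU Ux) ?partial_cst // => y Uy; exact: riem_al.
  have [c e] := prop Ux i.
  rewrite (partial_ctr oU gsm gs gu Ux); last by move=> p q; apply: differentiableM.
  have -> : ctr (gi x) (fun p q => partial i (fun y => Rl g j k l p y * al q y) x
      - act i x p (fun r => Rl g j k l r x * al q x) - act i x q (fun r => Rl g j k l p x * al r x)) =
     ctr (gi x) (fun p q => V i j k l p * al q x) + c * Q j k l x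
      + act i x j (fun r => Q r k l x) + act i x k (fun r => Q j r l x) + act i x l (fun r => Q j k r x).
    rewrite !act_ctr -(ctrD (ctrD (ctrD (ctrD (ctr_refl _ _) (ctrMl _ (ctr_refl _ _))) (ctr_refl _ _)) (ctr_refl _ _)) (ctr_refl _ _)).
    apply: eq_ctr => p q; rewrite partialM // (partial_al _ e) actMl !actMr /V nabla4E.
    move: (partial _ _ _) (act i x j _) (act i x k _) (act i x l _) (act i x p _) (act i x q _) (Rl _ _ _ _ _ _) (al _ _) => *; ring.
  rewrite Q0 !act_I0 // mulr0 !addr0 => <-.
  by rewrite (ctr_lv gisx (ev_refl _ _)).
have V34 i j k l m : V i j k l m = - V i j k m l.
  have ep : partial i (Rl g j k l m) x = - partial i (Rl g j k m l) x.
    rewrite -partialN //; apply: (eq_on_partial i oU Ux) => y Uy; exact: (Rl34 oU gsm gs gu).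
  rewrite /V !nabla4E ep.
  have h a' b c d : Rl g a' b c d x = - Rl g a' b d c x by exact: (Rl34 oU gsm gs gu).
  rewrite (eq_act _ _ _ _ (fun p => h p k l m)) (eq_act _ _ _ _ (fun p => h j p l m)).
  rewrite (eq_act _ _ _ _ (fun p => h j k p m)) (eq_act _ _ _ _ (fun p => h j k l p)) !actN.
  by move: (act _ _ _ _) (act _ _ _ _) (act _ _ _ _) (act _ _ _ _) (partial _ _ _) => *; ring.
have Vp i j k l m : V i j k l m = V i l m j k.
  have ep : partial i (Rl g j k l m) x = partial i (Rl g l m j k) x.
    apply: (eq_on_partial i oU Ux) => y Uy; exact: (Rl_pair oU gsm gs gu).
  rewrite /V !nabla4E ep.
  have h a' b c d : Rl g a' b c d x = Rl g c d a' b x by exact: (Rl_pair oU gsm gs gu).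
  rewrite (eq_act _ _ _ _ (fun p => h p k l m)) (eq_act _ _ _ _ (fun p => h j p l m)).
  rewrite (eq_act _ _ _ _ (fun p => h j k p m)) (eq_act _ _ _ _ (fun p => h j k l p)).
  by move: (act _ _ _ _) (act _ _ _ _) (act _ _ _ _) (act _ _ _ _) (partial _ _ _) => *; ring.
(* In the second Bianchi identity contracted with al^i, the other two terms have i among the slots
   of R, where [Va] applies after the symmetries of R. *)
have Va1 j k l m : app a (fun i => V i j k l m) = 0.
  have e1 : app a (fun i => V j k i l m) = 0.
    rewrite (eq_app a (G := fun i => - V j l m i k)) => [|i]; last by rewrite Vp V34.
    rewrite (evN (ev_refl _ _)); rewrite (eq_app a (G := fun i => - V j l m k i)) => [|i]; last exact: V34.
    by rewrite (evN (ev_refl _ _)) Va !oppr0.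
  have e2 : app a (fun i => V k i j l m) = 0.
    rewrite (eq_app a (G := fun i => - V k l m j i)) => [|i]; last by rewrite Vp V34.
    by rewrite (evN (ev_refl _ _)) Va oppr0.
  have h : app a (fun i => V i j k l m + V j k i l m + V k i j l m) = 0.
    by apply: etrans (ev0 a); apply: eq_app => i; exact: (second_bianchi oU gsm gs gu).
  have := etrans (esym (evD (evD (ev_refl a (fun i => V i j k l m)) e1) e2)) h.
  by rewrite !addr0.
pose Sp k l := app a (fun i => nabla2 g S i k l x).
have sE : app a (al^~ x) = sqnorm x by rewrite -(ctr_vl gisx (ev_refl _ _)).
have sC j k l m : sqnorm x * weyl g j k l m x =
    g x j m * Sp k l - g x k m * Sp j l + Sp j m * g x k l - Sp k m * g x j l.
  rewrite -sE -(evMr _ (ev_refl _ _)).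
  rewrite (eq_app a (G := fun i => V i j k l m + (g x j m * nabla2 g S i k l x - g x k m * nabla2 g S i j l x
   + nabla2 g S i j m x * g x k l - nabla2 g S i k m x * g x j l))); last first.
    by move=> i; rewrite -(rec Ux) (nabla4_weyl n5 oU gsm gs gu Ux).
  apply: ev_eval; first by ev_solve ltac:(exact: Va1).
  by rewrite add0r.
have [_ _ _ _ _ _ _ ht] := weyl_pt n5 oU gsm gs gu Ux.
pose sig := ctr (gi x) Sp.
(* C is trace-free, so tracing [sC] once, and then once more, kills [Sp], the derivative of S along
   al. *)
have tr1 k l : (N - 2) * Sp k l + sig * g x k l = 0.
  have := ctrMl (sqnorm x) (ht k l); rewrite mulr0 => e0; rewrite -[RHS]e0.
  rewrite (eq_ctr _ (fun j m => sC j k l m)); apply/esym/ctr_eval.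
    by ctr_solve (g x) gKx gsx gisx ltac:(fail).
  by rewrite -/sig; move: (Sp k l) (g x k l) sig => *; ring.
have sig0 : sig = 0.
  have e0 : ctr (gi x) (fun k l => (N - 2) * Sp k l + sig * g x k l) = 0 by exact: ctr_eq0.
  have : (2 * (N - 1)) * sig = 0.
    rewrite -[RHS]e0; apply/esym/ctr_eval; first by ctr_solve (g x) gKx gsx gisx ltac:(fail).
    rewrite -/sig; ring.
  by move=> /eqP; rewrite !mulf_eq0 pnatr_eq0 (negbTE (Nm1 R n5)) => /eqP.
have Sp0 k l : Sp k l = 0.
  by have /eqP := tr1 k l; rewrite sig0 mul0r addr0 mulf_eq0 (negbTE (Nm2 R n5)) => /eqP.
have C0 j k l m : weyl g j k l m x = 0.
  have := sC j k l m; rewrite !Sp0 !mulr0 !mul0r subr0 addr0 subr0 => /eqP.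
  by rewrite mulf_eq0 (negbTE (s0 Ux)) => /eqP.
have := sq0 Ux; rewrite weyl_sqE /C2 [ctr _ _](_ : _ = 0) ?eqxx //.
apply: ctr_eq0 => i j; apply: ctr_eq0 => b c; apply: ctr_eq0 => d e; apply: ctr_eq0 => b' c'.
by rewrite C0 mul0r.
Qed.
End Flat.

(** * From the dense set to every point of a chart *)

Section Special.
Variables (R : realType) (n : nat) (U : set 'rV[R]_n) (g : 'rV[R]_n -> 'M[R]_n).
Hypothesis n5 : (5 <= n)%N.
Hypothesis oU : open U.
Implicit Types (i j k l m p q r : 'I_n) (x y : 'rV[R]_n).
Hypothesis gsm : smooth_mx U g.
Hypothesis gs : forall x, U x -> (g x)^T = g x.
Hypothesis gu : forall x, U x -> g x \in unitmx.
Hypothesis sq0 : forall x, U x -> weyl_sq g x != 0.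
Variable al : 'I_n -> 'rV[R]_n -> R.
Hypothesis als : forall i, smooth_on U (al i).
Hypothesis rec : forall y, U y -> forall i j k l m,
  nabla4 g (weyl g) i j k l m y = al i y * weyl g j k l m y.
Hypothesis al0 : forall y, U y -> exists i, al i y != 0.
Local Notation gi y := (invmx (g y)).
Local Notation S := (schouten g).
Local Notation C y := (fun j k l m => weyl g j k l m y).
Local Notation h := (htensor g).
Local Notation N := (n%:R : R).
Local Notation nabla1 := (nabla1 g al).

Lemma htensor_parallel x k i j : U x -> nabla2 g h k i j x = 0.
Proof. by move=> Ux; apply: (htensor_parallel_at n5 oU gsm gs gu Ux (rec Ux)); exact: sq0. Qed.

Lemma htensorC x i j : U x -> h i j x = h j i x.
Proof. by move=> Ux; rewrite !htensorE (hC_sym (weyl_pt n5 oU gsm gs gu Ux)). Qed.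

Lemma ctr_htensor x : U x -> ctr (gi x) (fun i j => h i j x) = 1.
Proof. by move=> Ux; rewrite (ctrMl _ (ctr_refl _ _)) mulVf // sq0. Qed.

Lemma schouten_h x : U x -> forall i l,
  N * ctr (gi x) (fun p q => S i p x * hC (gi x) (C x) q l) + ctr (gi x) (fun p q => S p q x) * hC (gi x) (C x) i l
  - S i l x - ctr (gi x) (fun i i' => ctr (gi x) (fun j j' => S i j x * h i' j' x)) * g x i l =
    ctr (gi x) (fun j j' => ctr (gi x) (fun m m' => weyl g i j l m x * hC (gi x) (C x) j' m')).
Proof.
move=> Ux i l.
have := @schouten_commutes _ _ (g x) (gi x) _ (weyl_pt n5 oU gsm gs gu Ux) (fun i j => S i j x) (fun i j => h i j x).
move=> /(_ (fun i j => schoutenC oU gsm gs gu Ux i j) (fun i j => htensorC i j Ux) (ctr_htensor Ux)) e.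
have {}e := e _ i l.
have hE : (fun i j => h i j x) = hC (gi x) (C x).
  by apply/funext => a; apply/funext => b; apply: htensorE.
rewrite -[hC (gi x) (C x)]hE; apply: e => j k l' q.
have RE a b c d : weyl g a b c d x -
   (g x a d * S b c x - g x b d * S a c x + S a d x * g x b c - S b d x * g x a c) = Rl g a b c d x.
  by rewrite (weylE n5 gs gu Ux) addrK.
rewrite -[RHS](parallel_Rl oU gsm gu (htensor_smooth n5 oU gsm gs gu sq0)
  (fun y Uy k i j => htensor_parallel k i j Uy) Ux j k l' q).
rewrite -(riem_ctr gs gu _ _ _ _ Ux) -(riem_ctr gs gu _ _ _ _ Ux); congr (_ + _).
  by apply: eq_ctr => a b; rewrite RE.
by apply: eq_ctr => a b; rewrite RE (htensorC l') // htensorC.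
Qed.

Definition specialx x := special (g x) (gi x) (fun i j => h i j x) (fun i j => S i j x).

(** The two alternatives are the two sources of a null solution of [bianchi]: al itself, or a
    complex combination of al and an independent nabla_k al. *)
Lemma special_at x : U x ->
  sqnorm g al x = 0 \/ (exists k, ~ exists c, forall i, nabla1 k i x = c * al i x) -> specialx x.
Proof.
move=> Ux H; rewrite /specialx.
have -> : (fun i j => h i j x) = hC (gi x) (C x).
  by apply/funext => a; apply/funext => b; apply: htensorE.
have W := weyl_pt n5 oU gsm gs gu Ux; have C20 : C2 (gi x) (C x) != 0 by rewrite -weyl_sqE sq0.
have B := weyl_bianchi n5 oU gsm gs gu Ux (rec Ux).
have sE : app (up (gi x) (al^~ x)) (al^~ x) = sqnorm g al x by rewrite -(ctr_vl (gis gs Ux) (ev_refl _ _)).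
have [s0|s0] := eqVneq (sqnorm g al x) 0.
  apply: (null_is_special W C20 (schouten_h Ux) B); first by rewrite sE.
  exact: al0.
case: H => [/eqP|[k ind]]; first by rewrite (negbTE s0).
apply: (indep_is_special W C20 (schouten_h Ux) B (bianchi_nabla n5 oU gsm gs gu als rec k Ux)) => //.
by rewrite sE.
Qed.

(* A differentiable function which vanishes wherever [special_at] applies vanishes on [U]:
   otherwise the hypotheses of [flat_absurd] hold near a point where it does not vanish. *)
Lemma vanish_special (f : 'rV[R]_n -> R) : (forall x, U x -> differentiable f x) ->
  (forall x, U x -> specialx x -> f x = 0) -> forall x, U x -> f x = 0.
Proof.
move=> df fs x Ux; apply/eqP; apply: contraT => fx0; exfalso.
pose V := [set y | U y /\ f y != 0]^°.
have oV : open V by exact: open_interior.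
have VU : V `<=` U by move=> y /interior_subset[].
have Vx : V x.
  have nU : \forall y \near x, U y by exact: open_nbhs_nbhs.
  have nf : \forall y \near x, f y != 0.
    have cf : {for x, continuous f} by exact/differentiable_continuous/df.
    exact: (cf [set z | z != 0] (open_nbhs_nbhs (conj (@open_neq R 0) fx0))).
  exact: filterI nU nf.
have nsp y : V y -> ~ specialx y.
  by move=> Vy sp; have [Uy /eqP] := interior_subset Vy; apply; apply: fs.
have nprop y : V y -> ~ (sqnorm g al y = 0 \/ exists k, ~ exists c, forall i, nabla1 k i y = c * al i y).
  by move=> Vy H; apply: (nsp _ Vy); apply: special_at H; exact: VU.
apply: (@flat_absurd R n V g n5 oV _ _ _ _ al _ _ _ _ x Vx).
- by move=> i j; apply: smooth_sub VU (gsm i j).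
- by move=> y /VU; apply: gs.
- by move=> y /VU; apply: gu.
- by move=> y /VU; apply: sq0.
- by move=> i; apply: smooth_sub VU (als i).
- by move=> y /VU; apply: rec.
- by move=> y Vy; apply/eqP => s0; apply: (nprop _ Vy); left.
- by move=> y Vy k; apply: contrapT => H; apply: (nprop _ Vy); right; exists k.
Qed.

Lemma special_everywhere x : U x -> specialx x.
Proof.
have dh i j y : U y -> differentiable (h i j) y.
  by move=> Uy; apply: smooth_diff (htensor_smooth n5 oU gsm gs gu sq0 i j) Uy.
have dS i j y : U y -> differentiable (S i j) y.
  by move=> Uy; apply: smooth_diff (schouten_smooth oU gsm gu i j) Uy.
have dg i j y : U y -> differentiable (fun z => g z i j) y.
  by move=> Uy; apply: smooth_diff (gsm i j) Uy.
have dc X y : U y -> (forall p q, differentiable (X p q) y) ->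
  differentiable (fun z => ctr (gi z) (fun p q => X p q z)) y.
  by move=> Uy dX; exact: (diff_ctr oU gsm gu Uy dX).
have dcst (c : R) y : differentiable (fun=> c : R) y by exact: differentiable_cst.
have dtf i j y : U y -> differentiable (fun z => trace_free (g z) (gi z) (fun i j => S i j z) i j) y.
  move=> Uy; apply: differentiableB; first exact: dS.
  apply: differentiableM; last exact: dg.
  by apply: differentiableM => //; apply: dc => // p q; apply: dS.
move=> Ux; split=> i j; apply/eqP; rewrite -subr_eq0; apply/eqP.
- pose f y := ctr (gi y) (fun p q => h i p y * h q j y) - ((mu R n + nu R n) * h i j y - mu R n * nu R n * g y i j).
  apply: (vanish_special (f := f)) Ux => y Uy; last by move=> [sp _]; rewrite /f sp subrr.
  apply: differentiableB; first by apply: dc => // p q; apply: differentiableM; apply: dh.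
  by apply: differentiableB; apply: differentiableM => //; [exact: dh|exact: dg].
- pose f y := trace_free (g y) (gi y) (fun i j => S i j y) i j
    - coefG (g y) (gi y) (fun i j => h i j y) (fun i j => S i j y) * (h i j y - g y i j / N).
  apply: (vanish_special (f := f)) Ux => y Uy; last by move=> [_ sp]; rewrite /f sp subrr.
  apply: differentiableB; first exact: dtf.
  apply: differentiableM.
    apply: differentiableM => //; apply: (dc) => // p q; apply: dc => // p' q'.
    by apply: differentiableM; [exact: dtf|exact: dh].
  apply: differentiableB; first exact: dh.
  by apply: differentiableM => //; exact: dg.
Qed.

Lemma htensor_al x i : U x -> ctr (gi x) (fun p q => al p x * h q i x) = mu R n * al i x.
Proof.
move=> Ux; have W := weyl_pt n5 oU gsm gs gu Ux.
case: W => _ gK gs' gis' h12 h34 hc ht.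
have B := weyl_bianchi n5 oU gsm gs gu Ux (rec Ux).
have := contr_eigen n5 gK gs' gis' h12 h34 hc ht B i.
rewrite -weyl_sqE => e.
rewrite (ctr_vl gis' (ev_refl _ _)).
rewrite (eq_app _ (G := fun q => (weyl_sq g x)^-1 * Hc (gi x) (C x) i q)); last first.
  by move=> q; rewrite htensorC // /htensor weyl_contrE.
rewrite (evMl _ (ev_refl _ _)) e /mu.
by move: (sq0 Ux) (al i x) (_ / _); move: (weyl_sq g x) => s s0 b c; field.
Qed.
End Special.

(** * Change of charts *)

Section ChangeOfCoordinates.
Variables (R : realType) (n : nat) (U V : set 'rV[R]_n).
Variable phi : 'rV[R]_n -> 'rV[R]_n.
Hypothesis oU : open U.
Hypothesis oV : open V.
Hypothesis phiU : forall x, U x -> V (phi x).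
Hypothesis phi_smooth : forall a, smooth_on U (fun z => phi z 0 a).
Implicit Types (i j k l : 'I_n) (x y : 'rV[R]_n).

Lemma smoothk_comp d (f : 'rV[R]_n -> R) : smoothk V d f -> smoothk U d (fun z => f (phi z)).
Proof.
elim: d f => [|d IH] f.
  move=> /smoothk0 df; apply/smoothk0 => x Ux.
  apply: differentiable_comp; last exact/df/phiU.
  by apply: differentiable_rV => a; apply: smooth_diff (phi_smooth a) Ux.
move=> sf'; have /smoothkS[df sf] := sf'; apply/smoothkS; split=> [x Ux|i].
  apply: differentiable_comp; last exact/df/phiU.
  by apply: differentiable_rV => a; apply: smooth_diff (phi_smooth a) Ux.
apply: (eq_smoothk oU (f := fun z => \sum_a partial i (fun z => phi z 0 a) z * partial a f (phi z))).
  move=> y Uy; rewrite partial_comp //; last exact/df/phiU.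
  by move=> a; apply: smooth_diff (phi_smooth a) Uy.
elim: (index_enum _) => [|a r IHr].
  apply: (eq_smoothk oU (f := fun=> 0)); first by move=> y _; rewrite big_nil.
  by have /smooth_onP := smooth_cst oU 0; apply.
apply: (eq_smoothk oU (f := fun z => partial i (fun z => phi z 0 a) z * partial a f (phi z) +
   \sum_(a <- r) partial i (fun z => phi z 0 a) z * partial a f (phi z))).
  by move=> y _; rewrite big_cons.
apply: smoothkD => //; apply: smoothkM => //; last exact: IH.
by have /smooth_onP := smooth_partial i (phi_smooth a); apply.
Qed.

Lemma smooth_comp (f : 'rV[R]_n -> R) : smooth_on V f -> smooth_on U (fun z => f (phi z)).
Proof. by move=> /smooth_onP sf; apply/smooth_onP => d; apply: smoothk_comp. Qed.

Definition Jac x : 'M[R]_n := \matrix_(i, a) partial i (fun z => phi z 0 a) x.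

Lemma Jac_smooth : smooth_mx U Jac.
Proof. by move=> i a; under eq_fun do rewrite mxE; apply: smooth_partial. Qed.

Lemma Jac_partialC i j b x : U x -> dM i Jac x j b = dM j Jac x i b.
Proof.
move=> Ux.
have e c : (fun y => Jac y c b) = partial c (fun z => phi z 0 b).
  by apply/funext => y; rewrite mxE.
rewrite [LHS]mxE [RHS]mxE (e i) (e j).
exact: (partialC i j oU Ux (phi_smooth b)).
Qed.

Lemma dM_comp i (A : 'rV[R]_n -> 'M[R]_n) x : U x -> smooth_mx V A ->
  dM i (fun z => A (phi z)) x = \sum_a Jac x i a *: dM a A (phi x).
Proof.
move=> Ux sA; apply/matrixP => p q; rewrite summxE mxE.
rewrite (partial_comp (f := fun z => A z p q)).
- by apply: eq_bigr => a _; rewrite !mxE.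
- by move=> a; apply: smooth_diff (phi_smooth a) Ux.
- by apply: smooth_diff (sA p q) _; apply: phiU.
Qed.

Variables g g' : 'rV[R]_n -> 'M[R]_n.
Hypothesis gsm : smooth_mx U g.
Hypothesis gs : forall x, U x -> (g x)^T = g x.
Hypothesis gu : forall x, U x -> g x \in unitmx.
Hypothesis gsm' : smooth_mx V g'.
Hypothesis gs' : forall x, V x -> (g' x)^T = g' x.
Hypothesis gu' : forall x, V x -> g' x \in unitmx.
Hypothesis g_pull : forall x, U x -> g x = Jac x *m g' (phi x) *m (Jac x)^T.

Lemma Jac_unit x : U x -> Jac x \in unitmx.
Proof.
move=> Ux; have := gu Ux; rewrite g_pull // !unitmxE !det_mulmx !unitrM.
by case/andP => /andP[].
Qed.

(** The connection of g' pulled back by phi: the direction of differentiation is transformed, the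
    frame is still that of the target coordinates. *)
Definition Gam_pull i x : 'M[R]_n := \sum_a Jac x i a *: Gam g' a (phi x).

Lemma Gam_pull_smooth i : smooth_mx U (Gam_pull i).
Proof.
move=> p q; apply: (@eq_smooth _ _ U oU (fun x => \sum_a Jac x i a * Gam g' a (phi x) p q)).
  by move=> y _; rewrite /Gam_pull summxE; apply: eq_bigr => a _; rewrite [RHS]mxE.
apply: (smooth_sum oU) => a _; apply: (smoothM oU); first exact: (Jac_smooth i a).
by apply: (@smooth_comp (fun z => Gam g' a z p q)); apply: (Gam_smooth oV gsm' gu').
Qed.

(** Applying the two transpositions alternately, three times each, restores the order of the slots
    after three changes of sign. *)
Lemma braid_zero (T : 'I_n -> 'I_n -> 'I_n -> R) : (forall a b c, T a b c = T b a c) ->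
  (forall a b c, T a b c = - T a c b) -> forall a b c, T a b c = 0.
Proof.
move=> sy an a b c; suff : T a b c = - T a b c by move=> e; lra.
by rewrite {1}sy an sy an opprK sy an.
Qed.

(** The difference of two torsion-free metric connections, lowered by g, is symmetric in two slots
    and skew in two, so [braid_zero] applies. *)
Lemma levi_civita_unique (D : 'I_n -> 'M[R]_n) x : U x ->
  (forall i j m, D i j m = D j i m) ->
  (forall i, dM i g x = D i *m g x + g x *m (D i)^T) ->
  forall i, D i = Gam g i x.
Proof.
move=> Ux Ds Dg i.
have [T TE] : exists T : 'I_n -> 'M[R]_n, forall a, T a = (D a - Gam g a x) *m g x by eexists.
have Tanti a b c : T a b c = - T a c b.
  have : T a + (T a)^T = 0.
    rewrite TE trmx_mul gs // linearB /= mulmxBl mulmxBr addrACA -opprD -Dg.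
    by rewrite -(metric_compat oU gs gu a Ux) subrr.
  move: (T a) => A /matrixP/(_ b c); rewrite [LHS]mxE [A^T b c]mxE [RHS]mxE => /eqP.
  by rewrite addr_eq0 => /eqP.
have Tsym a b c : T a b c = T b a c.
  rewrite !TE [LHS]mxE [RHS]mxE; apply: eq_bigr => p _; congr (_ * _).
  have DE s t : (D s - Gam g s x) t p = D s t p - christoffel g p s t x by rewrite !mxE.
  apply: (etrans (DE a b)); apply: (etrans _ (esym (DE b a))).
  exact: (congr2 +%R (Ds a b p) (congr1 -%R (christoffelC oU gs p a b Ux))).
have T0 a b c : T a b c = 0 by exact: (braid_zero (T := fun a => T a) Tsym Tanti).
have : T i = 0 by apply/matrixP => b c; rewrite T0 mxE.
move=> /(congr1 (mulmx^~ (invmx (g x)))); rewrite TE -mulmxA mulmxV ?gu // mulmx1 mul0mx.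
by move/eqP; rewrite subr_eq0 => /eqP.
Qed.

(** The Christoffel symbols are never expanded: [D] is defined by the transformation law and
    recognised as the Levi-Civita connection of g by uniqueness. Symmetry of the second derivatives
    of phi makes it torsion-free. *)
Lemma Gam_law i x : U x -> Gam g i x *m Jac x = dM i Jac x + Jac x *m Gam_pull i x.
Proof.
move=> Ux; have Ju := Jac_unit Ux.
have [D DJ] : exists D : 'I_n -> 'M[R]_n, forall a, D a *m Jac x = dM a Jac x + Jac x *m Gam_pull a x.
  by exists (fun a => (dM a Jac x + Jac x *m Gam_pull a x) *m invmx (Jac x)) => a; rewrite mulmxKV.
rewrite -DJ; congr (_ *m _); symmetry; apply: (levi_civita_unique Ux); last first.
  move=> {}i.
  have sgphi : smooth_mx U (fun z => g' (phi z)).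
    by move=> p q; apply: (@smooth_comp (fun z => g' z p q)); apply: gsm'.
  have sJ := Jac_smooth; have sJt := smooth_trmx sJ; have sJg := smooth_mulmx oU sJ sgphi.
  rewrite (dM_eq oU Ux i g_pull) (dM_mul Ux i sJg sJt) (dM_mul Ux i sJ sgphi) dM_tr (dM_comp i Ux gsm').
  have -> : \sum_a Jac x i a *: dM a g' (phi x) = Gam_pull i x *m g' (phi x) + g' (phi x) *m (Gam_pull i x)^T.
    rewrite /Gam_pull mulmx_suml [in RHS]linear_sum /= mulmx_sumr -big_split /=; apply: eq_bigr => a _.
    rewrite (metric_compat oV gs' gu' a (phiU Ux)) scalerDr -scalemxAl linearZ /=.
    by rewrite -scalemxAr.
  have -> : D i *m g x + g x *m (D i)^T = (dM i Jac x + Jac x *m Gam_pull i x) *m g' (phi x) *m (Jac x)^T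
      + Jac x *m g' (phi x) *m (dM i Jac x + Jac x *m Gam_pull i x)^T.
    by rewrite -DJ (trmx_mul (D i) (Jac x)) g_pull // !mulmxA.
  move: (dM i Jac x) (Jac x) (Gam_pull i x) (g' (phi x)); clear=> A J P G.
  rewrite [(_ + _)^T]linearD /= trmx_mul !(mulmxDl, mulmxDr) !mulmxA; mx_abel.
move=> a b c.
suff s : (\matrix_(a, p) D a b p : 'M[R]_n) = \matrix_(a, p) D b a p.
  by have /matrixP/(_ a c) := s; rewrite !mxE.
apply: (can_inj (mulmxK Ju)); apply/matrixP => {}a p.
have -> : ((\matrix_(a, p) D a b p : 'M[R]_n) *m Jac x) a p = (D a *m Jac x) b p.
  by rewrite !mxE; apply: eq_bigr => q _; rewrite mxE.
have -> : ((\matrix_(a, p) D b a p : 'M[R]_n) *m Jac x) a p = (D b *m Jac x) a p.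
  by rewrite !mxE; apply: eq_bigr => q _; rewrite mxE.
have DE s t : (D s *m Jac x) t p = dM s Jac x t p + (Jac x *m Gam_pull s x) t p by rewrite DJ mxE.
apply: (etrans (DE a b)); apply: (etrans _ (esym (DE b a))).
apply: (congr2 +%R (Jac_partialC a b p Ux)).
have JE v d : (Jac x *m Gam_pull v x) d p = \sum_s \sum_q Jac x d q * (Jac x v s * christoffel g' p s q (phi x)).
  rewrite mxE exchange_big; apply: eq_bigr => q _; rewrite -mulr_sumr; congr (_ * _).
  by rewrite /Gam_pull summxE; apply: eq_bigr => s _; rewrite [LHS]mxE [Gam _ _ _ _ _]mxE.
apply: (etrans (JE a b)); apply: (etrans _ (esym (JE b a))).
rewrite exchange_big; apply: eq_bigr => q _; apply: eq_bigr => s _.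
by rewrite mulrCA; congr (_ * (_ * _)); apply: (christoffelC oV gs' p s q (phiU Ux)).
Qed.

(** Pure matrix algebra: the first two hypotheses are derivatives of the law G J = dJ + J P, where
    [X1] and [X2] are second derivatives of J. Once these cancel, only the two curvatures remain. *)
Lemma curvature_law (A1 A2 X1 X2 P1 P2 Gj Gk Pj Pk Jj Jk J : 'M[R]_n) :
  A1 *m J + Gj *m Jk = X1 + (Jk *m Pj + J *m P1) ->
  A2 *m J + Gk *m Jj = X2 + (Jj *m Pk + J *m P2) -> X1 = X2 ->
  Gj *m J = Jj + J *m Pj -> Gk *m J = Jk + J *m Pk ->
  (A1 - A2 + (Gj *m Gk - Gk *m Gj)) *m J = J *m (P1 - P2 + (Pj *m Pk - Pk *m Pj)).
Proof.
move=> /(canRL (addrK _)) e1 /(canRL (addrK _)) e2 X12 ej ek.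
rewrite !mulmxDl !mulNmx e1 e2 -!mulmxA ej ek !mulmxDr !mulmxN !mulmxA ej ek !mulmxDl X12.
mx_abel.
Qed.

Lemma Rmat_law j k x : U x -> Rmat g j k x *m Jac x =
  \sum_a \sum_b (Jac x j a * Jac x k b) *: (Jac x *m Rmat g' a b (phi x)).
Proof.
move=> Ux; have sJ := Jac_smooth.
have sG a := Gam_smooth oU gsm gu a.
have d a b : dM b (Gam g a) x *m Jac x + Gam g a x *m dM b Jac x =
    dM b (dM a Jac) x + (dM b Jac x *m Gam_pull a x + Jac x *m dM b (Gam_pull a) x).
  have sJP := smooth_mulmx oU sJ (Gam_pull_smooth a).
  rewrite -(dM_mul Ux b (sG a) sJ) (dM_eq oU Ux b (Gam_law a)).
  by rewrite (dM_add Ux b (smooth_dM a sJ) sJP) (dM_mul Ux b sJ (Gam_pull_smooth a)).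
(* The first sum carries second derivatives of phi; it is symmetric in a and b and will cancel in
   the curvature. *)
have dP a b : dM b (Gam_pull a) x = \sum_c dM b Jac x a c *: Gam g' c (phi x)
   + \sum_c \sum_e (Jac x a c * Jac x b e) *: dM e (Gam g' c) (phi x).
  rewrite -big_split /=; apply/matrixP => p q; rewrite summxE mxE.
  have dG c : differentiable (fun y => Gam g' c (phi y) p q) x.
    apply: smooth_diff Ux; apply: (@smooth_comp (fun z => Gam g' c z p q)); exact: Gam_smooth.
  have dJ c : differentiable (fun y => Jac y a c) x by apply: smooth_diff Ux; apply: sJ.
  under eq_fun do rewrite summxE.
  rewrite partial_sumf; last first.
    by move=> c; under eq_fun do rewrite mxE; apply: differentiableM.
  apply: eq_bigr => c _.
  under eq_fun do rewrite mxE.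
  rewrite partialM // [RHS]mxE; congr (_ + _); first by rewrite !mxE.
  have /matrixP/(_ p q) := dM_comp b Ux (Gam_smooth oV gsm' gu' c).
  rewrite mxE => ->; rewrite !summxE mulr_sumr; apply: eq_bigr => e _.
  by rewrite !mxE mulrA.
have Gam_pull_curv : dM k (Gam_pull j) x - dM j (Gam_pull k) x + (Gam_pull j x *m Gam_pull k x - Gam_pull k x *m Gam_pull j x) =
   \sum_a \sum_b (Jac x j a * Jac x k b) *: Rmat g' a b (phi x).
  have PP a b : Gam_pull a x *m Gam_pull b x = \sum_c \sum_e (Jac x a c * Jac x b e) *: (Gam g' c (phi x) *m Gam g' e (phi x)).
    rewrite /Gam_pull mulmx_suml; apply: eq_bigr => c _; rewrite mulmx_sumr; apply: eq_bigr => e _.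
    by rewrite -scalemxAl -scalemxAr scalerA.
  rewrite !dP !PP.
  have -> : \sum_c dM k Jac x j c *: Gam g' c (phi x) = \sum_c dM j Jac x k c *: Gam g' c (phi x).
    by apply: eq_bigr => c _; congr (_ *: _); apply: Jac_partialC.
  have subDD (A B C : 'M[R]_n) : A + B - (A + C) = B - C by rewrite opprD addrACA subrr add0r.
  rewrite subDD.
  rewrite [in X in _ - X + _]exchange_big [in X in _ + (_ - X)]exchange_big /=.
  rewrite -!sumrB -big_split /=; apply: eq_bigr => c _; rewrite -!sumrB -big_split /=; apply: eq_bigr => e _.
  by rewrite (mulrC (Jac x k e)) -!scalerBr -scalerDr RmatE.
transitivity (Jac x *m (dM k (Gam_pull j) x - dM j (Gam_pull k) x + (Gam_pull j x *m Gam_pull k x - Gam_pull k x *m Gam_pull j x))); last first.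
  rewrite Gam_pull_curv mulmx_sumr; apply: eq_bigr => a _; rewrite mulmx_sumr; apply: eq_bigr => b _.
  by rewrite -scalemxAr.
rewrite RmatE.
exact: (curvature_law (d j k) (d k j) (dMC oU Ux k j sJ) (Gam_law j Ux) (Gam_law k Ux)).
Qed.

Lemma ricci_law k l x : U x ->
  ricci g k l x = \sum_b \sum_c Jac x k b * Jac x l c * ricci g' b c (phi x).
Proof.
move=> Ux; have Ju := Jac_unit Ux.
have e m : riemann g m k l m x =
    \sum_b \sum_a Jac x k b * ((Jac x *m Rmat g' a b (phi x) *m invmx (Jac x)) l m * Jac x m a).
  have -> : riemann g m k l m x = Rmat g m k x l m by rewrite mxE.
  rewrite -(mulmxK Ju (Rmat g m k x)) Rmat_law // mulmx_suml summxE exchange_big.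
  apply: eq_bigr => a _; rewrite mulmx_suml summxE; apply: eq_bigr => b _.
  rewrite -scalemxAl mxE; move: (_ *m invmx _) => Q; ring.
rewrite /ricci; under eq_bigr do rewrite e.
rewrite exchange_big -sumrN; apply: eq_bigr => b _.
under [RHS]eq_bigr do rewrite mulrN mulr_sumr.
rewrite [RHS]sumrN; congr (- _).
rewrite exchange_big [RHS]exchange_big; apply: eq_bigr => a _.
rewrite -mulr_sumr.
have -> : \sum_m (Jac x *m Rmat g' a b (phi x) *m invmx (Jac x)) l m * Jac x m a = (Jac x *m Rmat g' a b (phi x)) l a.
  by rewrite -[in RHS](mulmxKV Ju (Jac x *m Rmat g' a b (phi x))) [RHS]mxE.
by rewrite [X in _ * X]mxE mulr_sumr; apply: eq_bigr => c _; rewrite [Rmat _ _ _ _ _ _]mxE mulrA.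
Qed.
End ChangeOfCoordinates.

(** * Eigenvalues of the Ricci endomorphism *)

Lemma quadratic_eigenvalues (R : realType) (n : nat) (A : 'M[R]_n) (a b : R) :
  A *m A = (a + b) *: A - (a * b)%:M -> at_most_two_eigenvalues A.
Proof.
move=> AA; exists (real_complex R a), (real_complex R b) => z /eigenvalueP[v vA v0].
have [f fE] : exists f : {rmorphism R -> R[i]}, real_complex R = f by exists (real_complex R).
rewrite fE in vA *.
have e : (z - f a) * (z - f b) *: v = 0.
  have := congr1 (mulmx v) (congr1 (map_mx f) AA).
  rewrite map_mxM map_mxB map_mxZ map_scalar_mx mulmxA vA -scalemxAl vA scalerA => e.
  rewrite (_ : (z - f a) * (z - f b) = z * z - (f (a + b) * z - f (a * b))); last first.
    by rewrite rmorphD rmorphM /=; ring.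
  rewrite scalerBl e mulmxBr mul_mx_scalar -scalemxAr vA scalerA -scalerBl subrr //.
have := e; move/eqP; rewrite scaler_eq0 (negbTE v0) orbF mulf_eq0 !subr_eq0.
by case/orP => /eqP ->; [left|right].
Qed.

Section RicciEndo.
Variables (R : realType) (n : nat) (U : set 'rV[R]_n) (g : 'rV[R]_n -> 'M[R]_n).
Hypothesis n5 : (5 <= n)%N.
Hypothesis oU : open U.
Implicit Types (i j k l : 'I_n) (x y : 'rV[R]_n).
Hypothesis gsm : smooth_mx U g.
Hypothesis gs : forall x, U x -> (g x)^T = g x.
Hypothesis gu : forall x, U x -> g x \in unitmx.
Hypothesis sq0 : forall x, U x -> weyl_sq g x != 0.
Variable al : 'I_n -> 'rV[R]_n -> R.
Hypothesis als : forall i, smooth_on U (al i).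
Hypothesis rec : forall y, U y -> forall i j k l m,
  nabla4 g (weyl g) i j k l m y = al i y * weyl g j k l m y.
Hypothesis al0 : forall y, U y -> exists i, al i y != 0.
Local Notation gi y := (invmx (g y)).
Local Notation S := (schouten g).
Local Notation h := (htensor g).
Local Notation N := (n%:R : R).

(** The factor n - 2 converts the trace-free Schouten tensor into the trace-free Ricci tensor. *)
Definition ricciG x := (N - 2) * coefG (g x) (gi x) (fun i j => h i j x) (fun i j => S i j x).

Lemma ricci_decomp x i j : U x ->
  ricci g i j x - scalar_curv g x / N * g x i j = ricciG x * (h i j x - N^-1 * g x i j).
Proof.
move=> Ux; have [_ /(_ i j)] := special_everywhere n5 oU gsm gs gu sq0 als rec al0 Ux.
rewrite /trace_free (ctr_schouten n5 gs gu Ux) => e.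
have -> : ricciG x * (h i j x - N^-1 * g x i j) = (N - 2) * (coefG (g x) (gi x) (fun i j => h i j x)
  (fun i j => S i j x) * (h i j x - g x i j / N)) by rewrite [RHS]mulrA (mulrC N^-1).
rewrite -e (ricciE g n5); field.
by rewrite ?(Nm1 R n5) ?(Nm2 R n5) ?pnatr_eq0 -?lt0n ?(leq_trans _ n5).
Qed.
Lemma ricciG_smooth : smooth_on U ricciG.
Proof.
have sgi := ginv_smooth oU gsm gu; have sS := schouten_smooth oU gsm gu.
have sh := htensor_smooth n5 oU gsm gs gu sq0.
have sctr (X : 'I_n -> 'I_n -> 'rV[R]_n -> R) : (forall p q, smooth_on U (X p q)) ->
  smooth_on U (fun y => ctr (gi y) (fun p q => X p q y)).
  move=> sX; apply: (smooth_sum oU) => p _; apply: (smooth_sum oU) => q _.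
  by apply: (smoothM oU); [exact: sgi|exact: sX].
apply: (smoothM oU); first exact: smooth_cst.
apply: (smoothM oU); last exact: smooth_cst.
apply: (sctr) => i i'; apply: (sctr) => j j'; apply: (smoothM oU); last exact: sh.
apply: (smoothB oU); first exact: sS.
apply: (smoothM oU); last exact: gsm.
by apply: (smoothM oU); [exact: sctr|exact: smooth_cst].
Qed.

Section At.
Variable x : 'rV[R]_n.
Hypothesis Ux : U x.
Let H : 'M[R]_n := gi x *m \matrix_(i, j) h i j x.

Lemma ricci_endoE : ricci_endo g x =
  (scalar_curv g x / N - ricciG x / N)%:M + ricciG x *: H.
Proof.
have -> : ricci_endo g x = gi x *m \matrix_(i, j) ricci g i j x.
  by apply/matrixP => i j; rewrite !mxE; apply: eq_bigr => p _; rewrite mxE.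
have -> : \matrix_(i, j) ricci g i j x = (scalar_curv g x / N - ricciG x / N) *: g x
    + ricciG x *: \matrix_(i, j) h i j x.
  apply/matrixP => i j; have := ricci_decomp i j Ux; rewrite !mxE => /eqP.
  rewrite subr_eq => /eqP ->; move: (ricciG x) (scalar_curv g x) (h i j x) => a b c; ring.
by rewrite mulmxDr -!scalemxAr (gVg gu Ux) scalemx1.
Qed.

Lemma htensor_quadratic : H *m H = (mu R n + nu R n) *: H - (mu R n * nu R n)%:M.
Proof.
pose h' : 'M[R]_n := \matrix_(i, j) h i j x.
have [sp _] := special_everywhere n5 oU gsm gs gu sq0 als rec al0 Ux.
have e : h' *m gi x *m h' = (mu R n + nu R n) *: h' - (mu R n * nu R n) *: g x.
  apply/matrixP => i j; have := sp i j; rewrite !mxE => <-.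
  under eq_bigr do rewrite mxE mulr_suml.
  rewrite exchange_big; apply: eq_bigr => p _; apply: eq_bigr => q _.
  by rewrite !mxE [h i p x * _]mulrC mulrA.
by rewrite /H -/h' mulmxA -(mulmxA _ h') -(mulmxA _ (h' *m _)) e mulmxBr -!scalemxAr (gVg gu Ux) scalemx1.
Qed.

Lemma ricci_two_eigenvalues : at_most_two_eigenvalues (ricci_endo g x).
Proof.
rewrite ricci_endoE; set c := (_ - _); set G := ricciG x.
apply: (@quadratic_eigenvalues _ _ _ (c + G * mu R n) (c + G * nu R n)).
rewrite mulmxDl !mulmxDr -!scalemxAl -!scalemxAr htensor_quadratic.
rewrite !mul_scalar_mx mul_mx_scalar.
move: (mu R n) (nu R n) H; clear => a b h'; apply/matrixP => i j; rewrite !mxE.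
by case: (i == j); rewrite ?mulr1n ?mulr0n; ring.
Qed.

Definition ricci_eigenvalue := scalar_curv g x / N + ricciG x * (mu R n - N^-1).

Lemma ricci_eigenvector :
  (\row_i al i x) *m ricci_endo g x = ricci_eigenvalue *: \row_i al i x.
Proof.
have aH : (\row_i al i x) *m H = mu R n *: \row_i al i x.
  apply/rowP => i; rewrite [RHS]mxE [X in _ * X]mxE -(htensor_al n5 oU gsm gs gu sq0 rec i Ux).
  rewrite /H mulmxA mxE; under eq_bigr do rewrite mxE mulr_suml.
  rewrite exchange_big; apply: eq_bigr => p _; apply: eq_bigr => q _.
  by rewrite !mxE [RHS]mulrCA mulrA.
rewrite ricci_endoE mulmxDr mul_mx_scalar -scalemxAr aH scalerA -scalerDl; congr (_ *: _).
rewrite /ricci_eigenvalue; move: (scalar_curv g x) (ricciG x) => a b; ring.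
Qed.

Lemma tr_ricci_endo : \tr (ricci_endo g x) = scalar_curv g x.
Proof.
apply: eq_bigr => i _; rewrite mxE; apply: eq_bigr => p _.
by rewrite (ricciC oU gsm gs gu Ux).
Qed.
End At.
End RicciEndo.

(** * Independence of the chart, and the theorem *)

Section Charts.
Variables (R : realType) (n : nat) (M : topologicalType).
Implicit Types c d : chart R n M.

Lemma overlap_sub c d : overlap c d `<=` coords c.
Proof. by move=> _ [p [cp dp] <-]; exists p. Qed.

Lemma overlapP c d x : coords c x -> cdom d (cinv c x) -> overlap c d x.
Proof. by move=> [p cp <-]; rewrite cmapK // => dp; exists p. Qed.

Lemma transition_coords c d x : overlap c d x -> coords d (transition c d x).
Proof. by move=> [p [cp dp] <-]; rewrite /transition cmapK //; exists p. Qed.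

Lemma overlap_open c d : open (overlap c d).
Proof.
rewrite openE => _ [p [cp dp] <-].
have oc : open (coords c) by exact: cimg_open.
have Uc : coords c (cmap c p) by exists p.
have := @cinv_continuous _ _ _ c; rewrite (continuous_open_subspace _ oc) => /(_ (cmap c p)).
rewrite inE => /(_ Uc) cc.
have nd : nbhs (cinv c (cmap c p)) (cdom d).
  by rewrite cmapK //; apply: open_nbhs_nbhs; split=> //; exact: cdom_open.
have nc : nbhs (cmap c p) (coords c) by apply: open_nbhs_nbhs.
apply: filterS (filterI nc (cc _ nd)) => x [cx dx]; exact: overlapP.
Qed.
End Charts.

Section Invariance.
Variables (R : realType) (n : nat) (M : manifold R n) (g : metric M).
Variables c d : chart R n M.
Hypotheses (ac : atlas c) (ad : atlas d).

Lemma ricci_endo_law x : overlap c d x ->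
  jacobian c d x \in unitmx /\
  ricci_endo (g c) x = invmx (jacobian c d x)^T *m ricci_endo (g d) (transition c d x) *m (jacobian c d x)^T.
Proof.
move=> ox.
have oU : open (overlap c d) by exact: overlap_open.
have oV : open (coords d) by exact: cimg_open.
have sub := @overlap_sub _ _ _ c d.
have gsm : smooth_mx (overlap c d) (g c).
  by move=> i j; apply: smooth_sub sub (metric_smooth g ac i j).
have gs y : overlap c d y -> (g c y)^T = g c y by move=> /sub; apply: metric_sym.
have gu y : overlap c d y -> g c y \in unitmx by move=> /sub; apply: metric_nondeg.
have gsm' : smooth_mx (coords d) (g d) by exact: metric_smooth.
have gs' y : coords d y -> (g d y)^T = g d y by apply: metric_sym.
have gu' y : coords d y -> g d y \in unitmx by apply: metric_nondeg.
have pull y : overlap c d y -> g c y = jacobian c d y *m g d (transition c d y) *m (jacobian c d y)^T.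
  exact: metric_tensor.
have ric := ricci_law oU oV (@transition_coords _ _ _ c d) (atlas_smooth ac ad) gsm gs gu gsm' gs' gu' pull.
have Ju : jacobian c d x \in unitmx := Jac_unit gu pull ox.
split=> //; move: (ox) => /transition_coords cy.
have endoE (k : 'rV[R]_n -> 'M[R]_n) z : ricci_endo k z = invmx (k z) *m \matrix_(i, j) ricci k i j z.
  by apply/matrixP => i j; rewrite !mxE; apply: eq_bigr => p _; rewrite mxE.
have -> : ricci_endo (g c) x = invmx (g c x) *m (jacobian c d x *m (\matrix_(i, j) ricci (g d) i j (transition c d x)) *m (jacobian c d x)^T).
  rewrite endoE; congr (_ *m _); apply/matrixP => k l.
  rewrite [LHS]mxE; have -> : ricci (g c) k l x = \sum_b \sum_e jacobian c d x k b * jacobian c d x l e * ricci (g d) b e (transition c d x).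
    exact: ric.
  move: (jacobian c d x) (transition c d x) => J y.
  rewrite exchange_big [RHS]mxE; apply: eq_bigr => e _.
  rewrite !mxE mulr_suml; apply: eq_bigr => b _; rewrite mxE; ring.
have gcu := gu x ox; have gdu := gu' _ cy.
apply: (can_inj (mulKmx gcu)); rewrite mulKVmx // endoE pull // -!mulmxA mulKVmx ?unitmx_tr //.
by rewrite (mulKVmx gdu).
Qed.
End Invariance.

Section Main.
Variables (R : realType) (n : nat) (M : manifold R n) (g : metric M) (alpha : covector_field M).
Hypothesis n5 : (5 <= n)%N.
Hypothesis recurrent : conformally_recurrent g alpha.
Hypothesis sq0 : forall c, atlas c -> forall x, coords c x -> weyl_sq (g c) x != 0.

Section Chart.
Variable c : chart R n M.
Hypothesis ac : atlas c.
Definition alc i x := alpha c x 0 i.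

Lemma chart_open : open (coords c). Proof. exact: cimg_open. Qed.
Lemma chart_gsm : smooth_mx (coords c) (g c). Proof. exact: metric_smooth. Qed.
Lemma chart_gs x : coords c x -> (g c x)^T = g c x. Proof. exact: metric_sym. Qed.
Lemma chart_gu x : coords c x -> g c x \in unitmx. Proof. exact: metric_nondeg. Qed.
Lemma chart_als i : smooth_on (coords c) (alc i). Proof. exact: covector_smooth. Qed.
Lemma chart_rec y : coords c y -> forall i j k l m,
  nabla4 (g c) (weyl (g c)) i j k l m y = alc i y * weyl (g c) j k l m y.
Proof. by case: recurrent => _ r cy i j k l m; exact: r. Qed.
Lemma chart_al0 y : coords c y -> exists i, alc i y != 0.
Proof. by case: recurrent => a0 _ cy; apply/rV0Pn; exact: a0. Qed.
Lemma alcE y : \row_i alc i y = alpha c y.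
Proof. by apply/rowP => i; rewrite mxE. Qed.
End Chart.

(** This is the coefficient of [ricciG] in [ricci_eigenvalue], so G can be recovered from that
    eigenvalue and the scalar curvature. *)
Lemma mu_neq_inv : mu R n - n%:R^-1 != 0.
Proof.
have n0 : (n%:R : R) != 0 by rewrite pnatr_eq0 -lt0n (leq_trans _ n5).
have -> : mu R n - n%:R^-1 = (n%:R - 1) * (n%:R - 4) / (2 * n%:R * (n%:R - 2)).
  by rewrite /mu; field; rewrite n0 (Nm2 R n5).
by rewrite !(mulf_neq0, invr_neq0) ?n0 ?(Nm1 R n5) ?(Nm2 R n5) ?(@Nsub_neq0 R n n5 4) ?pnatr_eq0.
Qed.

(** The matrices of the Ricci endomorphism in the two charts are similar, so they have the same
    trace and the same eigenvalue on alpha. The law of change of charts for the Ricci tensor thus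
    suffices, and C and h need not be transformed. *)
Lemma ricciG_invariant c d x : atlas c -> atlas d -> overlap c d x ->
  ricciG (g c) x = ricciG (g d) (transition c d x).
Proof.
move=> ac ad ox; have cx := overlap_sub ox; have dy := transition_coords ox.
have [Ju law] := ricci_endo_law g ac ad ox.
have Jtu : (jacobian c d x)^T \in unitmx by rewrite unitmx_tr.
have sc : scalar_curv (g c) x = scalar_curv (g d) (transition c d x).
  rewrite -(tr_ricci_endo (@chart_open c) (chart_gsm ac) (chart_gs ac) (chart_gu ac) cx).
  rewrite -(tr_ricci_endo (@chart_open d) (chart_gsm ad) (chart_gs ad) (chart_gu ad) dy).
  by rewrite law mxtrace_mulC mulmxA mulmxV // mul1mx.
have ec := ricci_eigenvector n5 (@chart_open c) (chart_gsm ac) (chart_gs ac) (chart_gu ac)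
  (sq0 ac) (chart_als ac) (chart_rec ac) (chart_al0 ac) cx.
have ed := ricci_eigenvector n5 (@chart_open d) (chart_gsm ad) (chart_gs ad) (chart_gu ad)
  (sq0 ad) (chart_als ad) (chart_rec ad) (chart_al0 ad) dy.
rewrite !alcE in ec ed.
have e : ricci_eigenvalue (g c) x *: alpha c x = ricci_eigenvalue (g d) (transition c d x) *: alpha c x.
  rewrite -ec law (covector_tensor alpha ac ad ox) !mulmxA mulmxK // ed -scalemxAl //.
have a0 : alpha c x != 0 by case: recurrent => a0 _; apply: a0.
have := e; move/eqP; rewrite -subr_eq0 -scalerBl scaler_eq0 (negbTE a0) orbF subr_eq0 => /eqP.
rewrite /ricci_eigenvalue sc => /addrI /(mulIf _); apply; exact: mu_neq_inv.
Qed.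

End Main.

Theorem mainTheorem4 (R : realType) (n : nat) (M : manifold R n)
    (g : metric M) (alpha : covector_field M)
    (n_ge5 : (5 <= n)%N)
    (recurrent : conformally_recurrent g alpha)
    (weyl_sq_neq0 : forall c, atlas c -> forall x, coords c x ->
       weyl_sq (g c) x != 0)
    (h_not_prop_g : ~ exists phi : M -> R,
       forall c, atlas c -> forall x, coords c x -> forall i j : 'I_n,
         htensor (g c) i j x = phi (cinv c x) * g c x i j) :
  (* (i) *)
  (forall c, atlas c -> forall x, coords c x -> forall k i j : 'I_n,
     nabla2 (g c) (htensor (g c)) k i j x = 0) /\
  (* (ii) *)
  (exists G : M -> R, smooth_scalar G /\
     forall c, atlas c -> forall x, coords c x -> forall i j : 'I_n,
       ricci (g c) i j x - scalar_curv (g c) x / n%:R * g c x i j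
       = G (cinv c x) * ((weyl_sq (g c) x)^-1 * weyl_contr (g c) i j x
                         - n%:R^-1 * g c x i j)) /\
  (* (iii) *)
  (forall c, atlas c -> forall x, coords c x ->
     at_most_two_eigenvalues (ricci_endo (g c) x) /\
     exists rho : R, alpha c x *m ricci_endo (g c) x = rho *: alpha c x).
Proof.
split.
  move=> c ac x cx k i j.
  exact: (htensor_parallel n_ge5 (@chart_open R n M c) (chart_gsm g ac) (chart_gs g ac) (chart_gu g ac) (weyl_sq_neq0 _ ac)
    (chart_rec recurrent ac) k i j cx).
split; last first.
  move=> c ac x cx; split.
    exact: (ricci_two_eigenvalues n_ge5 (@chart_open R n M c) (chart_gsm g ac) (chart_gs g ac) (chart_gu g ac)
     (weyl_sq_neq0 _ ac) (chart_als alpha ac) (chart_rec recurrent ac) (chart_al0 recurrent ac) cx).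
  have := ricci_eigenvector n_ge5 (@chart_open R n M c) (chart_gsm g ac) (chart_gs g ac) (chart_gu g ac)
     (weyl_sq_neq0 _ ac) (chart_als alpha ac) (chart_rec recurrent ac) (chart_al0 recurrent ac) cx.
  by rewrite alcE => e; exists (ricci_eigenvalue (g c) x).
(* G is computed at each point in an arbitrarily chosen chart around it; [GE] then replaces that
   chart by any other. *)
have /choice[ch chP] : forall p : M, exists d, atlas d /\ cdom d p.
  by move=> p; have [d ad dp] := atlas_cover p; exists d.
pose G p := ricciG (g (ch p)) (cmap (ch p) p).
have GE c x : atlas c -> coords c x -> G (cinv c x) = ricciG (g c) x.
  move=> ac cx; have [ad dp] := chP (cinv c x).
  by rewrite (ricciG_invariant n_ge5 recurrent weyl_sq_neq0 ac ad (overlapP cx dp)).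
exists G; split=> [c ac|c ac x cx i j].
  apply: (eq_smooth (@chart_open R n M c) (f := ricciG (g c))) => [y cy|]; first by rewrite GE.
  exact: (ricciG_smooth n_ge5 (@chart_open R n M c) (chart_gsm g ac) (chart_gs g ac) (chart_gu g ac) (weyl_sq_neq0 _ ac)).
rewrite GE //.
exact: (ricci_decomp n_ge5 (@chart_open R n M c) (chart_gsm g ac) (chart_gs g ac) (chart_gu g ac)
     (weyl_sq_neq0 _ ac) (chart_als alpha ac) (chart_rec recurrent ac) (chart_al0 recurrent ac) i j cx).
Qed.
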